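(* Let $(M,g)$ be a 4-dimensional spacetime and $\{s,\underline{s},\vartheta\}$ a double null coordinate system on $(M,g)$, constructed from two null hypersurfaces $C_0=\{s=0\}$ and $\underline{C}_0=\{\underline{s}=0\}$ intersecting at the spacelike surface $\Sigma_{0,0}=\{s=\underline{s}=0\}$. Let $\mathcal{H}$ be a smooth hypersurface containing $\Sigma_{0,0}$. Assume that $\mathcal{H}$ can be parametrised as the graph of a function $h$ of the independent variables $(\underline{s},\vartheta)$, $$\mathcal{H}=\{(s,\underline{s},\vartheta)=(h(\underline{s},\vartheta),\underline{s},\vartheta)\},\qquad \psi_h:(\underline{s},\vartheta)\mapsto (h(\underline{s},\vartheta),\underline{s},\vartheta)\in\mathcal{H}.$$ If every spacelike section $\Sigma$ of $\mathcal{H}$ is a marginal surface with $\mathrm{tr}\,\chi_{\Sigma}\equiv 0$, then $\mathcal{H}$ is null, which is equivalent to $h\equiv 0$; therefore $\mathcal{H}$ is a tangential null marginal tube.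
   Context: All objects are smooth. $(M,g)$ is a 4-dimensional time-oriented Lorentzian manifold with signature $(-,+,+,+)$. No field equation or energy condition is assumed, and no assumption is made on the topology of the surfaces. Double null coordinates. $C_0,\underline{C}_0$ are null hypersurfaces intersecting at a spacelike surface $\Sigma_{0,0}$. $s$ is a function on $\underline{C}_0$ decreasing in the future direction, $\underline{s}$ is a function on $C_0$ increasing in the future direction, and $s=\underline{s}=0$ on $\Sigma_{0,0}$. They are extended to a neighbourhood by the eikonal equations $g(\nabla s,\nabla s)=g(\nabla\underline{s},\nabla\underline{s})=0$, with level sets $C_s$, $\underline{C}_{\underline{s}}$ (null hypersurfaces; $C_0,\underline{C}_0$ are the zero level sets of $s,\underline{s}$), and $\Sigma_{s,\underline{s}}=C_s\cap\underline{C}_{\underline{s}}$. Put $L'=2\nabla s$, $\underline{L}'=2\nabla\underline{s}$, $2\Omega^{-2}=g(L',\underline{L}')$ ($\Omega>0$), $L=\Omega^2L'$, $\underline{L}=\Omega^2\underline{L}'$. Then $g(L,\underline{L})=2\Omega^2$, $L\underline{s}=1$, $\underline{L}s=1$. Coordinates $\vartheta=(\theta^1,\theta^2)$ on $\Sigma_{0,0}$ are extended to $\underline{C}_0$ to be constant along integral curves of $\underline{L}$, then to a neighbourhood of $\underline{C}_0$ to be constant along integral curves of $L$. Thus $\partial_{\underline{s}}=L$, $\partial_s=\underline{L}-b$ with $b=b^i\partial_i$ tangent to $\Sigma_{s,\underline{s}}$, and $$g=2\Omega^2(ds\otimes d\underline{s}+d\underline{s}\otimes ds)+\not{g}_{ij}(d\theta^i-b^ids)\otimes(d\theta^j-b^jds).$$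 When $\Sigma_{0,0}$ is not covered by one chart, $\vartheta$ is regarded as a point of $\Sigma_{0,0}$. The function $h$ is smooth on an open set of pairs $(\underline{s},\vartheta)$ containing all $(0,\vartheta)$, $\vartheta\in\Sigma_{0,0}$, and such that for each $\vartheta$ the set of admissible $\underline{s}$ is an interval. Since $\Sigma_{0,0}\subset\mathcal{H}$, $h(0,\vartheta)=0$. Spacelike sections. A spacelike section of $\mathcal{H}$ is a spacelike 2-surface $\Sigma\subset\mathcal{H}$ (not required to be closed or complete) that is a graph $\vartheta\mapsto(s,\underline{s},\vartheta)=(f(\vartheta),\underline{f}(\vartheta),\vartheta)$ over an open set of $\vartheta$, with $B_i^j=\delta_i^j-f_ib^j$ invertible, where $f_i=\partial f/\partial\theta^i$, $\underline{f}_i=\partial\underline{f}/\partial\theta^i$. Its tangent frame is $\dot\partial_i=\partial_i+f_i\partial_s+\underline{f}_i\partial_{\underline{s}}$. Null expansion. $\mathrm{tr}\,\chi_\Sigma$ is the trace, with respect to the induced metric on $\Sigma$, of $g(\nabla_XL_\Sigma,Y)$ ($X,Y$ tangent to $\Sigma$), where $L_\Sigma=L+\varepsilon\underline{L}+\varepsilon^k\partial_k$ is the null normal of $\Sigma$ with $$\varepsilon=\frac{-|e|^2}{(2\Omega^2+e\cdot\underline{e})+\sqrt{(2\Omega^2+e\cdot\underline{e})^2-|e|^2|\underline{e}|^2}},\qquad \varepsilon^k=e^k+\varepsilon\,\underline{e}^k,$$ $$e^k=-2\Omega^2f_i(B^{-1})^i_j(\not{g}^{-1})^{jk},\qquad \underline{e}^k=-2\Omega^2\underline{f}_i(B^{-1})^i_j(\not{g}^{-1})^{jk},$$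 norms and inner products being taken with respect to $\not{g}$. (The vanishing of $\mathrm{tr}\,\chi_\Sigma$ is unchanged when $L_\Sigma$ is rescaled by a nonvanishing function.) A surface $\Sigma$ is marginal if at least one of its two future null expansions vanishes identically; by convention the vanishing one is denoted $\mathrm{tr}\,\chi_\Sigma$. A marginal tube is a 3-dimensional hypersurface foliated by marginal surfaces, such that the null normal direction with vanishing null expansion is continuous. A tangential null marginal tube is a marginal tube which is a null hypersurface and whose null expansion with respect to its tangential future null vector field vanishes. *)

(* Defs.v *)
From HB Require Import structures.
From mathcomp Require Import all_boot all_order all_algebra.
From mathcomp Require Import all_classical all_reals all_analysis.
Set Implicit Arguments.
Unset Strict Implicit.
Unset Printing Implicit Defensive.
Import Order.TTheory GRing.Theory Num.Theory.
Import numFieldNormedType.Exports.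
Local Open Scope classical_set_scope.
Local Open Scope ring_scope.

Definition partial {R : realType} {n : nat} (i : 'I_n)
    (f : 'rV[R]_n -> R) (x : 'rV[R]_n) : R :=
  'D_(delta_mx 0 i) f x.

(* Meant for open A only. *)
Fixpoint Ck {R : realType} {n : nat} (k : nat)
    (A : set 'rV[R]_n) (f : 'rV[R]_n -> R) : Prop :=
  match k with
  | 0 => forall x, A x -> {for x, continuous f}
  | k'.+1 => (forall x, A x -> {for x, continuous f}) /\
      forall i : 'I_n, (forall x, A x -> derivable f x (delta_mx 0 i)) /\
                       Ck k' A (partial i f)
  end.

Definition smooth_on {R : realType} {n : nat}
    (A : set 'rV[R]_n) (f : 'rV[R]_n -> R) : Prop :=
  forall k, Ck k A f.

Definition smooth_map_on {R : realType} {n m : nat}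
    (A : set 'rV[R]_n) (F : 'rV[R]_n -> 'rV[R]_m) : Prop :=
  forall j : 'I_m, smooth_on A (fun x => F x 0 j).

(* [cinv] is the inverse of [cmap] on its image, and is unconstrained
   elsewhere. *)
Record chart (R : realType) (n : nat) (T : Type) := Chart {
  cdom : set T;
  cmap : T -> 'rV[R]_n;
  cinv : 'rV[R]_n -> T }.

Definition cimg {R : realType} {n : nat} {T : Type} (c : chart R n T)
  : set 'rV[R]_n := cmap c @` cdom c.

Record is_chart {R : realType} {n : nat} {T : topologicalType}
    (c : chart R n T) : Prop := {
  chart_open_dom : open (cdom c);
  chart_open_img : open (cimg c);
  chart_cancel : forall p, cdom c p -> cinv c (cmap c p) = p;
  chart_continuous : forall p, cdom c p -> {for p, continuous (cmap c)};
  chart_continuous_inv : forall x, cimg c x -> {for x, continuous (cinv c)} }.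

Definition smooth_transition {R : realType} {n : nat} {T : Type}
    (c c' : chart R n T) : Prop :=
  smooth_map_on (cmap c @` (cdom c `&` cdom c')) (cmap c' \o cinv c).

Record smooth_structure (R : realType) (n : nat) (T : topologicalType) := {
  atlas : set (chart R n T);
  atlas_chart : forall c, atlas c -> is_chart c;
  atlas_cover : forall p : T, exists2 c, atlas c & cdom c p;
  atlas_compat : forall c c', atlas c -> atlas c' -> smooth_transition c c';
  manifold_hausdorff : hausdorff_space T;
  manifold_second_countable : @second_countable T }.

Definition smooth_chart {R : realType} {n : nat} {T : topologicalType}
    (A : smooth_structure R n T) (c : chart R n T) : Prop :=
  is_chart c /\
  forall c', atlas A c' -> smooth_transition c c' /\ smooth_transition c' c.

Definition smooth_fun {R : realType} {n : nat} {T : topologicalType}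
    (A : smooth_structure R n T) (W : set T) (f : T -> R) : Prop :=
  forall p, W p -> exists c, [/\ smooth_chart A c, cdom c p &
    smooth_on (cmap c @` (W `&` cdom c)) (f \o cinv c)].

(* Row-vector convention: if the row X holds the components of a tangent
   vector in the chart c, then X *m jac c c' p holds those in c'. *)
Definition jac {R : realType} {n : nat} {T : Type} (c c' : chart R n T) (p : T)
  : 'M[R]_n :=
  \matrix_(i, j) partial i (fun x => cmap c' (cinv c x) 0 j) (cmap c p).

Definition vector_field {R : realType} {n : nat} {T : topologicalType}
    (A : smooth_structure R n T) (W : set T)
    (X : chart R n T -> T -> 'rV[R]_n) : Prop :=
  forall c c' p, smooth_chart A c -> smooth_chart A c' ->
    W p -> cdom c p -> cdom c' p -> X c' p = X c p *m jac c c' p.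

Definition ip {R : realType} {n : nat} (G : 'M[R]_n) (X Y : 'rV[R]_n) : R :=
  (X *m G *m Y^T) 0 0.

Definition posdef {R : realType} {n : nat} (G : 'M[R]_n) : Prop :=
  forall v : 'rV[R]_n, v != 0 -> 0 < ip G v v.

Definition minkowski {R : realType} : 'M[R]_4 :=
  diag_mx (\row_(i < 4) if i == 0 then -1 else 1).

Record lorentz_metric (R : realType) (M : topologicalType)
    (A : smooth_structure R 4 M) := {
  metric :> chart R 4 M -> M -> 'M[R]_4;
  metric_sym : forall c p, smooth_chart A c -> cdom c p ->
    (metric c p)^T = metric c p;
  metric_signature : forall c p, smooth_chart A c -> cdom c p ->
    exists2 P : 'M[R]_4, P \in unitmx & P *m metric c p *m P^T = minkowski;
  metric_smooth : forall c, smooth_chart A c -> forall i j : 'I_4,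
    smooth_on (cimg c) (fun x => metric c (cinv c x) i j);
  metric_tensor : forall c c' p, smooth_chart A c -> smooth_chart A c' ->
    cdom c p -> cdom c' p ->
    metric c p = jac c c' p *m metric c' p *m (jac c c' p)^T }.

Record time_orientation (R : realType) (M : topologicalType)
    (A : smooth_structure R 4 M) (g : lorentz_metric A) := {
  tvec :> chart R 4 M -> M -> 'rV[R]_4;
  tvec_field : vector_field A setT tvec;
  tvec_smooth : forall c, smooth_chart A c ->
    smooth_map_on (cimg c) (tvec c \o cinv c);
  tvec_timelike : forall c p, smooth_chart A c -> cdom c p ->
    ip (g c p) (tvec c p) (tvec c p) < 0 }.

Definition future_null {R : realType} {M : topologicalType}
    {A : smooth_structure R 4 M} {g : lorentz_metric A}
    (T : time_orientation g) (c : chart R 4 M) (p : M) (X : 'rV[R]_4) : Prop :=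
  [/\ X != 0, ip (g c p) X X = 0 & ip (g c p) (T c p) X < 0].

Definition dfun {R : realType} {n : nat} {T : Type} (c : chart R n T)
    (f : T -> R) (p : T) : 'rV[R]_n :=
  \row_i partial i (f \o cinv c) (cmap c p).

Definition grad {R : realType} {M : topologicalType}
    {A : smooth_structure R 4 M} (g : lorentz_metric A)
    (c : chart R 4 M) (f : M -> R) (p : M) : 'rV[R]_4 :=
  dfun c f p *m invmx (g c p).

(* Below, G is the matrix of metric components as a function of the
   coordinates of a chart. *)
Definition metric_in {R : realType} {M : topologicalType}
    {A : smooth_structure R 4 M} (g : lorentz_metric A) (c : chart R 4 M)
    (x : 'rV[R]_4) : 'M[R]_4 := g c (cinv c x).

(* Gamma^m_{ab} of the Levi-Civita connection *)
Definition christoffel {R : realType} (G : 'rV[R]_4 -> 'M[R]_4)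
    (x : 'rV[R]_4) (m a b : 'I_4) : R :=
  2^-1 * \sum_(l < 4) invmx (G x) m l *
    (partial a (fun z => G z l b) x + partial b (fun z => G z l a) x
     - partial l (fun z => G z a b) x).

(* For a k-dimensional submanifold z |-> F z, written in a chart, and a vector
   field N along it: tangent frame, first fundamental form, covariant
   derivative of N along the a-th frame vector, and the form
   (a, b) |-> g (nabla_{F_a} N, F_b). *)
Definition frame {R : realType} {k : nat} (F : 'rV[R]_k -> 'rV[R]_4)
    (a : 'I_k) (z : 'rV[R]_k) : 'rV[R]_4 :=
  \row_m partial a (fun w => F w 0 m) z.

Definition first_form {R : realType} {k : nat} (G : 'rV[R]_4 -> 'M[R]_4)
    (F : 'rV[R]_k -> 'rV[R]_4) (z : 'rV[R]_k) : 'M[R]_k :=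
  \matrix_(a, b) ip (G (F z)) (frame F a z) (frame F b z).

Definition cov_deriv {R : realType} {k : nat} (G : 'rV[R]_4 -> 'M[R]_4)
    (F N : 'rV[R]_k -> 'rV[R]_4) (a : 'I_k) (z : 'rV[R]_k) : 'rV[R]_4 :=
  \row_m (partial a (fun w => N w 0 m) z +
    \sum_(i < 4) \sum_(j < 4)
      christoffel G (F z) m i j * frame F a z 0 i * N z 0 j).

Definition chi_form {R : realType} {k : nat} (G : 'rV[R]_4 -> 'M[R]_4)
    (F N : 'rV[R]_k -> 'rV[R]_4) (z : 'rV[R]_k) : 'M[R]_k :=
  \matrix_(a, b) ip (G (F z)) (cov_deriv G F N a z) (frame F b z).

Definition null_expansion {R : realType} (G : 'rV[R]_4 -> 'M[R]_4)
    (F N : 'rV[R]_2 -> 'rV[R]_4) (y : 'rV[R]_2) : R :=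
  \tr (invmx (first_form G F y) *m chi_form G F N y).

Definition slice_chart {R : realType} {M : topologicalType}
    (A : smooth_structure R 4 M) (H : set M) (c : chart R 4 M) : Prop :=
  smooth_chart A c /\ H `&` cdom c = cdom c `&` [set p | cmap c p 0 0 = 0].

Definition smooth_hypersurface {R : realType} {M : topologicalType}
    (A : smooth_structure R 4 M) (H : set M) : Prop :=
  forall p, H p -> exists2 c, slice_chart A H c & cdom c p.

(* In a slice chart the tangent space of H is {X | X^0 = 0}; H is null when the
   metric degenerates on its tangent spaces. *)
Definition null_hypersurface {R : realType} {M : topologicalType}
    {A : smooth_structure R 4 M} (g : lorentz_metric A) (H : set M) : Prop :=
  forall p, H p -> exists c, [/\ slice_chart A H c, cdom c p &
    exists X : 'rV[R]_4, [/\ X != 0, X 0 0 = 0 &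
      forall Y : 'rV[R]_4, Y 0 0 = 0 -> ip (g c p) X Y = 0]].

(* In a foliated chart each leaf is a countable union of slices
   {x^0 = 0, x^1 = t}. *)
Definition foliated_chart {R : realType} {M : topologicalType}
    (A : smooth_structure R 4 M) (H : set M) (leaves : set (set M))
    (c : chart R 4 M) : Prop :=
  slice_chart A H c /\
  forall l, leaves l -> exists2 J : set R, countable J &
    l `&` cdom c =
    cdom c `&` [set p | cmap c p 0 0 = 0 /\ J (cmap c p 0 1)].

(* Leaves are not required to be connected, as no assumption is made on the
   topology of the surfaces. *)
Definition foliation {R : realType} {M : topologicalType}
    (A : smooth_structure R 4 M) (H : set M) (leaves : set (set M)) : Prop :=
  [/\ forall l, leaves l -> l !=set0,
      \bigcup_(l in leaves) l = H,
      forall l l', leaves l -> leaves l' -> l `&` l' !=set0 -> l = l' &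
      forall p, H p -> exists2 c, foliated_chart A H leaves c & cdom c p].

Definition pt4 {R : realType} (a b : R) (y : 'rV[R]_2) : 'rV[R]_(2 + 2) :=
  row_mx (\row_(j < 2) if j == 0 then a else b) y.

(* The slice {x^0 = 0, x^1 = t} of the chart is spacelike, N is a smooth
   normal field of it (nullness of N is imposed separately), and its expansion along N vanishes. *)
Definition marginal_slice {R : realType} {M : topologicalType}
    {A : smooth_structure R 4 M} (g : lorentz_metric A)
    (N : chart R 4 M -> M -> 'rV[R]_4) (c : chart R 4 M) (t : R) : Prop :=
  let F y := pt4 0 t y in
  let Nt y := N c (cinv c (F y)) in
  let Y := [set y | cimg c (F y)] in
  smooth_map_on Y Nt /\
  forall y, Y y ->
    [/\ posdef (first_form (metric_in g c) F y),
        forall a : 'I_2, ip (metric_in g c (F y)) (Nt y) (frame F a y) = 0 &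
        null_expansion (metric_in g c) F Nt y = 0].

Definition marginal_tube {R : realType} {M : topologicalType}
    {A : smooth_structure R 4 M} {g : lorentz_metric A}
    (T : time_orientation g) (H : set M) : Prop :=
  smooth_hypersurface A H /\
  exists (leaves : set (set M)) (N : chart R 4 M -> M -> 'rV[R]_4),
    [/\ foliation A H leaves, vector_field A H N &
     forall p, H p -> exists c,
       [/\ foliated_chart A H leaves c, cdom c p,
           {within H `&` cdom c, continuous (N c)},
           forall q, H q -> cdom c q -> future_null T c q (N c q) &
           forall t, marginal_slice g N c t]].

(* The expansion of H with respect to a tangential null field K is the trace of
   g (nabla_X K, Y) over spacelike 2-planes of the tangent spaces of H; the
   rows of E span such a plane. *)
Definition tangential_expansion_zero {R : realType} {M : topologicalType}
    {A : smooth_structure R 4 M} (g : lorentz_metric A)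
    (K : chart R 4 M -> M -> 'rV[R]_4) (c : chart R 4 M) : Prop :=
  let F (z : 'rV[R]_3) : 'rV[R]_(1 + 3) := row_mx 0 z in
  let Kt z := K c (cinv c (F z)) in
  let Z := [set z | cimg c (F z)] in
  smooth_map_on Z Kt /\
  forall z, Z z -> forall E : 'M[R]_(2, 3),
    posdef (E *m first_form (metric_in g c) F z *m E^T) ->
    \tr (invmx (E *m first_form (metric_in g c) F z *m E^T) *m
         (E *m chi_form (metric_in g c) F Kt z *m E^T)) = 0.

Definition tangential_null_marginal_tube {R : realType} {M : topologicalType}
    {A : smooth_structure R 4 M} {g : lorentz_metric A}
    (T : time_orientation g) (H : set M) : Prop :=
  [/\ marginal_tube T H, null_hypersurface g H &
   exists2 K : chart R 4 M -> M -> 'rV[R]_4, vector_field A H K &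
     forall p, H p -> exists c,
       [/\ slice_chart A H c, cdom c p,
           forall q, H q -> cdom c q ->
             future_null T c q (K c q) /\ K c q 0 0 = 0 &
           tangential_expansion_zero g K c]].

(* S is the surface Sigma_{0,0}, as a 2-manifold; theta is the
   Sigma_{0,0}-valued coordinate. [dn_point a b x] is the point of coordinates
   (s, sbar, theta) = (a, b, x), when there is one. *)
Record dn_data (R : realType) (M S : Type) := DnData {
  dn_dom : set M;
  dn_s : M -> R;
  dn_sb : M -> R;
  dn_th : M -> S;
  dn_point : R -> R -> S -> M;
  dn_Om : M -> R }.

Definition dn_chart {R : realType} {M S : Type} (d : dn_data R M S)
    (k : chart R 2 S) : chart R 4 M :=
  @Chart R 4 M
    (dn_dom d `&` [set p | cdom k (dn_th d p)])
    (fun p => pt4 (dn_s d p) (dn_sb d p) (cmap k (dn_th d p)))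
    (fun x : 'rV[R]_(2 + 2) => dn_point d (x 0 (lshift 2 0)) (x 0 (lshift 2 1))
                                 (cinv k (rsubmx x))).

Definition Lprime {R : realType} {M S : topologicalType}
    {A : smooth_structure R 4 M} (g : lorentz_metric A) (d : dn_data R M S)
    (c : chart R 4 M) (p : M) : 'rV[R]_4 := 2 *: grad g c (dn_s d) p.

Definition Lbprime {R : realType} {M S : topologicalType}
    {A : smooth_structure R 4 M} (g : lorentz_metric A) (d : dn_data R M S)
    (c : chart R 4 M) (p : M) : 'rV[R]_4 := 2 *: grad g c (dn_sb d) p.

Definition Lvec {R : realType} {M S : topologicalType}
    {A : smooth_structure R 4 M} (g : lorentz_metric A) (d : dn_data R M S)
    (c : chart R 4 M) (p : M) : 'rV[R]_4 := dn_Om d p ^+ 2 *: Lprime g d c p.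

Definition Lbvec {R : realType} {M S : topologicalType}
    {A : smooth_structure R 4 M} (g : lorentz_metric A) (d : dn_data R M S)
    (c : chart R 4 M) (p : M) : 'rV[R]_4 := dn_Om d p ^+ 2 *: Lbprime g d c p.

Definition vapp {R : realType} {n : nat} {T : Type} (c : chart R n T)
    (X : 'rV[R]_n) (phi : T -> R) (p : T) : R :=
  \sum_i X 0 i * dfun c phi p 0 i.

Record double_null {R : realType} {M S : topologicalType}
    {A : smooth_structure R 4 M} {g : lorentz_metric A}
    (T : time_orientation g) (AS : smooth_structure R 2 S)
    (d : dn_data R M S) : Prop := {
  dn_open : open (dn_dom d);
  dn_pointK : forall p, dn_dom d p ->
    dn_point d (dn_s d p) (dn_sb d p) (dn_th d p) = p;
  dn_smooth_chart : forall k, smooth_chart AS k -> smooth_chart A (dn_chart d k);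
  (* with the previous two fields: theta identifies {s = sbar = 0} with S *)
  dn_sigma00 : forall x : S, exists p,
    [/\ dn_dom d p, dn_s d p = 0, dn_sb d p = 0 & dn_th d p = x];
  dn_eikonal_s : forall c p, smooth_chart A c -> dn_dom d p -> cdom c p ->
    ip (g c p) (grad g c (dn_s d) p) (grad g c (dn_s d) p) = 0;
  dn_eikonal_sb : forall c p, smooth_chart A c -> dn_dom d p -> cdom c p ->
    ip (g c p) (grad g c (dn_sb d) p) (grad g c (dn_sb d) p) = 0;
  dn_Om_gt0 : forall p, dn_dom d p -> 0 < dn_Om d p;
  dn_OmE : forall c p, smooth_chart A c -> dn_dom d p -> cdom c p ->
    2 * dn_Om d p ^- 2 = ip (g c p) (Lprime g d c p) (Lbprime g d c p);
  (* theta is constant along the integral curves of Lbar on {sbar = 0},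
     then along those of L *)
  dn_th_Lb : forall k p (i : 'I_2), smooth_chart AS k ->
    cdom (dn_chart d k) p -> dn_sb d p = 0 ->
    vapp (dn_chart d k) (Lbvec g d (dn_chart d k) p)
      (fun q => cmap k (dn_th d q) 0 i) p = 0;
  dn_th_L : forall k p (i : 'I_2), smooth_chart AS k ->
    cdom (dn_chart d k) p ->
    vapp (dn_chart d k) (Lvec g d (dn_chart d k) p)
      (fun q => cmap k (dn_th d q) 0 i) p = 0;
  (* s decreases to the future on {sbar = 0}, sbar increases to the future on
     {s = 0} *)
  dn_s_decreasing : forall c p X, smooth_chart A c -> dn_dom d p -> cdom c p ->
    dn_sb d p = 0 -> future_null T c p X -> vapp c X (dn_sb d) p = 0 ->
    vapp c X (dn_s d) p < 0;
  dn_sb_increasing : forall c p X, smooth_chart A c -> dn_dom d p -> cdom c p ->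
    dn_s d p = 0 -> future_null T c p X -> vapp c X (dn_s d) p = 0 ->
    0 < vapp c X (dn_sb d) p }.

Record graph_function {R : realType} {M S : topologicalType}
    (AS : smooth_structure R 2 S) (d : dn_data R M S)
    (D : set (R * S)) (h : R -> S -> R) : Prop := {
  graph_open : open D;
  graph_zero : forall x, D (0, x);
  graph_interval : forall x, is_interval [set t | D (t, x)];
  graph_smooth : forall t x, D (t, x) -> exists k,
    [/\ smooth_chart AS k, cdom k x &
        smooth_on
          [set z : 'rV[R]_(1 + 2) | cimg k (rsubmx z) /\
             D (z 0 (lshift 2 0), cinv k (rsubmx z))]
          (fun z : 'rV[R]_(1 + 2) => h (z 0 (lshift 2 0)) (cinv k (rsubmx z)))];
  graph_in_dom : forall t x, D (t, x) -> exists p,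
    [/\ dn_dom d p, dn_s d p = h t x, dn_sb d p = t & dn_th d p = x];
  (* the graph contains Sigma_{0,0} *)
  graph_sigma00 : forall x, h 0 x = 0 }.

Definition graph_hypersurface {R : realType} {M S : Type} (d : dn_data R M S)
    (D : set (R * S)) (h : R -> S -> R) : set M :=
  [set p | [/\ dn_dom d p, D (dn_sb d p, dn_th d p) &
               dn_s d p = h (dn_sb d p) (dn_th d p)]].

(* The graph theta |-> (f, fb, theta) in the coordinates of dn_chart d k. *)
Definition section_map {R : realType} {S : Type} (k : chart R 2 S)
    (f fb : S -> R) (y : 'rV[R]_2) : 'rV[R]_4 :=
  pt4 (f (cinv k y)) (fb (cinv k y)) y.

(* b^i, from d/ds = Lbar - b *)
Definition shift_vec {R : realType} {M S : topologicalType}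
    {A : smooth_structure R 4 M} (g : lorentz_metric A) (d : dn_data R M S)
    (k : chart R 2 S) (p : M) : 'rV[R]_2 :=
  @rsubmx R 1 2 2 (Lbvec g d (dn_chart d k) p).

Definition slash_metric {R : realType} {M S : topologicalType}
    {A : smooth_structure R 4 M} (g : lorentz_metric A) (d : dn_data R M S)
    (k : chart R 2 S) (p : M) : 'M[R]_2 :=
  @drsubmx R 2 2 2 2 (g (dn_chart d k) p).

(* B_i^j = delta_i^j - f_i b^j, with row index i *)
Definition section_B {R : realType} {M S : topologicalType}
    {A : smooth_structure R 4 M} (g : lorentz_metric A) (d : dn_data R M S)
    (k : chart R 2 S) (f : S -> R) (x : S) (p : M) : 'M[R]_2 :=
  1%:M - (dfun k f x)^T *m shift_vec g d k p.

(* e^k = - 2 Omega^2 f_i (B^-1)^i_j (gslash^-1)^{jk}, where the inverse is that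
   of the linear map: B_i^j (B^-1)^k_j = delta_i^k. The lower index j is thus
   the row index of invmx B, hence the transpose. Used for f and for fb, with
   the same B. *)
Definition section_e {R : realType} {M S : topologicalType}
    {A : smooth_structure R 4 M} (g : lorentz_metric A) (d : dn_data R M S)
    (k : chart R 2 S) (B : 'M[R]_2) (phi : S -> R) (x : S) (p : M)
  : 'rV[R]_2 :=
  - (2 * dn_Om d p ^+ 2) *:
    (dfun k phi x *m (invmx B)^T *m invmx (slash_metric g d k p)).

Definition section_L {R : realType} {M S : topologicalType}
    {A : smooth_structure R 4 M} (g : lorentz_metric A) (d : dn_data R M S)
    (k : chart R 2 S) (f fb : S -> R) (y : 'rV[R]_2) : 'rV[R]_4 :=
  let c := dn_chart d k in
  let x := cinv k y in
  let p := cinv c (section_map k f fb y) in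
  let sg := slash_metric g d k p in
  let B := section_B g d k f x p in
  let e := section_e g d k B f x p in
  let eb := section_e g d k B fb x p in
  let a := 2 * dn_Om d p ^+ 2 + ip sg e eb in
  let eps := - ip sg e e /
             (a + Num.sqrt (a ^+ 2 - ip sg e e * ip sg eb eb)) in
  Lvec g d c p + eps *: Lbvec g d c p
  + (row_mx 0 (e + eps *: eb) : 'rV[R]_(2 + 2)).

(* The pointwise conditions of the last field do not depend on the chart. *)
Record spacelike_section {R : realType} {M S : topologicalType}
    {A : smooth_structure R 4 M} (g : lorentz_metric A)
    (AS : smooth_structure R 2 S) (d : dn_data R M S)
    (D : set (R * S)) (h : R -> S -> R)
    (W : set S) (f fb : S -> R) : Prop := {
  section_open : open W;
  section_smooth_f : smooth_fun AS W f;
  section_smooth_fb : smooth_fun AS W fb;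
  section_in_graph : forall x, W x -> D (fb x, x) /\ f x = h (fb x) x;
  section_spacelike : forall x, W x -> exists k,
    [/\ smooth_chart AS k, cdom k x,
        posdef (first_form (metric_in g (dn_chart d k))
                  (section_map k f fb) (cmap k x)) &
        section_B g d k f x (dn_point d (f x) (fb x) x) \in unitmx] }.

Definition section_expansion {R : realType} {M S : topologicalType}
    {A : smooth_structure R 4 M} (g : lorentz_metric A) (d : dn_data R M S)
    (k : chart R 2 S) (f fb : S -> R) (x : S) : R :=
  null_expansion (metric_in g (dn_chart d k)) (section_map k f fb)
    (section_L g d k f fb) (cmap k x).

Definition section_marginal {R : realType} {M S : topologicalType}
    {A : smooth_structure R 4 M} (g : lorentz_metric A)
    (AS : smooth_structure R 2 S) (d : dn_data R M S)
    (W : set S) (f fb : S -> R) : Prop :=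
  forall k x, smooth_chart AS k -> W x -> cdom k x ->
    section_expansion g d k f fb x = 0.

(* Main.v *)
Require Import Defs.
From HB Require Import structures.
From mathcomp Require Import all_boot all_order all_algebra.
From mathcomp Require Import all_classical all_reals all_analysis.
From mathcomp Require Import ring lra.
Set Implicit Arguments.
Unset Strict Implicit.
Unset Printing Implicit Defensive.
Import Order.TTheory GRing.Theory Num.Theory.
Import numFieldNormedType.Exports.
Local Open Scope classical_set_scope.
Local Open Scope ring_scope.

(** In a double null chart the inverse metric satisfies g^00 = g^11 = g^0i = 0.
    Hence L is the coordinate field d/dsb, g(L, .) = 2 Om^2 ds and
    g(Lb, .) = 2 Om^2 dsb ([dn_formP], [dnf_LE], [dnf_ip_L], [dnf_ip_Lb]).  A
    hypersurface s = h(sb, theta) is null exactly where the differential of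
    s - h is null, which reads ([gr_sqE])

      h_t (g^01 - g^1l h_l) = 1/2 g^ij h_i h_j,

    where h_t is the derivative in sb and h_i are the angular derivatives.

    Nullness forces h = 0.  At a point where the angular gradient vanishes the
    bracket is g^01, which is not zero.  Near such a point h_t is therefore a
    quadratic form in the angular gradient.  Differentiating this equation in
    the angular variables gives a linear homogeneous ordinary differential
    equation for the angular gradient along each line theta = const
    ([quadratic_flow]), so that its zeros, and those of h, propagate.  Since
    h(0, .) = 0, an open and closed argument along the interval of admissible
    sb yields h = 0 ([graph_zero_of_null]).  This argument uses the null
    equation only near points where the angular gradient vanishes.

    Marginality of the sections gives the null equation at these points.  Near
    such a point the section sb = const is spacelike ([gr_good_flat],
    [ts_spacelike]).  It is compared with the section sb = const + c |y - y1|^2,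
    which has the same point, tangent plane and normal N at y1.  For tangent
    vectors F_b the identity g(N, F_b) = 0 trades the derivative of N for second
    derivatives of the section ([chi_form_normal]), so that the two expansions
    differ by a nonzero multiple of g(N, h_t d/ds + d/dsb)
    ([null_expansion_diff]).  Both expansions vanish, so that N is orthogonal to
    the whole tangent space of the graph.  It is then proportional to the
    gradient of s - h, which is null because N is ([marginal_gr_sq]).

    Conversely, when h = 0 the hypersurface is part of s = 0, to which L is both
    tangent and orthogonal ([tube_null]).  It is foliated by the level sets of
    sb, which are the sections with f = 0 and fb constant.  Their normal is L,
    so their expansions vanish by hypothesis ([slice_expansion]).  The metric
    and the second fundamental form of s = 0 degenerate along L, so that the
    tangential expansion is that of these leaves ([tube_tangential]). *)

(** * Differential calculus in finite dimension *)

Lemma derivable_ext_open (R : realType) (V : normedModType R) (A : set V)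
    (f g : V -> R) (x v : V) : open A -> A x ->
  (forall y, A y -> f y = g y) -> derivable f x v -> derivable g x v.
Proof.
move=> oA Ax fg; apply: near_eq_derivable.
by near=> y; apply: fg; near: y; exact: open_nbhs_nbhs.
Unshelve. all: by end_near. Qed.

Lemma derive_ext_open (R : realType) (V : normedModType R) (A : set V)
    (f g : V -> R) (x v : V) : open A -> A x ->
  (forall y, A y -> f y = g y) -> 'D_v f x = 'D_v g x.
Proof.
move=> oA Ax fg; apply: near_eq_derive.
by near=> y; apply: fg; near: y; exact: open_nbhs_nbhs.
Unshelve. all: by end_near. Qed.

Lemma continuous_ext_open (R : realType) (V W : topologicalType) (A : set V)
    (f g : V -> W) (x : V) : open A -> A x ->
  (forall y, A y -> f y = g y) -> {for x, continuous f} ->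
  {for x, continuous g}.
Proof.
move=> oA Ax fg cf; rewrite /prop_for /continuous_at -(fg _ Ax).
apply: cvg_trans cf; apply: near_eq_cvg.
by near=> y; apply: fg; near: y; exact: open_nbhs_nbhs.
Unshelve. all: by end_near. Qed.

Lemma is_derive_line (R : realType) (V : normedModType R) (f : V -> R)
    (z v : V) (s : R) : derivable f (s *: v + z) v ->
  is_derive s 1 (fun t => f (t *: v + z)) ('D_v f (s *: v + z)).
Proof.
have E : (fun h : R => h^-1 *: (((fun t => f (t *: v + z)) \o shift s) (h *: 1)
    - f (s *: v + z))) =
  (fun h : R => h^-1 *: ((f \o shift (s *: v + z)) (h *: v) - f (s *: v + z))).
  by apply/funext => h /=; rewrite [h *: 1]mulr1 scalerDl addrA.
move=> df; split; first by rewrite /derivable E.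
by rewrite /derive E.
Qed.

(** The increment [t] may be negative: the mean value theorem is then applied
    on [[t, 0]]. *)
Lemma mvt_line (R : realType) (V : normedModType R) (f : V -> R)
    (z v : V) (t : R) :
  (forall s : R, `|s| <= `|t| -> derivable f (s *: v + z) v) ->
  exists2 s, `|s| <= `|t| &
    f (t *: v + z) - f z = t * 'D_v f (s *: v + z).
Proof.
move=> df; set phi := fun s : R => f (s *: v + z).
have phi0 : phi 0 = f z by rewrite /phi scale0r add0r.
have dphi (s : R) : `|s| <= `|t| -> is_derive s 1 phi ('D_v f (s *: v + z)).
  by move=> st; apply/is_derive_line/df.
have [t0|t0] := leP 0 t.
- have bnd (s : R) : s \in `[0, t] -> `|s| <= `|t|.
    by rewrite in_itv/= => /andP[s0 st]; rewrite !ger0_norm.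
  have [||c /bnd ct E] := @MVT_segment R phi (fun s => 'D_v f (s *: v + z)) 0 t t0.
  + by move=> s; rewrite in_itv/= => /andP[s0 st]; apply: dphi;
      rewrite !ger0_norm // ltW.
  + apply: derivable_within_continuous => s /bnd st.
    exact: (@ex_derive _ _ _ _ _ _ _ (dphi _ st)).
  by exists c => //; rewrite -phi0 E subr0 mulrC.
- have bnd (s : R) : s \in `[t, 0] -> `|s| <= `|t|.
    by rewrite in_itv/= => /andP[s0 st]; rewrite !ler0_norm ?lerN2 // ltW.
  have [||c /bnd ct E] :=
      @MVT_segment R phi (fun s => 'D_v f (s *: v + z)) t 0 (ltW t0).
  + by move=> s; rewrite in_itv/= => /andP[s0 st]; apply: dphi;
      rewrite !ler0_norm ?lerN2 // ltW.
  + apply: derivable_within_continuous => s /bnd st.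
    exact: (@ex_derive _ _ _ _ _ _ _ (dphi _ st)).
  exists c => //; rewrite -phi0 -[LHS]opprB.
  by rewrite -/(phi t) E sub0r mulrN opprK mulrC.
Qed.

Lemma near_ballP (R : realType) (V : normedModType R) (x : V) (P : V -> Prop) :
  (\forall y \near x, P y) <->
  exists2 r : R, 0 < r & forall y, `|y - x| < r -> P y.
Proof.
split=> [/nbhs_ballP[r r0 rP]|[r r0 rP]].
  by exists r => // y yx; apply: rP; rewrite -ball_normE /= distrC.
apply/nbhs_ballP; exists r => // y; rewrite -ball_normE /= distrC; exact: rP.
Qed.

Lemma norm_delta (R : realType) n (i : 'I_n) (s : R) :
  `|s *: (delta_mx 0 i : 'rV[R]_n)| = `|s|.
Proof.
apply/eqP; rewrite eq_le; apply/andP; split.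
  rewrite [leLHS]/Num.Def.normr/= mx_normrE; apply: bigmax_le => //= -[a b] _.
  by rewrite !mxE; case: eqP => _; case: eqP => _ /=; rewrite ?mulr1 ?mulr0 ?normr0.
rewrite [leRHS]/Num.Def.normr/= mx_normrE.
apply: le_trans (le_bigmax _ _ (0, i)) => /=.
by rewrite !mxE !eqxx mulr1.
Qed.

Lemma norm_coord (R : realType) n (v : 'rV[R]_n) i : `|v 0 i| <= `|v|.
Proof.
rewrite [leRHS]/Num.Def.normr/= mx_normrE.
exact: (le_bigmax _ _ (0, i)).
Qed.

Lemma norm_rowP (R : realType) n (v : 'rV[R]_n) (r : R) : 0 <= r ->
  (forall i, `|v 0 i| <= r) -> `|v| <= r.
Proof.
move=> r0 vr; rewrite [leLHS]/Num.Def.normr/= mx_normrE.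
by apply: bigmax_le => //= -[a b] _; rewrite (ord1 a) /=; exact: vr.
Qed.

Lemma continuous_row (R : realType) (V : topologicalType) n (F : V -> 'rV[R]_n)
    (x : V) : (forall j, {for x, continuous (fun y => F y 0 j)}) ->
  {for x, continuous F}.
Proof.
move=> cF; apply: (@cvgrPdist_le _ _ _ (nbhs x) (nbhs_filter x) F (F x)).2 => e e0.
have : \forall y \near x, forall j, `|F x 0 j - F y 0 j| <= e.
  apply: (@filter_forall _ _ _ _ (nbhs_filter x)) => j.
  by move/cvgrPdist_le : (cF j) => /(_ _ e0).
apply: filterS => y Hy; apply: norm_rowP; first exact: ltW.
by move=> j; rewrite !mxE.
Qed.

(** Moving from [x] to [x + h] one coordinate at a time, the mean value theorem
    bounds the error of the linear approximation. *)
Lemma partial_approx (R : realType) n (f : 'rV[R]_n -> R) (x : 'rV[R]_n) :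
  (\forall y \near x, forall i, derivable f y (delta_mx 0 i)) ->
  (forall i, {for x, continuous (partial i f)}) ->
  forall e, 0 < e -> \forall h \near (0 : 'rV[R]_n),
    `|f (h + x) - f x - \sum_i h 0 i * partial i f x| <= e * `|h|.
Proof.
move=> df cf e e0.
pose e1 := e / n.+1%:R.
have e10 : 0 < e1 by rewrite divr_gt0.
have near1 : \forall y \near x, (forall i, derivable f y (delta_mx 0 i)) /\
    forall i, `|partial i f y - partial i f x| <= e1.
  near=> y; split; first by near: y.
  near: y; apply: filter_forall => i.
  near=> y; rewrite distrC; near: y.
  by move/cvgrPdist_le : (cf i) => /(_ _ e10).
have [r r0 rP] := (near_ballP _ _).1 near1.
apply/near_ballP; exists r => // h; rewrite subr0 => hr.
(* [hk k] keeps the first [k] coordinates of [h]: these are the vertices of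
   the path from [x] to [h + x]. *)
pose hk k : 'rV[R]_n := \row_j if (j < k)%N then h 0 j else 0.
have hkn : hk n = h by apply/rowP => j; rewrite mxE ltn_ord.
have hk0 : hk 0%N = 0 by apply/rowP => j; rewrite !mxE.
have key k : (k <= n)%N ->
    `|f (hk k + x) - f x - \sum_(i < n | (i < k)%N) h 0 i * partial i f x|
      <= k%:R * e1 * `|h|.
  elim: k => [_|k IH kn].
    by rewrite hk0 add0r big_pred0 // !subrr normr0 !mul0r.
  pose ik := Ordinal kn.
  have hkS : hk k.+1 = h 0 ik *: delta_mx 0 ik + hk k.
    apply/rowP => j; rewrite !mxE eqxx /= ltnS leq_eqVlt -val_eqE /=.
    case: eqP => [jk|_] /=; last by rewrite mulr0 add0r.
    by rewrite jk ltnn mulr1 addr0; congr (h 0 _); apply: val_inj.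
  have [|s sh E] := @mvt_line _ _ f (hk k + x) (delta_mx 0 ik) (h 0 ik).
    move=> s sh; apply: (rP _ _).1; rewrite addrA addrK.
    apply: le_lt_trans hr; apply: norm_rowP => // j; rewrite !mxE eqxx /=.
    rewrite -val_eqE /=; case: eqP => [->|_] /=.
      by rewrite ltnn addr0 mulr1 (le_trans sh) ?norm_coord.
    rewrite mulr0 add0r; case: ifP => _; rewrite ?normr0 ?norm_coord //.
  have sr : `|partial ik f (s *: delta_mx 0 ik + (hk k + x)) - partial ik f x| <= e1.
    apply: (rP _ _).2; rewrite addrA addrK.
    apply: le_lt_trans hr; apply: norm_rowP => // j; rewrite !mxE eqxx /=.
    rewrite -val_eqE /=; case: eqP => [->|_] /=.
      by rewrite ltnn addr0 mulr1 (le_trans sh) ?norm_coord.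
    rewrite mulr0 add0r; case: ifP => _; rewrite ?normr0 ?norm_coord //.
  rewrite (bigD1 ik) ?leqnn //=.
  rewrite (eq_bigl (fun i : 'I_n => (i < k)%N)); last first.
    move=> i; rewrite ltnS leq_eqVlt -val_eqE /=.
    by case: eqP => [->|_] /=; rewrite ?ltnn ?andbF ?andbT.
  move/eqP: E; rewrite subr_eq => /eqP E; rewrite hkS -[_ + hk k + x]addrA E.
  set S1 := \sum_(i < n | _) _.
  rewrite [X in `|X|](_ : _ = h 0 ik * ('D_(delta_mx 0 ik) f
      (s *: delta_mx 0 ik + (hk k + x)) - partial ik f x)
      + (f (hk k + x) - f x - S1)); last by ring.
  apply: le_trans (ler_normD _ _) _.
  rewrite -natr1 !mulrDl mul1r [leRHS]addrC; apply: lerD; last exact: IH (ltnW kn).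
  rewrite normrM mulrC; apply: ler_pM => //; exact: norm_coord.
have := key n (leqnn n); rewrite hkn.
rewrite (eq_bigl xpredT); last by move=> i; rewrite ltn_ord.
move=> /le_trans; apply; apply: ler_wpM2r => //.
rewrite /e1 mulrCA -{2}[e]mulr1; apply: ler_wpM2l; first exact: ltW.
by rewrite ler_pdivrMr ?ltr0n // mul1r ler_nat.
Unshelve. all: by end_near. Qed.

Lemma continuous_bigsum (R : realType) (T : topologicalType) (I : Type)
    (r : seq I) (P : pred I) (f : I -> T -> R) (x : T) :
  (forall i, P i -> {for x, continuous (f i)}) ->
  {for x, continuous (fun y => \sum_(i <- r | P i) f i y)}.
Proof.
move=> cf; elim: r => [|i r IH].
  rewrite (_ : (fun _ => _) = cst 0); last by apply/funext => y; rewrite big_nil.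
  exact: cst_continuous.
rewrite (_ : (fun _ => _) = fun y => (if P i then f i y else 0) +
    \sum_(i <- r | P i) f i y); last first.
  by apply/funext => y; rewrite big_cons; case: ifP; rewrite ?add0r.
by apply: continuousD => //; case Pi: (P i); [exact: cf | exact: cst_continuous].
Qed.

Lemma C1_differentiable (R : realType) n (f : 'rV[R]_n -> R) (x : 'rV[R]_n) :
  (\forall y \near x, forall i, derivable f y (delta_mx 0 i)) ->
  (forall i, {for x, continuous (partial i f)}) ->
  differentiable f x.
Proof.
move=> df cf.
pose L (h : 'rV[R]_n) : R := \sum_i h 0 i * partial i f x.
have Llin : linear L.
  move=> a u v; rewrite /L /GRing.scale /= mulr_sumr -big_split /=; apply: eq_bigr => i _.
  by rewrite !mxE mulrDl -mulrA.
pose Lm := GRing.isLinear.Build _ _ _ _ L Llin.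
pose LL : {linear 'rV[R]_n -> R} := HB.pack L Lm.
have cL : continuous LL.
  move=> y; rewrite /LL /= /L; apply: continuous_bigsum => i _.
  apply: continuousM; [exact: coord_continuous | exact: cst_continuous].
have E : f \o shift x = cst (f x) + (LL : 'rV[R]_n -> R) +o_ (0 : 'rV[R]_n) id.
  apply/eqaddoP => e e0; have := partial_approx df cf e0; apply: filterS => h.
  by rewrite -addrA -opprD.
by apply/diff_locallyP; rewrite (diff_unique cL E).
Qed.

Lemma is_derive_ext (R : realType) (V : normedModType R) (f g : V -> R)
    (x v : V) (d : R) : f = g -> is_derive x v f d -> is_derive x v g d.
Proof. by move=> ->. Qed.

(** Chain rule along a direction; it is reduced to the curve
    [t |-> F (t *: v + x)], to which the Frechet chain rule applies. *)
Lemma is_derive_chain (R : realType) (V : normedModType R) m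
    (f : 'rV[R]_m -> R) (F : V -> 'rV[R]_m) (x v : V) :
  differentiable f (F x) ->
  (forall j, derivable (fun y => F y 0 j) x v) ->
  is_derive x v (fun y => f (F y))
    (\sum_j 'D_v (fun y => F y 0 j) x * partial j f (F x)).
Proof.
move=> df dF.
have dF' : derivable F x v by apply/derivable_mxP => i j; rewrite (ord1 i); exact: dF.
pose c (t : R) := F (t *: v + x).
have c0 : c 0 = F x by rewrite /c scale0r add0r.
have dc : derivable c 0 1 := (derivable1P F x v).1 dF'.
have dc' : differentiable c 0 := (derivable1_diffP c 0).1 dc.
have dfc : differentiable f (c 0) by rewrite c0.
have dfc' : differentiable (f \o c) 0 by exact: differentiable_comp.
have d1 : derivable (fun y => f (F y)) x v.
  exact: (derivable1P (fun y => f (F y)) x v).2 ((derivable1_diffP _ _).2 dfc').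
split => //.
have E1 : 'D_v (fun y => f (F y)) x = 'D_1 (f \o c) 0.
  rewrite /derive; set u := (fun h : R => _); set w := (fun h : R => _).
  suff -> : u = w by []; apply/funext => h; rewrite /u /w /=.
  by rewrite [h *: 1]mulr1 c0 /c addr0.
have E2 : 'D_v F x = 'D_1 c 0.
  rewrite /derive; set u := (fun h : R => _); set w := (fun h : R => _).
  suff -> : u = w by []; apply/funext => h; rewrite /u /w /=.
  by rewrite [h *: 1]mulr1 c0 /c addr0.
have E3 : 'D_1 (f \o c) 0 = 'd f (c 0) ('D_1 c 0).
  by rewrite (deriveE _ dfc') (deriveE _ dc') (diff_comp dc' dfc).
rewrite E1 E3 c0 -E2 (derive_mx dF').
set w := \matrix_(_, _) _.
have lin (l : {linear 'rV[R]_m -> R}) : l w = \sum_j w 0 j * l (delta_mx 0 j).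
  by rewrite {1}(row_sum_delta w) linear_sum; apply: eq_bigr => j _; rewrite linearZ.
rewrite lin; apply: eq_bigr => j _; congr (_ * _); first by rewrite mxE.
by symmetry; apply: deriveE.
Qed.

(** The mean value theorem, applied twice in either order, expresses one and the
    same second difference of [f] by each of the mixed partials at points close
    to [x]. *)
Lemma schwarz (R : realType) n (f : 'rV[R]_n -> R) (x : 'rV[R]_n) i j :
  (\forall y \near x, [/\ derivable f y (delta_mx 0 i),
     derivable f y (delta_mx 0 j),
     derivable (partial i f) y (delta_mx 0 j) &
     derivable (partial j f) y (delta_mx 0 i)]) ->
  {for x, continuous (partial j (partial i f))} ->
  {for x, continuous (partial i (partial j f))} ->
  partial j (partial i f) x = partial i (partial j f) x.
Proof.
move=> df /cvgrPdist_le cji /cvgrPdist_le cij; apply/eqP/negPn/negP => ne.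
move: ne cji cij.
move: (partial j (partial i f) x) (partial i (partial j f) x) => a b ne cji cij.
pose e := `|a - b| / 3.
have e0 : 0 < e by rewrite divr_gt0 // normr_gt0 subr_eq0.
have [r r0 rP] := (near_ballP x _).1 (filterI df (filterI (cji _ e0) (cij _ e0))).
(* Two steps of length [t] stay in the ball of radius [r]. *)
pose t := r / 3.
have t0 : 0 < t by rewrite divr_gt0.
have tr (s s' : R) k l : `|s| <= `|t| -> `|s'| <= `|t| ->
    `|s *: (delta_mx 0 k : 'rV[R]_n) + s' *: delta_mx 0 l + x - x| < r.
  move=> st s't; rewrite addrK; apply: le_lt_trans (ler_normD _ _) _.
  rewrite !norm_delta; apply: le_lt_trans (lerD st s't) _.
  by rewrite gtr0_norm // /t; lra.
have tr1 (s : R) k : `|s| <= `|t| ->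
    `|s *: (delta_mx 0 k : 'rV[R]_n) + x - x| < r.
  move=> st; have := tr s 0 k k st; rewrite normr0 scale0r addr0.
  by apply; exact: normr_ge0.
pose di : 'rV[R]_n := delta_mx 0 i.
pose dj : 'rV[R]_n := delta_mx 0 j.
have swap (u w z : 'rV[R]_n) : u + (w + z) = w + (u + z).
  by rewrite !addrA (addrC u).
have sub_is (k l : 'I_n) (s : R) : `|s| <= `|t| ->
    `|t *: (delta_mx 0 k : 'rV[R]_n) + (s *: delta_mx 0 l + x) - x| < r.
  by move=> st; have := tr t s k l (lexx _) st; rewrite -[_ + _ + x]addrA.
have second (k l : 'I_n) :
    (forall y, `|y - x| < r -> derivable f y (delta_mx 0 k) /\
       derivable (partial k f) y (delta_mx 0 l)) ->
    exists2 y, `|y - x| < r &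
     (f (t *: delta_mx 0 l + (t *: delta_mx 0 k + x))
       - f (t *: delta_mx 0 k + x)) - (f (t *: delta_mx 0 l + x) - f x)
     = t * (t * partial l (partial k f) y).
  move=> dkl.
  pose g y := f (t *: delta_mx 0 l + y) - f y.
  have dshift (y : 'rV[R]_n) : derivable f (t *: delta_mx 0 l + y) (delta_mx 0 k) ->
      is_derive y (delta_mx 0 k) (fun y => f (t *: delta_mx 0 l + y))
        (partial k f (t *: delta_mx 0 l + y)).
    move=> dk; have E : (fun h : R => h^-1 *: (((fun y => f (t *: delta_mx 0 l + y)) \o
        shift y) (h *: delta_mx 0 k) - f (t *: delta_mx 0 l + y))) =
      (fun h : R => h^-1 *: ((f \o shift (t *: delta_mx 0 l + y)) (h *: delta_mx 0 k)
         - f (t *: delta_mx 0 l + y))).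
      by apply/funext => h /=; rewrite swap.
    by split; [rewrite /derivable E | rewrite /derive E].
  have dg (s : R) : `|s| <= `|t| -> is_derive (s *: delta_mx 0 k + x) (delta_mx 0 k) g
      (partial k f (t *: delta_mx 0 l + (s *: delta_mx 0 k + x))
        - partial k f (s *: delta_mx 0 k + x)).
    move=> st; apply: is_deriveB.
      by apply: dshift; apply: (dkl _ _).1; exact: sub_is.
    by apply/derivableP; apply: (dkl _ _).1; exact: tr1.
  have [|s st E] := @mvt_line _ _ g x (delta_mx 0 k) t.
    by move=> s st; exact: (@ex_derive _ _ _ _ _ _ _ (dg s st)).
  have [|s' s't E'] := @mvt_line _ _ (partial k f) (s *: delta_mx 0 k + x)
      (delta_mx 0 l) t.
    move=> s' s't; apply: (dkl _ _).2.
    by have := tr s' s l k s't st; rewrite -[_ + _ + x]addrA.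
  exists (s' *: delta_mx 0 l + (s *: delta_mx 0 k + x)).
    by have := tr s' s l k s't st; rewrite -[_ + _ + x]addrA.
  have := E; rewrite (@derive_val _ _ _ _ _ _ _ (dg s st)) E' /g => <-.
  by [].
have [|y1 y1r E1] := second i j.
  by move=> y /rP[[? ? ? ?] _].
have [|y2 y2r E2] := second j i.
  by move=> y /rP[[? ? ? ?] _].
have E : partial j (partial i f) y1 = partial i (partial j f) y2.
  apply: (mulfI (lt0r_neq0 t0)); apply: (mulfI (lt0r_neq0 t0)).
  apply: etrans (esym E1) (etrans _ E2).
  rewrite (swap (t *: delta_mx 0 i)).
  move: (f (_ + (_ + _))) (f (_ + x)) (f (_ + x)) (f x) => F1 F2 F3 F4.
  by rewrite -!addrA; congr (_ + _); rewrite !opprD !opprK addrCA.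
have [_ [b1 _]] := rP _ y1r.
have [_ [_ b2]] := rP _ y2r.
move: b1 b2; rewrite {}E; move: (partial i (partial j f) y2) => c b1 b2.
have : `|a - b| <= e + e.
  rewrite -[a - b](subrKA c); apply: le_trans (ler_normD _ _) _.
  by apply: lerD => //; rewrite distrC.
have : 0 < `|a - b| by rewrite normr_gt0 subr_eq0.
by rewrite /e; move: (`|a - b|) => q; clear; lra.
Qed.

(** * Functions of class C^k *)

Lemma Ck_continuous (R : realType) n k (A : set 'rV[R]_n) f x :
  Ck k A f -> A x -> {for x, continuous f}.
Proof. by case: k => [|k] /= => [cf|[cf _]] /cf. Qed.

Lemma Ck_le (R : realType) n k (A : set 'rV[R]_n) f : Ck k.+1 A f -> Ck k A f.
Proof.
elim: k f => [|k IH] f /=; first by case.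
by case=> cf df; split => // i; have [d1 d2] := df i; split => //; exact: IH.
Qed.

Lemma Ck_subset (R : realType) n k (A B : set 'rV[R]_n) f :
  B `<=` A -> Ck k A f -> Ck k B f.
Proof.
move=> BA; elim: k f => [|k IH] f /=; first by move=> cf x /BA /cf.
case=> cf df; split => [x /BA /cf //|i]; have [d1 d2] := df i.
by split => [x /BA /d1 //|]; exact: IH.
Qed.

Lemma Ck_ext (R : realType) n k (A : set 'rV[R]_n) f g : open A ->
  (forall x, A x -> f x = g x) -> Ck k A f -> Ck k A g.
Proof.
move=> oA; elim: k f g => [|k IH] f g fg /=.
  by move=> cf x Ax; apply: continuous_ext_open oA Ax fg (cf _ Ax).
case=> cf df; split => [x Ax|i].
  by apply: continuous_ext_open oA Ax fg (cf _ Ax).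
have [d1 d2] := df i; split => [x Ax|].
  by apply: derivable_ext_open oA Ax fg (d1 _ Ax).
by apply: IH d2 => x Ax; apply: derive_ext_open oA Ax fg.
Qed.

Lemma Ck_local (R : realType) n k (A : set 'rV[R]_n) f :
  (forall x, A x -> exists2 B : set 'rV[R]_n, B x & Ck k B f) -> Ck k A f.
Proof.
elim: k f => [|k IH] f loc /=.
  by move=> x /loc[B Bx cf]; exact: cf.
split=> [x /loc[B Bx [cf _]]|i]; first exact: cf.
split=> [x /loc[B Bx [_ df]]|]; first exact: (df i).1.
by apply: IH => x /loc[B Bx [_ df]]; exists B => //; exact: (df i).2.
Qed.

Lemma Ck_differentiable (R : realType) n k (A : set 'rV[R]_n) f x : open A ->
  Ck k.+1 A f -> A x -> differentiable f x.
Proof.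
move=> oA [cf df] Ax; apply: C1_differentiable => [|i].
  by near=> y; move=> i; apply: (df i).1; near: y; exact: open_nbhs_nbhs.
exact: Ck_continuous (df i).2 Ax.
Unshelve. all: by end_near. Qed.

Lemma Ck_cst (R : realType) n k (A : set 'rV[R]_n) (c : R) : Ck k A (fun=> c).
Proof.
have part i : partial i (fun=> c) = (fun=> 0) :> ('rV[R]_n -> R).
  by apply/funext => x; exact: derive_cst.
elim: k c part => [|k IH] c part /=; first by move=> x _; exact: cst_continuous.
split=> [x _|i]; first exact: cst_continuous.
split=> [x _|]; first exact: derivable_cst.
by rewrite part; apply: IH => j; apply/funext => x; exact: derive_cst.
Qed.

Lemma is_derive_coord (R : realType) n (j : 'I_n) (x v : 'rV[R]_n) :
  is_derive x v (fun y : 'rV[R]_n => y 0 j) (v 0 j).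
Proof.
have /derivable_mxP dc : derivable id x v by exact: derivable_id.
split; first exact: (dc 0 j).
have /derive_mx := @derivable_id _ _ x v.
by rewrite derive_id => {2}->; rewrite mxE.
Qed.

Lemma Ck_coord (R : realType) n k (A : set 'rV[R]_n) (j : 'I_n) :
  Ck k A (fun x => x 0 j).
Proof.
have cc (x : 'rV[R]_n) : {for x, continuous (fun x : 'rV[R]_n => x 0 j)}.
  exact: coord_continuous.
case: k => [|k] /=; first by move=> x _.
split=> [x _ //|i]; split=> [x _|].
  exact: (@ex_derive _ _ _ _ _ _ _ (is_derive_coord j x (delta_mx 0 i))).
rewrite (_ : partial i _ = fun=> (delta_mx 0 i : 'rV[R]_n) 0 j); first exact: Ck_cst.
apply/funext => x; rewrite /partial.
by rewrite (@derive_val _ _ _ _ _ _ _ (is_derive_coord j x (delta_mx 0 i))).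
Qed.

Section CkAlgebra.
Variables (R : realType) (n : nat) (A : set 'rV[R]_n).
Hypothesis oA : open A.

Lemma CkD k f g : Ck k A f -> Ck k A g -> Ck k A (fun x => f x + g x).
Proof.
elim: k f g => [|k IH] f g /=.
  by move=> cf cg x Ax; apply: continuousD; [exact: cf|exact: cg].
case=> cf df [cg dg]; split=> [x Ax|i].
  by apply: continuousD; [exact: cf|exact: cg].
have [df1 df2] := df i; have [dg1 dg2] := dg i.
split=> [x Ax|]; first by apply: derivableD; [exact: df1|exact: dg1].
apply: Ck_ext (IH _ _ df2 dg2) => // x Ax.
by rewrite /partial deriveD //; [exact: df1|exact: dg1].
Qed.

Lemma CkM k f g : Ck k A f -> Ck k A g -> Ck k A (fun x => f x * g x).
Proof.
elim: k f g => [|k IH] f g /=.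
  by move=> cf cg x Ax; apply: continuousM; [exact: cf|exact: cg].
move=> Cf Cg; case: (Cf) => cf df; case: (Cg) => cg dg; split=> [x Ax|i].
  by apply: continuousM; [exact: cf|exact: cg].
have [df1 df2] := df i; have [dg1 dg2] := dg i.
split=> [x Ax|]; first by apply: derivableM; [exact: df1|exact: dg1].
have Cf' : Ck k A f by exact: Ck_le.
have Cg' : Ck k A g by exact: Ck_le.
apply: Ck_ext (CkD (IH _ _ Cf' dg2) (IH _ _ Cg' df2)) => // x Ax.
by rewrite /partial deriveM //; [exact: df1|exact: dg1].
Qed.

Lemma CkN k f : Ck k A f -> Ck k A (fun x => - f x).
Proof.
move=> Cf; rewrite (_ : (fun _ => _) = fun x => (-1) * f x).
  by apply: CkM => //; exact: Ck_cst.
by apply/funext => x; rewrite mulN1r.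
Qed.

Lemma CkB k f g : Ck k A f -> Ck k A g -> Ck k A (fun x => f x - g x).
Proof. by move=> Cf Cg; apply: CkD => //; exact: CkN. Qed.

Lemma CkV k f : (forall x, A x -> f x != 0) -> Ck k A f ->
  Ck k A (fun x => (f x)^-1).
Proof.
move=> f0; elim: k => [|k IH] /=.
  by move=> cf x Ax; apply: continuousV; [exact: f0|exact: cf].
move=> Cf; case: (Cf) => cf df; split=> [x Ax|i].
  by apply: continuousV; [exact: f0|exact: cf].
have [df1 df2] := df i.
split=> [x Ax|]; first by apply: derivableV; [exact: f0|exact: df1].
have Cv := IH (Ck_le Cf).
apply: Ck_ext (CkN (CkM (CkM Cv Cv) df2)) => // x Ax.
rewrite /partial deriveV; last 2 first.
- exact: f0.
- exact: df1.
by rewrite /GRing.scale /= mulNr -exprVn expr2.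
Qed.

Lemma Ck_sum k (I : Type) (r : seq I) (P : pred I) (f : I -> 'rV[R]_n -> R) :
  (forall i, P i -> Ck k A (f i)) ->
  Ck k A (fun x => \sum_(i <- r | P i) f i x).
Proof.
move=> Cf; elim: r => [|i r IH].
  rewrite (_ : (fun _ => _) = fun=> 0); first exact: Ck_cst.
  by apply/funext => x; rewrite big_nil.
case Pi : (P i).
  rewrite (_ : (fun _ => _) = fun x => f i x + \sum_(i <- r | P i) f i x).
    by apply: CkD => //; exact: Cf.
  by apply/funext => x; rewrite big_cons Pi.
rewrite (_ : (fun _ => _) = fun x => \sum_(i <- r | P i) f i x) //.
by apply/funext => x; rewrite big_cons Pi.
Qed.

Lemma Ck_prod k (I : Type) (r : seq I) (P : pred I) (f : I -> 'rV[R]_n -> R) :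
  (forall i, P i -> Ck k A (f i)) ->
  Ck k A (fun x => \prod_(i <- r | P i) f i x).
Proof.
move=> Cf; elim: r => [|i r IH].
  rewrite (_ : (fun _ => _) = fun=> 1); first exact: Ck_cst.
  by apply/funext => x; rewrite big_nil.
case Pi : (P i).
  rewrite (_ : (fun _ => _) = fun x => f i x * \prod_(i <- r | P i) f i x).
    by apply: CkM => //; exact: Cf.
  by apply/funext => x; rewrite big_cons Pi.
rewrite (_ : (fun _ => _) = fun x => \prod_(i <- r | P i) f i x) //.
by apply/funext => x; rewrite big_cons Pi.
Qed.

Lemma Ck_sqrt k f : (forall x, A x -> 0 < f x) -> Ck k A f ->
  Ck k A (fun x => Num.sqrt (f x)).
Proof.
move=> f0; elim: k => [|k IH] /=.
  move=> cf x Ax; apply: continuous_comp; first exact: cf.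
  exact: sqrt_continuous.
move=> Cf; case: (Cf) => cf df; split=> [x Ax|i].
  apply: continuous_comp; first exact: cf.
  exact: sqrt_continuous.
have [df1 df2] := df i.
have dsq x : A x -> is_derive x (delta_mx 0 i) (fun x => Num.sqrt (f x))
    (partial i f x * (2 * Num.sqrt (f x))^-1).
  (* The chain rule is stated for functions of a row vector, so that the
     square root is seen as a function of a row of length one. *)
  move=> Ax; pose F (y : 'rV[R]_n) : 'rV[R]_1 := \row_j f y.
  pose sq (z : 'rV[R]_1) := Num.sqrt (z 0 0).
  have dsq' : differentiable sq (F x).
    have d1 : differentiable (Num.sqrt : R -> R) (F x 0 0).
      apply: (derivable1_diffP _ _).1; rewrite mxE.
      exact: (@ex_derive _ _ _ _ _ _ _ (is_derive1_sqrt (f0 _ Ax))).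
    apply: (@differentiable_comp _ _ _ _ (fun z : 'rV[R]_1 => z 0 0)
      (Num.sqrt : R -> R)) => //; exact: differentiable_coord.
  have E j : (fun y => F y 0 j) = f by apply/funext => y; rewrite mxE.
  have [|d1 d2] := is_derive_chain dsq' (F := F) (x := x) (v := delta_mx 0 i).
    by move=> j; rewrite E; exact: df1.
  have E2 : (fun y => sq (F y)) = (fun x => Num.sqrt (f x)).
    by apply/funext => y; rewrite /sq mxE.
  rewrite E2 in d1 d2; split => //; rewrite d2 big_ord1 E; congr (_ * _).
  rewrite /partial.
  have -> : 'D_(delta_mx 0 0) sq (F x) = 'D_1 (Num.sqrt : R -> R) (f x).
    rewrite /derive; set u := (fun h : R => _); set w := (fun h : R => _).
    suff -> : u = w by []; apply/funext => h; rewrite /u /w /sq /=.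
    by rewrite !mxE [h *: 1]mulr1 mulr1.
  exact: derive_sqrt (f0 _ Ax).
split=> [x Ax|]; first exact: (@ex_derive _ _ _ _ _ _ _ (dsq x Ax)).
have C1 : Ck k A (fun x => partial i f x * (2 * Num.sqrt (f x))^-1).
  apply: CkM => //; apply: CkV.
    by move=> x Ax; rewrite mulf_neq0 // gt_eqF // sqrtr_gt0 f0.
  apply: CkM; first exact: Ck_cst.
  exact: IH (Ck_le Cf).
apply: Ck_ext C1 => // x Ax.
by rewrite [RHS]/partial (@derive_val _ _ _ _ _ _ _ (dsq x Ax)).
Qed.

Lemma Ck_comp m k (B : set 'rV[R]_m) (f : 'rV[R]_m -> R)
    (F : 'rV[R]_n -> 'rV[R]_m) : open B ->
  (forall x, A x -> B (F x)) ->
  (forall j, Ck k A (fun x => F x 0 j)) -> Ck k B f ->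
  Ck k A (fun x => f (F x)).
Proof.
move=> oB AB.
elim: k f => [|k IH] f CF Cf.
  move=> x Ax; apply: continuous_comp; last exact: Cf (AB _ Ax).
  by apply: continuous_row => j; exact: CF.
have CF' j : Ck k A (fun x => F x 0 j) by exact: Ck_le.
case: (Cf) => cf df.
have ch i x : A x -> is_derive x (delta_mx 0 i) (fun x => f (F x))
   (\sum_j partial i (fun y => F y 0 j) x * partial j f (F x)).
  move=> Ax; apply: is_derive_chain.
    exact: Ck_differentiable oB Cf (AB _ Ax).
  by move=> j; apply: ((CF j).2 i).1.
split=> [x Ax|i].
  apply: continuous_comp; last exact: cf (AB _ Ax).
  by apply: continuous_row => j; exact: Ck_continuous (CF j) Ax.
split=> [x Ax|]; first exact: (@ex_derive _ _ _ _ _ _ _ (ch i x Ax)).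
have C1 : Ck k A (fun x => \sum_j partial i (fun y => F y 0 j) x * partial j f (F x)).
  apply: Ck_sum => j _; apply: CkM; first exact: ((CF j).2 i).2.
  by apply: IH => //; exact: (df j).2.
apply: Ck_ext C1 => // x Ax.
by rewrite [RHS]/partial (@derive_val _ _ _ _ _ _ _ (ch i x Ax)).
Unshelve. all: by end_near. Qed.

Lemma Ck_partial k f i : Ck k.+1 A f -> Ck k A (partial i f).
Proof. by case=> _ /(_ i)[]. Qed.

Lemma Ck_det k m (M : 'rV[R]_n -> 'M[R]_m) :
  (forall i j, Ck k A (fun x => M x i j)) -> Ck k A (fun x => \det (M x)).
Proof.
move=> CM; rewrite /determinant; apply: Ck_sum => s _.
apply: CkM; first exact: Ck_cst.
by apply: Ck_prod => i _; exact: CM.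
Qed.

Lemma Ck_invmx k m (M : 'rV[R]_n -> 'M[R]_m) i j :
  (forall x, A x -> M x \in unitmx) ->
  (forall i j, Ck k A (fun x => M x i j)) -> Ck k A (fun x => invmx (M x) i j).
Proof.
move=> Mu CM.
have C1 : Ck k A (fun x => (\det (M x))^-1 * \adj (M x) i j).
  apply: CkM.
    apply: CkV; last exact: Ck_det.
    by move=> x /Mu; rewrite unitmxE unitfE.
  rewrite (_ : (fun _ => _) = fun x => cofactor (M x) j i); last first.
    by apply/funext => x; rewrite mxE.
  rewrite /cofactor; apply: CkM; first exact: Ck_cst.
  apply: Ck_det => a b.
  rewrite (_ : (fun _ => _) = fun x => M x (lift j a) (lift i b)) //.
  by apply/funext => x; rewrite !mxE.
apply: Ck_ext C1 => // x Ax.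
by rewrite /invmx Mu // [RHS]mxE.
Qed.

End CkAlgebra.

(** * Charts and changes of coordinates *)

Lemma cmap_cimg (R : realType) n (T : Type) (c : chart R n T) p :
  cdom c p -> cimg c (cmap c p).
Proof. by move=> cp; exists p. Qed.

Lemma cimgP (R : realType) n (T : topologicalType) (c : chart R n T) x :
  is_chart c -> cimg c x -> cdom c (cinv c x) /\ cmap c (cinv c x) = x.
Proof. by move=> hc [p cp <-]; rewrite (chart_cancel hc). Qed.

Lemma open_chart_image (R : realType) n (T : topologicalType)
    (c : chart R n T) (V : set T) : is_chart c -> open V ->
  open (cmap c @` (V `&` cdom c)).
Proof.
move=> hc oV.
rewrite openE => _ [p [Vp cp] <-].
have cI : cimg c (cmap c p) by exact: cmap_cimg.
have nV : \forall x \near cmap c p, V (cinv c x).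
  apply: (chart_continuous_inv hc cI); rewrite (chart_cancel hc) //.
  exact: open_nbhs_nbhs.
have nI : \forall x \near cmap c p, cimg c x.
  by apply: open_nbhs_nbhs; split => //; exact: chart_open_img.
apply: filterS2 nV nI => x Vx Ix; have [cx E] := cimgP hc Ix.
by exists (cinv c x).
Qed.

Lemma open_chart_preimage (R : realType) n (T : topologicalType)
    (c : chart R n T) (U : set 'rV[R]_n) : is_chart c -> open U ->
  open (cdom c `&` (cmap c @^-1` U)).
Proof.
move=> hc oU; rewrite openE => p [cp Up].
have n1 : \forall q \near p, U (cmap c q).
  by apply: (chart_continuous hc cp); exact: open_nbhs_nbhs.
have n2 : \forall q \near p, cdom c q.
  by apply: open_nbhs_nbhs; split => //; exact: chart_open_dom.
exact: filterS2 n2 n1.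
Qed.

(** Compatibility is given with the charts of the atlas: near each point the
    transition is factored through one of them. *)
Lemma smooth_transition_charts (R : realType) n (T : topologicalType)
    (A : smooth_structure R n T) (c c' : chart R n T) :
  smooth_chart A c -> smooth_chart A c' -> smooth_transition c c'.
Proof.
move=> [hc cA] [hc' cA'] j k; apply: Ck_local => _ [p [cp cp'] <-].
have [a aA ap] := atlas_cover A p.
have ha := atlas_chart aA.
pose B := cmap c @` ((cdom c' `&` cdom a) `&` cdom c).
have oB : open B.
  by apply: open_chart_image => //; apply: openI; exact: chart_open_dom.
pose B' := cmap a @` (cdom c' `&` cdom a).
have oB' : open B' by apply: open_chart_image => //; exact: chart_open_dom.
exists B; first by exists p.
have C1 : Ck k B (fun x => (cmap c' \o cinv a) ((cmap a \o cinv c) x) 0 j).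
  apply: (Ck_comp oB (B := B') (f := fun y => (cmap c' \o cinv a) y 0 j)
    (F := cmap a \o cinv c)) => //.
  - by move=> _ [q [[c'q aq] cq] <-] /=; rewrite (chart_cancel hc) //; exists q.
  - move=> i; apply: Ck_subset ((cA _ aA).1 i k).
    by move=> _ [q [[c'q aq] cq] <-]; exists q.
  - apply: Ck_subset ((cA' _ aA).2 j k).
    by move=> _ [q [c'q aq] <-]; exists q.
apply: Ck_ext C1 => // _ [q [[c'q aq] cq] <-] /=.
by rewrite (chart_cancel hc) // (chart_cancel ha).
Qed.

Lemma dfun_change (R : realType) n (T : topologicalType)
    (A : smooth_structure R n T) (c c' : chart R n T) (f : T -> R) (p : T) :
  smooth_chart A c -> smooth_chart A c' -> cdom c p -> cdom c' p ->
  differentiable (f \o cinv c') (cmap c' p) ->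
  dfun c f p = dfun c' f p *m (jac c c' p)^T.
Proof.
move=> sc sc' cp cp' df; have [hc _] := sc; have [hc' _] := sc'.
have oB := open_chart_image hc (chart_open_dom hc').
set B := _ @` _ in oB.
have Bp : B (cmap c p) by exists p.
have E x : B x -> (f \o cinv c') ((cmap c' \o cinv c) x) = (f \o cinv c) x.
  by move=> [q [c'q cq] <-] /=; rewrite (chart_cancel hc) // (chart_cancel hc').
have st := smooth_transition_charts sc sc'.
have pE : (cmap c' \o cinv c) (cmap c p) = cmap c' p.
  by rewrite /= (chart_cancel hc).
apply/rowP => i; rewrite !mxE.
rewrite /partial -(derive_ext_open _ oB Bp E).
have [|j|_ ->] := @is_derive_chain _ _ _ (f \o cinv c') (cmap c' \o cinv c)
    (cmap c p) (delta_mx 0 i).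
- by rewrite pE.
- have [_ /(_ i) [d _]] := st j 1%N; apply: d; rewrite setIC; exact: Bp.
by apply: eq_bigr => j _; rewrite !mxE pE mulrC.
Qed.

Lemma jac_self (R : realType) n (T : topologicalType) (c : chart R n T) p :
  is_chart c -> cdom c p -> jac c c p = 1%:M.
Proof.
move=> hc cp; apply/matrixP => i j; rewrite !mxE /partial.
have E x : cimg c x -> x 0 j = cmap c (cinv c x) 0 j.
  by move=> /(cimgP hc)[_ ->].
rewrite -(derive_ext_open _ (chart_open_img hc) (cmap_cimg cp) E).
rewrite (@derive_val _ _ _ _ _ _ _ (is_derive_coord j _ _)).
by rewrite mxE eqxx /= eq_sym.
Qed.

(** * Restriction of charts *)

(** The metric is indexed by charts, so that its components in a restricted chart
    are recovered from the tensor law ([metric_restr]). *)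
Definition restr_chart {R : realType} {n : nat} {T : Type} (c : chart R n T)
    (V : set T) : chart R n T := Chart (cdom c `&` V) (cmap c) (cinv c).

Lemma smooth_restr_chart (R : realType) n (T : topologicalType)
    (A : smooth_structure R n T) (c : chart R n T) (V : set T) :
  smooth_chart A c -> open V -> smooth_chart A (restr_chart c V).
Proof.
move=> [hc cA] oV; split; [split|].
- by apply: openI => //; exact: chart_open_dom hc.
- have := open_chart_image hc oV; by rewrite /cimg /= setIC.
- by move=> p [cp _]; exact: (chart_cancel hc).
- by move=> p [cp _]; exact: (chart_continuous hc).
- by move=> x [p [cp _] <-]; apply: (chart_continuous_inv hc); exact: cmap_cimg.
move=> c' /cA[s1 s2]; split => j k.
  apply: Ck_subset (s1 j k) => _ [p [[cp Vp] c'p] <-]; by exists p.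
by apply: Ck_subset (s2 j k) => _ [p [c'p [cp Vp]] <-]; exists p.
Qed.

(** * Lorentzian linear algebra *)

Lemma ipC (R : realType) n (G : 'M[R]_n) (X Y : 'rV[R]_n) : G^T = G ->
  ip G X Y = ip G Y X.
Proof.
move=> GT; rewrite /ip -[in RHS]GT -[Y in RHS]trmxK -!trmx_mul.
by rewrite [RHS]mxE mulmxA.
Qed.

Lemma ipE (R : realType) n (G : 'M[R]_n) (X Y : 'rV[R]_n) :
  ip G X Y = \sum_i \sum_j X 0 i * G i j * Y 0 j.
Proof.
rewrite /ip mxE exchange_big /=; apply: eq_bigr => j _.
by rewrite !mxE mulr_suml; apply: eq_bigr.
Qed.

Lemma ip_congr (R : realType) m n (P : 'M[R]_(m, n)) (G : 'M[R]_n)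
    (X Y : 'rV[R]_m) : ip (P *m G *m P^T) X Y = ip G (X *m P) (Y *m P).
Proof. by rewrite /ip trmx_mul !mulmxA. Qed.

Lemma ip_minkowski (R : realType) (X Y : 'rV[R]_4) : ip Defs.minkowski X Y =
  - (X 0 0 * Y 0 0) + X 0 1 * Y 0 1 + X 0 2 * Y 0 2 + X 0 3 * Y 0 3.
Proof.
rewrite /ip mul_mx_diag mxE !big_ord_recl big_ord0 !mxE /=.
rewrite (_ : lift ord0 ord0 = 1); last exact: val_inj.
rewrite (_ : lift ord0 _ = 2); last exact: val_inj.
rewrite (_ : lift ord0 _ = 3); last exact: val_inj.
by rewrite /=; ring.
Qed.

(** In Minkowski coordinates orthogonality equates the product of the time
    components with the scalar product of the space components, and the
    Cauchy-Schwarz inequality concludes. *)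
Lemma orth_timelike (R : realType) (G P : 'M[R]_4) (X Y : 'rV[R]_4) :
  P \in unitmx -> P *m G *m P^T = Defs.minkowski ->
  ip G X X < 0 -> ip G X Y = 0 -> Y != 0 -> 0 < ip G Y Y.
Proof.
move=> Pu PG; pose x := X *m invmx P; pose y := Y *m invmx P.
have -> : X = x *m P by rewrite mulmxKV.
have -> : Y = y *m P by rewrite mulmxKV.
clearbody x y; rewrite -!ip_congr PG !ip_minkowski => xx xy yP0.
have {yP0} : y != 0 by apply: contra_neq yP0 => ->; rewrite mul0mx.
have y0 : y = 0 <-> [/\ y 0 0 = 0, y 0 1 = 0, y 0 2 = 0 & y 0 3 = 0].
  split=> [->|[h0 h1 h2 h3]]; first by split; rewrite mxE.
  apply/rowP => -[[|[|[|[|]]]]] // hi; rewrite mxE.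
  - by rewrite -[RHS]h0; congr (y 0 _); apply: val_inj.
  - by rewrite -[RHS]h1; congr (y 0 _); apply: val_inj.
  - by rewrite -[RHS]h2; congr (y 0 _); apply: val_inj.
  - by rewrite -[RHS]h3; congr (y 0 _); apply: val_inj.
move=> yn0; rewrite ltNge; apply/negP => yy; move/eqP: yn0; apply; apply/y0.
move: (x 0 0) (x 0 1) (x 0 2) (x 0 3) xx xy => t a b c xx xy.
move: (y 0 0) (y 0 1) (y 0 2) (y 0 3) xy yy => s u v w xy yy.
clear x y y0 PG Pu P G X Y.
have E : t * s = a * u + b * v + c * w by lra.
pose n2 := u ^+ 2 + v ^+ 2 + w ^+ 2.
pose m2 := a ^+ 2 + b ^+ 2 + c ^+ 2.
have cs : (t * s) ^+ 2 <= m2 * n2.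
  rewrite E -subr_ge0 (_ : _ - _ = (a * v - b * u) ^+ 2 + (a * w - c * u) ^+ 2
     + (b * w - c * v) ^+ 2); last by rewrite /m2 /n2; ring.
  by rewrite !addr_ge0 // sqr_ge0.
have mt : m2 < t ^+ 2 by rewrite /m2; lra.
have ns : n2 <= s ^+ 2 by rewrite /n2; lra.
have m0 : 0 <= m2 by rewrite /m2 !addr_ge0 // sqr_ge0.
have n0 : 0 <= n2 by rewrite /n2 !addr_ge0 // sqr_ge0.
have t0 : 0 < t ^+ 2 by exact: le_lt_trans mt.
have s0 : s ^+ 2 = 0.
  apply/eqP; rewrite eq_le sqr_ge0 andbT leNgt; apply/negP => s0.
  have : m2 * n2 < (t * s) ^+ 2.
    rewrite exprMn; apply: (@le_lt_trans _ _ (m2 * s ^+ 2)).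
      exact: ler_wpM2l.
    by rewrite ltr_pM2r.
  by rewrite ltNge cs.
have u0 := sqr_ge0 u; have v0 := sqr_ge0 v; have w0 := sqr_ge0 w.
have n20 : n2 <= 0 by rewrite -s0.
split; apply/eqP; rewrite -sqrf_eq0; apply/eqP; rewrite ?s0 //;
  move: n20; rewrite /n2; lra.
Qed.

Lemma minkowski_unit (R : realType) : (Defs.minkowski : 'M[R]_4) \in unitmx.
Proof.
rewrite unitmxE det_diag unitfE; apply/prodf_neq0 => i _.
by rewrite mxE; case: ifP; rewrite ?oppr_eq0 oner_eq0.
Qed.

Lemma metric_unit (R : realType) (M : topologicalType)
    (A : smooth_structure R 4 M) (g : lorentz_metric A) c p :
  smooth_chart A c -> cdom c p -> g c p \in unitmx.
Proof.
move=> sc cp; have [P Pu PG] := metric_signature g sc cp.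
have := minkowski_unit R; rewrite -PG !unitmx_mul unitmx_tr.
by case/andP => /andP[].
Qed.

Section MetricCharts.
Variables (R : realType) (M : topologicalType) (A : smooth_structure R 4 M).
Variable g : lorentz_metric A.

Lemma metric_restr c V p : smooth_chart A c -> open V -> cdom c p -> V p ->
  g (restr_chart c V) p = g c p.
Proof.
move=> sc oV cp Vp; have [hc _] := sc.
rewrite (metric_tensor g (smooth_restr_chart sc oV) sc) //.
by rewrite (_ : jac _ _ _ = 1%:M) ?trmx1 ?mul1mx ?mulmx1 // -(jac_self hc cp).
Qed.

Lemma jac_unit c c' p : smooth_chart A c -> smooth_chart A c' ->
  cdom c p -> cdom c' p -> jac c c' p \in unitmx.
Proof.
move=> sc sc' cp cp'; have := metric_unit g sc cp.
by rewrite (metric_tensor g sc sc' cp cp') !unitmx_mul => /andP[/andP[]].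
Qed.

Lemma invmx_metric c c' p : smooth_chart A c -> smooth_chart A c' ->
  cdom c p -> cdom c' p ->
  (jac c c' p)^T *m invmx (g c p) *m jac c c' p = invmx (g c' p).
Proof.
move=> sc sc' cp cp'; have Ju := jac_unit sc sc' cp cp'.
have Gu := metric_unit g sc' cp'.
have Ku := metric_unit g sc cp.
have KE := metric_tensor g sc sc' cp cp'.
move: Ju Gu Ku KE; move: (jac c c' p) (g c' p) (g c p) => J G K Ju Gu Ku KE.
apply: (can_inj (mulKmx Gu)); rewrite mulmxV //.
apply: (can_inj (mulKmx Ju)).
by rewrite mulmx1 !mulmxA -KE mulmxV // mul1mx.
Qed.

Lemma grad_change c c' (f : M -> R) p :
  smooth_chart A c -> smooth_chart A c' -> cdom c p -> cdom c' p ->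
  differentiable (f \o cinv c') (cmap c' p) ->
  grad g c' f p = grad g c f p *m jac c c' p.
Proof.
move=> sc sc' cp cp' df; rewrite /grad (dfun_change sc sc' cp cp' df).
by rewrite -(invmx_metric sc sc' cp cp') !mulmxA.
Qed.

(** The nullness of a hypersurface is witnessed in a slice chart; this invariance
    transports it to a double null chart. *)
Lemma conorm_change c c' (f : M -> R) p :
  smooth_chart A c -> smooth_chart A c' -> cdom c p -> cdom c' p ->
  differentiable (f \o cinv c') (cmap c' p) ->
  ip (invmx (g c p)) (dfun c f p) (dfun c f p) =
  ip (invmx (g c' p)) (dfun c' f p) (dfun c' f p).
Proof.
move=> sc sc' cp cp' df; rewrite (dfun_change sc sc' cp cp' df) -ip_congr trmxK.
by rewrite (invmx_metric sc sc' cp cp').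
Qed.

End MetricCharts.

(** * Positive definite forms *)

Lemma posdef_unit (R : realType) n (G : 'M[R]_n) : posdef G -> G \in unitmx.
Proof.
move=> pG; rewrite -row_free_unit -kermx_eq0; apply/negPn/negP => k0.
have [i ki] : exists i, row i (kermx G) != 0.
  apply/existsP; apply: contraNT k0 => /existsPn k0.
  by apply/eqP/row_matrixP => i; rewrite row0; apply/eqP/negPn/k0.
have := pG _ ki; rewrite /ip -row_mul mulmx_ker row0 mul0mx mxE ltxx.
by [].
Qed.

Lemma ip_delta (R : realType) n (G : 'M[R]_n) i j :
  ip G (delta_mx 0 i) (delta_mx 0 j) = G i j.
Proof.
rewrite /ip -rowE trmx_delta mxE (bigD1 j) //= big1 ?addr0.
  by rewrite !mxE !eqxx mulr1.
by move=> l lj; rewrite !mxE (negbTE lj) mulr0.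
Qed.

Lemma posdef_diag (R : realType) n (G : 'M[R]_n) i : posdef G -> 0 < G i i.
Proof.
move=> pG; rewrite -ip_delta; apply: pG.
by apply/eqP => /rowP /(_ i); rewrite !mxE !eqxx => /eqP; rewrite oner_eq0.
Qed.

Lemma ip_invmx (R : realType) n (G : 'M[R]_n) (u v : 'rV[R]_n) :
  G \in unitmx -> G^T = G -> ip G (u *m invmx G) (v *m invmx G) = ip (invmx G) u v.
Proof.
by move=> Gu GT; rewrite /ip mulmxKV // trmx_mul trmx_inv GT mulmxA.
Qed.

Lemma posdef_invmx (R : realType) n (G : 'M[R]_n) : G^T = G -> posdef G ->
  posdef (invmx G).
Proof.
move=> GT pG v vn0; have Gu := posdef_unit pG.
rewrite -ip_invmx //; apply: pG; apply: contra_neq vn0 => /(congr1 (mulmx^~ G)).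
by rewrite mulmxKV // mul0mx.
Qed.

(** This isolates the coefficient of a pure-trace variation of an expansion. *)
Lemma posdef_trace_invmx (R : realType) n (G : 'M[R]_n.+1) : G^T = G ->
  posdef G -> 0 < \tr (invmx G).
Proof.
move=> GT pG; rewrite /mxtrace big_ord_recl ltr_wpDr //.
  by apply: sumr_ge0 => i _; apply/ltW/posdef_diag/posdef_invmx.
exact/posdef_diag/posdef_invmx.
Qed.

(** Sylvester's criterion in dimension two displays positivity as an open
    condition. *)
Lemma posdef2P (R : realType) (G : 'M[R]_2) : G^T = G ->
  (posdef G <-> 0 < G 0 0 /\ 0 < G 0 0 * G 1 1 - G 0 1 * G 0 1).
Proof.
move=> GT; have G10 : G 1 0 = G 0 1 by rewrite -[in LHS]GT mxE.
have ipG (v : 'rV[R]_2) : ip G v v = G 0 0 * v 0 0 ^+ 2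
    + 2 * G 0 1 * v 0 0 * v 0 1 + G 1 1 * v 0 1 ^+ 2.
  rewrite ipE !big_ord_recl !big_ord0.
  rewrite (_ : lift ord0 ord0 = 1) ?G10; last exact: val_inj.
  by rewrite (_ : ord0 = 0) //; ring.
split=> [pG|[G0 dG] v vn0].
  have G0 := posdef_diag 0 pG; split=> //.
  pose v : 'rV[R]_2 := \row_j if j == 0 then - G 0 1 else G 0 0.
  have : 0 < ip G v v.
    apply: pG; apply/eqP => /rowP /(_ 1); rewrite !mxE /=.
    by move/eqP; rewrite gt_eqF.
  rewrite ipG !mxE /= => H.
  rewrite -(pmulr_rgt0 _ G0); move: H; congr (_ < _).
  by rewrite /=; ring.
rewrite ipG -(pmulr_rgt0 _ G0).
have -> : G 0 0 * (G 0 0 * v 0 0 ^+ 2 + 2 * G 0 1 * v 0 0 * v 0 1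
    + G 1 1 * v 0 1 ^+ 2) = (G 0 0 * v 0 0 + G 0 1 * v 0 1) ^+ 2
    + (G 0 0 * G 1 1 - G 0 1 * G 0 1) * v 0 1 ^+ 2 by ring.
have [v1|v1] := eqVneq (v 0 1) 0.
  have v0 : v 0 0 != 0.
    apply: contra_neq vn0 => v0; apply/rowP => -[[|[|]]] // hi; rewrite mxE.
      by rewrite -[RHS]v0; congr (v 0 _); apply: val_inj.
    by rewrite -[RHS]v1; congr (v 0 _); apply: val_inj.
  rewrite v1 mulr0 addr0 expr0n /= mulr0 addr0 exprn_even_gt0 //=.
  by rewrite mulf_neq0 // gt_eqF.
by apply: ltr_wpDl; [exact: sqr_ge0 | rewrite mulr_gt0 // exprn_even_gt0].
Qed.

(** * Coordinates adapted to a double null foliation *)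

Lemma lshift20 : lshift 2 (0 : 'I_2) = (0 : 'I_4). Proof. exact: val_inj. Qed.
Lemma lshift21 : lshift 2 (1 : 'I_2) = (1 : 'I_4). Proof. exact: val_inj. Qed.

Lemma sum4 (R : realType) (F : 'I_4 -> R) :
  \sum_m F m = F 0 + F 1 + \sum_(i < 2) F (rshift 2 i).
Proof.
rewrite (@big_split_ord _ _ _ 2 2) /= big_ord_recl big_ord1.
rewrite lshift20; congr (_ + F _ + _); exact: val_inj.
Qed.

Lemma ind4 (P : 'I_4 -> Prop) : P 0 -> P 1 -> (forall i : 'I_2, P (rshift 2 i)) ->
  forall m, P m.
Proof.
move=> P0 P1 P2 m; rewrite -(@fintype.splitK 2 2 m).
case: (@fintype.split 2 2 m) => [[[|[|]] // hi]|j] /=; last exact: P2.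
- by suff <- : (0 : 'I_4) = lshift 2 (Ordinal hi) by []; exact: val_inj.
- by suff <- : (1 : 'I_4) = lshift 2 (Ordinal hi) by []; exact: val_inj.
Qed.

Lemma pt4_0 (R : realType) (a b : R) y : pt4 a b y 0 (0 : 'I_4) = a.
Proof. by rewrite -lshift20 row_mxEl mxE. Qed.
Lemma pt4_1 (R : realType) (a b : R) y : pt4 a b y 0 (1 : 'I_4) = b.
Proof. by rewrite -lshift21 row_mxEl mxE. Qed.
Lemma pt4_2 (R : realType) (a b : R) y i : pt4 a b y 0 (rshift 2 i) = y 0 i.
Proof. by rewrite row_mxEr. Qed.
Definition pt4E := (pt4_0, pt4_1, pt4_2).

Lemma delta_pt4 (R : realType) (i : 'I_2) :
  delta_mx 0 (rshift 2 i) = pt4 0 0 (delta_mx 0 i) :> 'rV[R]_4.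
Proof.
apply/rowP; elim/ind4 => [||j]; rewrite pt4E !mxE ?eqxx //=.
Qed.

(** The algebraic content of a double null chart at a point: [w] is twice the
    squared lapse. *)
Record dn_form (R : realType) (G : 'M[R]_4) (w : R) : Prop := {
  dnf_sym : G^T = G;
  dnf_lorentz : exists2 P : 'M[R]_4, P \in unitmx & P *m G *m P^T = Defs.minkowski;
  dnf_unit : G \in unitmx;
  dnf_w : 0 < w;
  dnf_00 : invmx G 0 0 = 0;
  dnf_11 : invmx G 1 1 = 0;
  dnf_01 : w * invmx G 0 1 = 1;
  dnf_0i : forall i : 'I_2, invmx G 0 (rshift 2 i) = 0 }.

Section DNForm.
Variables (R : realType) (G : 'M[R]_4) (w : R).
Hypothesis hG : dn_form G w.

Let I := invmx G.
Let Gu := dnf_unit hG.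
Let GT := dnf_sym hG.

Lemma dnf_inv_sym i j : I i j = I j i.
Proof. by rewrite /I -[in LHS]GT -trmx_inv mxE. Qed.

Definition dnf_L : 'rV[R]_4 := w *: row 0 I.
Definition dnf_Lb : 'rV[R]_4 := w *: row 1 I.
Definition dnf_b : 'rV[R]_2 := @rsubmx R 1 2 2 dnf_Lb.
Definition dnf_gs : 'M[R]_2 := @drsubmx R 2 2 2 2 G.

Lemma dnf_LE : dnf_L = delta_mx 0 1.
Proof.
apply/rowP; elim/ind4 => [||i]; rewrite !mxE.
- by rewrite (dnf_00 hG) mulr0.
- exact: dnf_01 hG.
- by rewrite (dnf_0i hG) mulr0.
Qed.

Lemma dnf_LbE : dnf_Lb = pt4 1 0 dnf_b.
Proof.
apply/rowP; elim/ind4 => [||i]; rewrite pt4E.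
- by rewrite !mxE -/I dnf_inv_sym; exact: dnf_01 hG.
- by rewrite !mxE (dnf_11 hG) mulr0.
- by rewrite [RHS]mxE.
Qed.

Lemma dnf_ip_L X : ip G dnf_L X = w * X 0 0.
Proof.
rewrite /ip /dnf_L -scalemxAl rowE mulmxKV // -scalemxAl -rowE mxE; congr (_ * _).
by rewrite !mxE.
Qed.

Lemma dnf_ip_Lb X : ip G dnf_Lb X = w * X 0 1.
Proof.
rewrite /ip /dnf_Lb -scalemxAl rowE mulmxKV // -scalemxAl -rowE mxE; congr (_ * _).
by rewrite !mxE.
Qed.

Lemma dnf_G1 j : G 1 j = w * (j == 0)%:R.
Proof.
by rewrite -ip_delta -dnf_LE dnf_ip_L mxE eq_sym eqxx.
Qed.

Lemma ipDl n (H : 'M[R]_n) (X Y Z : 'rV[R]_n) : ip H (X + Y) Z = ip H X Z + ip H Y Z.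
Proof. by rewrite /ip !mulmxDl mxE. Qed.
Lemma ipZl n (H : 'M[R]_n) a (X Z : 'rV[R]_n) : ip H (a *: X) Z = a * ip H X Z.
Proof. by rewrite /ip -!scalemxAl mxE. Qed.
Lemma ipDr n (H : 'M[R]_n) (X Y Z : 'rV[R]_n) : ip H Z (X + Y) = ip H Z X + ip H Z Y.
Proof. by rewrite /ip linearD mulmxDr mxE. Qed.
Lemma ipZr n (H : 'M[R]_n) a (X Z : 'rV[R]_n) : ip H Z (a *: X) = a * ip H Z X.
Proof. by rewrite /ip linearZ -scalemxAr mxE. Qed.

Definition angular (u : 'rV[R]_2) : 'rV[R]_4 := pt4 0 0 u.

Lemma ip_angular u v : ip G (angular u) (angular v) = ip dnf_gs u v.
Proof.
rewrite !ipE sum4 big1 => [|j _]; last by rewrite pt4_0 !mul0r.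
rewrite big1 => [|j _]; last by rewrite pt4_1 !mul0r.
rewrite !add0r; apply: eq_bigr => i _.
rewrite sum4 !pt4E !mulr0 !add0r; apply: eq_bigr => j _.
by rewrite !pt4E !mxE.
Qed.

(** The angular directions are orthogonal to the timelike vector [L - Lb]. *)
Lemma dnf_gs_posdef : posdef dnf_gs.
Proof.
move=> v vn0; have [P Pu PG] := dnf_lorentz hG.
rewrite -ip_angular; apply: (@orth_timelike _ G P (dnf_L + (-1) *: dnf_Lb)) => //.
- rewrite ipDl (ipZl _ (-1)) dnf_ip_L dnf_ip_Lb.
  have X0 : (dnf_L + (-1) *: dnf_Lb) 0 (0 : 'I_4) = -1.
    by rewrite mxE [X in _ + X]mxE dnf_LE dnf_LbE pt4_0 !mxE /= add0r mulr1.
  have X1 : (dnf_L + (-1) *: dnf_Lb) 0 (1 : 'I_4) = 1.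
    by rewrite mxE [X in _ + X]mxE dnf_LE dnf_LbE pt4_1 !mxE /= mulr0 addr0.
  by rewrite X0 X1 mulrN1 mulr1 mulN1r -opprD oppr_lt0 addr_gt0 ?(dnf_w hG).
- by rewrite ipDl (ipZl _ (-1)) dnf_ip_L dnf_ip_Lb !pt4E !mulr0 addr0.
- apply: contra_neq vn0 => /rowP v0; apply/rowP => i.
  by have := v0 (rshift 2 i); rewrite pt4E !mxE.
Qed.

End DNForm.

(** * The null normal of a section at a point *)

(** The ingredients of the null normal of a section at one point, with the metric,
    [w] = 2 Om^2 and the differentials of the section as plain parameters. *)
Definition sec_e {R : realType} (w : R) (gs B : 'M[R]_2) (dphi : 'rV[R]_2)
  : 'rV[R]_2 := - w *: (dphi *m (invmx B)^T *m invmx gs).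

Definition sec_disc {R : realType} (w : R) (gs : 'M[R]_2) (e eb : 'rV[R]_2) : R :=
  (w + ip gs e eb) ^+ 2 - ip gs e e * ip gs eb eb.

Definition sec_eps {R : realType} (w : R) (gs : 'M[R]_2) (e eb : 'rV[R]_2) : R :=
  - ip gs e e / (w + ip gs e eb + Num.sqrt (sec_disc w gs e eb)).

Definition sec_N {R : realType} (G : 'M[R]_4) (w : R) (B : 'M[R]_2)
    (df dfb : 'rV[R]_2) : 'rV[R]_4 :=
  let e := sec_e w (dnf_gs G) B df in
  let eb := sec_e w (dnf_gs G) B dfb in
  let eps := sec_eps w (dnf_gs G) e eb in
  dnf_L G w + eps *: dnf_Lb G w + angular (e + eps *: eb).

Definition sec_frame {R : realType} (df dfb : 'rV[R]_2) (a : 'I_2) : 'rV[R]_4 :=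
  pt4 (df 0 a) (dfb 0 a) (delta_mx 0 a).

Definition sec_B {R : realType} (df b : 'rV[R]_2) : 'M[R]_2 := 1%:M - df^T *m b.

Lemma mxDE (R : realType) m n (X Y : 'M[R]_(m, n)) i j :
  (X + Y) i j = X i j + Y i j.
Proof. by rewrite mxE. Qed.

Lemma mxZE (R : realType) m n a (X : 'M[R]_(m, n)) i j :
  (a *: X) i j = a * X i j.
Proof. by rewrite mxE. Qed.

Lemma angularE (R : realType) (u : 'rV[R]_2) : angular u = @row_mx R 1 2 2 0 u.
Proof.
rewrite /angular /pt4 (_ : (\row_(j < 2) _) = 0) //.
by apply/rowP => j; rewrite !mxE; case: ifP.
Qed.

Section SecNormal.
Variables (R : realType) (G : 'M[R]_4) (w : R).
Hypothesis hG : dn_form G w.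
Variables df dfb : 'rV[R]_2.
Let b := dnf_b G w.
Let gs := dnf_gs G.
Let B := sec_B df b.
Hypothesis Bu : B \in unitmx.

(** In terms of [L] and [Lb] the shift is absorbed in [B]. *)
Lemma sec_frameE a : sec_frame df dfb a =
  df 0 a *: dnf_Lb G w + dfb 0 a *: dnf_L G w + angular (row a B).
Proof.
rewrite dnf_LE // dnf_LbE // /sec_frame.
have d0 : (delta_mx 0 1 : 'rV[R]_4) 0 0 = 0 by rewrite mxE.
have d1 : (delta_mx 0 1 : 'rV[R]_4) 0 1 = 1 by rewrite mxE.
have d2 i : (delta_mx 0 1 : 'rV[R]_4) 0 (rshift 2 i) = 0 by rewrite mxE.
apply/rowP; elim/ind4 => [||i]; rewrite !mxDE !mxZE !pt4E ?d0 ?d1 ?d2.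
- by rewrite mulr1 mulr0 !addr0.
- by rewrite mulr1 mulr0 add0r addr0.
- rewrite mulr0 addr0 [X in _ = _ + X]mxE /B /sec_B mxDE.
  rewrite [X in _ = _ + (_ + X)]mxE [X in _ = _ + (_ - X)]mxE big_ord1 -/b.
  by rewrite [df^T _ _]mxE addrC subrK !mxE eqxx eq_sym.
Qed.

Lemma sec_e_row phi a :
  ip gs (sec_e w gs B phi) (row a B) = - w * phi 0 a.
Proof.
have gsu := posdef_unit (dnf_gs_posdef hG).
rewrite /ip /sec_e -!scalemxAl mulmxKV // mxZE; congr (_ * _).
rewrite -mulmxA -trmx_mul -row_mul mulmxV //.
rewrite !mxE (bigD1 a) //= big1 ?addr0 => [|j ja]; rewrite !mxE ?eqxx ?mulr1 //.
by rewrite eq_sym (negbTE ja) mulr0.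
Qed.

(** The vectors [e] and [eb] correct [L] and [Lb] separately: both L + e and
    Lb + eb are orthogonal to the section. *)
Lemma sec_orth a : ip G (sec_N G w B df dfb) (sec_frame df dfb a) = 0.
Proof.
rewrite /sec_N -/gs; set e := sec_e _ _ _ df; set eb := sec_e _ _ _ dfb.
set eps := sec_eps _ _ _ _.
rewrite !ipDl (ipZl _ eps) dnf_ip_L // dnf_ip_Lb // {1 2}/sec_frame !pt4E.
rewrite sec_frameE !ipDr (ipZr _ (df 0 a)) (ipZr _ (dfb 0 a)) ip_angular -/gs.
rewrite (ipC (angular _) (dnf_L _ _)) ?(dnf_sym hG) //.
rewrite (ipC (angular _) (dnf_Lb _ _)) ?(dnf_sym hG) //.
rewrite dnf_ip_L // dnf_ip_Lb // !pt4E !mulr0 !add0r.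
by rewrite ipDl ipZl !sec_e_row; ring.
Qed.

Lemma sec_N1 : sec_N G w B df dfb 0 (1 : 'I_4) = 1.
Proof.
rewrite /sec_N !mxDE (mxZE _ (dnf_Lb _ _)) dnf_LE // dnf_LbE // !pt4E mulr0 !addr0.
by rewrite mxE.
Qed.

(** For [dfb = 0] the root in the definition of the normal is [w], so that
    [2 w eps = - |e|^2]. *)
Lemma sec_null : dfb = 0 -> ip G (sec_N G w B df dfb) (sec_N G w B df dfb) = 0.
Proof.
move=> fb0; rewrite /sec_N -/gs fb0.
have -> : sec_e w gs B 0 = 0 by rewrite /sec_e !mul0mx scaler0.
set e := sec_e _ _ _ df; rewrite scaler0 addr0.
have ip0 u : ip gs u 0 = 0 by rewrite /ip trmx0 mulmx0 mxE.
have w0 := dnf_w hG.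
have -> : sec_eps w gs e 0 = - ip gs e e / (w + w).
  by rewrite /sec_eps /sec_disc !ip0 mulr0 subr0 addr0 sqrtr_sqr gtr0_norm.
set eps := _ / _.
rewrite !ipDl (ipZl _ eps) dnf_ip_L // dnf_ip_Lb // !ipDr (ipZr _ eps) ip_angular -/gs.
rewrite (ipC (angular _) (dnf_L _ _)) ?(dnf_sym hG) //.
rewrite (ipC (angular _) (dnf_Lb _ _)) ?(dnf_sym hG) //.
rewrite dnf_ip_L // dnf_ip_Lb // !pt4E !mulr0 !mxDE !(mxZE eps) dnf_LE // dnf_LbE // !pt4E.
rewrite !mxE /= /eps; field.
by rewrite -mulr2n mulrn_eq0 /= gt_eqF.
Qed.

End SecNormal.

(** A null vector orthogonal to the kernel of a covector, here
    ds - [h1] dsb - [dh], is proportional to the dual vector of the latter, which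
    is therefore null. *)
Lemma conormal_null (R : realType) (G : 'M[R]_4) (N : 'rV[R]_4) (h1 : R)
    (dh : 'rV[R]_2) : G^T = G -> G \in unitmx -> N != 0 ->
  ip G N N = 0 -> ip G N (pt4 h1 1 0) = 0 ->
  (forall a, ip G N (pt4 (dh 0 a) 0 (delta_mx 0 a)) = 0) ->
  ip (invmx G) (pt4 1 (- h1) (- dh)) (pt4 1 (- h1) (- dh)) = 0.
Proof.
move=> GT Gu N0 NN NV NF; pose n := N *m G.
have nX X : ip G N X = \sum_m n 0 m * X 0 m.
  by rewrite /ip mxE; apply: eq_bigr => m _; rewrite [X^T _ _]mxE.
have n1 : n 0 1 = - h1 * n 0 0.
  move: NV; rewrite nX sum4 !pt4E big1 => [|i _]; last by rewrite pt4E [X in _ * X]mxE mulr0.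
  by move=> E; apply/eqP; rewrite -subr_eq0; apply/eqP; rewrite -E; ring.
have n2 a : n 0 (rshift 2 a) = - dh 0 a * n 0 0.
  move: (NF a); rewrite nX sum4 !pt4E (bigD1 a) //= big1 => [|i ia]; last first.
    by rewrite pt4E [X in _ * X]mxE (negbTE ia) mulr0.
  have da : (delta_mx 0 a : 'rV[R]_2) 0 a = 1 by rewrite mxE !eqxx.
  rewrite pt4E da => E.
  by apply/eqP; rewrite -subr_eq0; apply/eqP; rewrite -E; ring.
have nE : n = n 0 0 *: pt4 1 (- h1) (- dh).
  apply/rowP; elim/ind4 => [||a]; rewrite mxZE pt4E ?mulr1 // ?n1 ?n2 ?mxE mulrC //.
have NE : N = n *m invmx G by rewrite /n mulmxK.
have n00 : n 0 0 != 0.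
  by apply: contra_neq N0 => n00; rewrite NE nE n00 scale0r mul0mx.
move: NN; rewrite NE ip_invmx // nE ipZl ipZr => /eqP.
by rewrite !mulf_eq0 !(negbTE n00) /= => /eqP.
Qed.

(** * First variation of the null expansion *)

Lemma is_derive_bigsum (R : realType) (V : normedModType R) n (x v : V)
    (f : 'I_n -> V -> R) (df : 'I_n -> R) :
  (forall i, is_derive x v (f i) (df i)) ->
  is_derive x v (fun y => \sum_i f i y) (\sum_i df i).
Proof.
move=> hf; have := is_derive_sum hf.
by apply: is_derive_ext; apply/funext => y; rewrite fct_sumE.
Qed.

Lemma is_derive_mul (R : realType) (V : normedModType R) (x v : V)
    (f g : V -> R) (df dg : R) : is_derive x v f df -> is_derive x v g dg ->
  is_derive x v (fun y => f y * g y) (df * g x + f x * dg).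
Proof.
move=> hf hg; have := is_deriveM hf hg.
by rewrite /GRing.scale /= addrC [g x * _]mulrC.
Qed.

(** The part of [chi_form] that involves only first derivatives of the
    immersion. *)
Definition chi_first {R : realType} (G : 'rV[R]_4 -> 'M[R]_4)
    (x N X Y : 'rV[R]_4) : R :=
  ip (G x) (\row_m \sum_(i < 4) \sum_(j < 4) christoffel G x m i j * X 0 i * N 0 j) Y
  - \sum_(m < 4) \sum_(n < 4) N 0 m
      * (\sum_(l < 4) X 0 l * partial l (fun z => G z m n) x) * Y 0 n.

(** For a normal field, differentiating [g(N, F_b) = 0] trades the derivative of
    [N] for second derivatives of the immersion. *)
Lemma chi_form_normal (R : realType) k (G : 'rV[R]_4 -> 'M[R]_4)
    (F N : 'rV[R]_k -> 'rV[R]_4) (y : 'rV[R]_k) (a b : 'I_k) :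
  (\forall z \near y, ip (G (F z)) (N z) (frame F b z) = 0) ->
  (forall m n, differentiable (fun x => G x m n) (F y)) ->
  (forall m, derivable (fun z => F z 0 m) y (delta_mx 0 a)) ->
  (forall m, derivable (partial b (fun z => F z 0 m)) y (delta_mx 0 a)) ->
  (forall m, derivable (fun z => N z 0 m) y (delta_mx 0 a)) ->
  chi_form G F N y a b =
    chi_first G (F y) (N y) (frame F a y) (frame F b y)
    - ip (G (F y)) (N y)
        (\row_m partial a (partial b (fun z => F z 0 m)) y).
Proof.
move=> orth dG dF ddF dN.
pose N' m := partial a (fun z => N z 0 m) y.
pose F' m := partial a (fun z => F z 0 m) y.
pose F2 m := partial a (partial b (fun z => F z 0 m)) y.
pose G' m n := \sum_l F' l * partial l (fun x => G x m n) (F y).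
have dsum : is_derive y (delta_mx 0 a)
    (fun z => \sum_m \sum_n N z 0 m * G (F z) m n * partial b (fun w => F w 0 n) z)
    (\sum_m \sum_n ((N' m * G (F y) m n + N y 0 m * G' m n)
         * partial b (fun w => F w 0 n) y + N y 0 m * G (F y) m n * F2 n)).
  apply: is_derive_bigsum => m; apply: is_derive_bigsum => n.
  apply: is_derive_mul; last exact/derivableP/ddF.
  apply: is_derive_mul; first exact/derivableP/dN.
  exact: is_derive_chain (dG m n) dF.
have E0 : \sum_m \sum_n ((N' m * G (F y) m n + N y 0 m * G' m n)
         * partial b (fun w => F w 0 n) y + N y 0 m * G (F y) m n * F2 n) = 0.
  rewrite -(@derive_val _ _ _ _ _ _ _ dsum).
  rewrite (@near_eq_derive _ _ _ _ (fun=> 0)) ?derive_cst //.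
  apply: filterS orth => z oz; rewrite -[RHS]oz ipE; apply: eq_bigr => m _.
  by apply: eq_bigr => n _; rewrite mxE.
rewrite /chi_first mxE !ipE.
rewrite [LHS](_ : _ = \sum_m \sum_n (N' m + \sum_(i < 4) \sum_(j < 4)
   christoffel G (F y) m i j * frame F a y 0 i * N y 0 j) * G (F y) m n
   * partial b (fun w => F w 0 n) y); last first.
  by apply: eq_bigr => m _; apply: eq_bigr => n _; rewrite !mxE.
apply/eqP; rewrite -subr_eq0 -[X in _ == X]E0 -subr_eq0; apply/eqP.
rewrite -!sumrB; apply: big1 => m _; rewrite -!sumrB; apply: big1 => n _.
rewrite !mxE /G'.
have -> : \sum_l frame F a y 0 l * partial l (fun z => G z m n) (F y) =
    \sum_l F' l * partial l (fun x => G x m n) (F y).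
  by apply: eq_bigr => l _; rewrite mxE.
set S := \sum_l _ * _; set C := \sum_(i < 4) _.
rewrite -/(F2 n).
move: (N' m) (F2 n) (partial b _ y) (N y 0 m) (G (F y) m n) S C => p q r s t u v.
clear; ring.
Qed.

(** As the tangent frames agree, both traces are taken with respect to the same
    first fundamental form. *)
Lemma null_expansion_diff (R : realType) (G : 'rV[R]_4 -> 'M[R]_4)
    (F1 N1 F2 N2 : 'rV[R]_2 -> 'rV[R]_4) (y : 'rV[R]_2) (r : R) :
  F1 y = F2 y -> N1 y = N2 y -> (forall a, frame F1 a y = frame F2 a y) ->
  (forall a b, chi_form G F1 N1 y a b - chi_form G F2 N2 y a b = (a == b)%:R * r) ->
  null_expansion G F1 N1 y - null_expansion G F2 N2 y =
    \tr (invmx (first_form G F2 y)) * r.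
Proof.
move=> eF eN ef dchi; rewrite /null_expansion.
have -> : first_form G F1 y = first_form G F2 y.
  by apply/matrixP => a b; rewrite !mxE eF !ef.
rewrite -raddfB -mulmxBr.
have -> : chi_form G F1 N1 y - chi_form G F2 N2 y = r%:M.
  by apply/matrixP => a b; rewrite mxE [X in _ + X]mxE dchi [RHS]mxE mulrC mulr_natr.
by rewrite mul_mx_scalar; apply: etrans (mxtraceZ _ _) _; rewrite mulrC.
Qed.

(** Contracting with the metric removes its inverse: second fundamental forms of
    coordinate slices are read off from first derivatives of the metric. *)
Lemma christoffel_lower (R : realType) (G : 'rV[R]_4 -> 'M[R]_4) x a b n :
  (G x)^T = G x -> G x \in unitmx ->
  \sum_m christoffel G x m a b * G x m n =
    2^-1 * (partial a (fun z => G z n b) x + partial b (fun z => G z n a) x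
            - partial n (fun z => G z a b) x).
Proof.
move=> GT Gu; rewrite /christoffel.
pose K l := partial a (fun z => G z l b) x + partial b (fun z => G z l a) x
  - partial l (fun z => G z a b) x.
rewrite [LHS](_ : _ = \sum_m 2^-1 * (\sum_(l < 4) invmx (G x) m l * K l) * G x m n) //.
have -> : \sum_m 2^-1 * (\sum_(l < 4) invmx (G x) m l * K l) * G x m n =
    2^-1 * \sum_(l < 4) (\sum_m G x n m * invmx (G x) m l) * K l.
  rewrite mulr_sumr; under [RHS]eq_bigr do rewrite mulr_suml mulr_sumr.
  rewrite [RHS]exchange_big /=; apply: eq_bigr => m _.
  rewrite -mulrA mulr_suml mulr_sumr; apply: eq_bigr => l _.
  have -> : G x n m = G x m n by rewrite -[in LHS]GT mxE.
  by congr (_ * _); rewrite mulrC mulrA.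
rewrite -/(K n); congr (_ * _).
have GI l : \sum_m G x n m * invmx (G x) m l = (n == l)%:R.
  by have := mulmxV Gu => /matrixP /(_ n l); rewrite !mxE.
rewrite (eq_bigr (fun l => (n == l)%:R * K l)) => [|l _]; last by rewrite GI.
rewrite (bigD1 n) //= big1 ?addr0 => [|l ln]; first by rewrite eqxx mul1r.
by rewrite eq_sym (negbTE ln) mul0r.
Qed.

(** Along a coordinate slice with a coordinate field as normal a single
    Christoffel symbol of the first kind survives. The coordinates that vary
    along the slice are listed by [s]. *)
Lemma chi_form_coord (R : realType) k (G : 'rV[R]_4 -> 'M[R]_4)
    (F N : 'rV[R]_k -> 'rV[R]_4) (z : 'rV[R]_k) (s : 'I_k -> 'I_4) (c : 'I_4)
    (a b : 'I_k) :
  (G (F z))^T = G (F z) -> G (F z) \in unitmx ->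
  (forall a, frame F a z = delta_mx 0 (s a)) ->
  (\forall w \near z, N w = delta_mx 0 c) ->
  chi_form G F N z a b =
   2^-1 * (partial (s a) (fun x => G x (s b) c) (F z)
     + partial c (fun x => G x (s b) (s a)) (F z)
     - partial (s b) (fun x => G x (s a) c) (F z)).
Proof.
move=> GT Gu fr Nc; rewrite mxE fr -christoffel_lower // ipE.
have Nz : N z = delta_mx 0 c by exact: nbhs_singleton Nc.
apply: eq_bigr => m _; rewrite (bigD1 (s b)) //= big1 ?addr0 => [|n nb]; last first.
  by rewrite [delta_mx _ _ _ _]mxE (negbTE nb) andbF mulr0.
rewrite [delta_mx _ _ _ _]mxE !eqxx mulr1 mxE; congr (_ * _).
have -> : partial a (fun w => N w 0 m) z = 0.
  rewrite /partial (@near_eq_derive _ _ _ _ (fun=> (delta_mx 0 c : 'rV[R]_4) 0 m)).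
    exact: derive_cst.
  by apply: filterS Nc => w ->.
rewrite add0r fr Nz (bigD1 (s a)) //= [X in _ + X]big1 ?addr0 => [|i ia]; last first.
  by apply: big1 => j _; rewrite mxE (negbTE ia) andbF mulr0 mul0r.
rewrite (bigD1 c) //= big1 ?addr0 => [|j jc]; last first.
  by rewrite [X in _ * X]mxE (negbTE jc) andbF mulr0.
by rewrite !mxE !eqxx !mulr1.
Qed.

(** * The metric in a double null chart *)

Section DoubleNull.
Variables (R : realType) (M S : topologicalType).
Variables (A : smooth_structure R 4 M) (g : lorentz_metric A).
Variables (T : time_orientation g) (AS : smooth_structure R 2 S).
Variables (d : dn_data R M S).
Hypothesis hd : double_null T AS d.

Lemma dn_chart_coord k x : smooth_chart AS k -> cimg (dn_chart d k) x ->
  let p := cinv (dn_chart d k) x in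
  [/\ cdom (dn_chart d k) p, dn_s d p = x 0 (0 : 'I_4), dn_sb d p = x 0 (1 : 'I_4)
    & cmap k (dn_th d p) = @rsubmx R 1 2 2 x].
Proof.
move=> sk Ix /=; have [hc _] := dn_smooth_chart hd sk.
have [cp E] := cimgP hc Ix; split => //.
- by rewrite -[in RHS]E /= pt4E.
- by rewrite -[in RHS]E /= pt4E.
- by rewrite -[in RHS]E /= row_mxKr.
Qed.

Lemma dfun_coord k (f : M -> R) (m : 'I_4) p : smooth_chart AS k ->
  cdom (dn_chart d k) p ->
  (forall x, cimg (dn_chart d k) x -> f (cinv (dn_chart d k) x) = x 0 m) ->
  dfun (dn_chart d k) f p = delta_mx 0 m.
Proof.
move=> sk cp E; have [hc _] := dn_smooth_chart hd sk.
apply/rowP => i; rewrite mxE /partial.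
rewrite (derive_ext_open _ (chart_open_img hc) (cmap_cimg cp)
  (g := fun x : 'rV[R]_4 => x 0 m)); last by move=> y /E.
rewrite (@derive_val _ _ _ _ _ _ _ (is_derive_coord m _ _)) !mxE eqxx /=.
by rewrite eq_sym.
Qed.

Lemma dfun_s k p : smooth_chart AS k -> cdom (dn_chart d k) p ->
  dfun (dn_chart d k) (dn_s d) p = delta_mx 0 0.
Proof. by move=> sk cp; apply: dfun_coord => // x /(dn_chart_coord sk)[]. Qed.

Lemma dfun_sb k p : smooth_chart AS k -> cdom (dn_chart d k) p ->
  dfun (dn_chart d k) (dn_sb d) p = delta_mx 0 1.
Proof. by move=> sk cp; apply: dfun_coord => // x /(dn_chart_coord sk)[]. Qed.

Lemma dfun_th k p i : smooth_chart AS k -> cdom (dn_chart d k) p ->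
  dfun (dn_chart d k) (fun q => cmap k (dn_th d q) 0 i) p = delta_mx 0 (rshift 2 i).
Proof.
move=> sk cp; apply: dfun_coord => // x /(dn_chart_coord sk)[_ _ _ ->].
by rewrite mxE.
Qed.

Definition dn_w (p : M) : R := 2 * dn_Om d p ^+ 2.

Lemma dn_LvecE k p : smooth_chart AS k -> cdom (dn_chart d k) p ->
  Lvec g d (dn_chart d k) p = dnf_L (g (dn_chart d k) p) (dn_w p).
Proof.
move=> sk cp; rewrite /Lvec /Lprime /grad dfun_s // scalerA -rowE /dnf_L /dn_w.
by rewrite mulrC.
Qed.

Lemma dn_LbvecE k p : smooth_chart AS k -> cdom (dn_chart d k) p ->
  Lbvec g d (dn_chart d k) p = dnf_Lb (g (dn_chart d k) p) (dn_w p).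
Proof.
move=> sk cp; rewrite /Lbvec /Lbprime /grad dfun_sb // scalerA -rowE /dnf_Lb /dn_w.
by rewrite mulrC.
Qed.

(** The two eikonal equations make the diagonal entries vanish, the definition of
    Om fixes the entry 01, and the constancy of theta along [L] kills the mixed
    entries. *)
Lemma dn_formP k p : smooth_chart AS k -> cdom (dn_chart d k) p ->
  dn_form (g (dn_chart d k) p) (dn_w p).
Proof.
move=> sk cp; have sc := dn_smooth_chart hd sk.
have dp : dn_dom d p by case: cp.
have GT := Defs.metric_sym g sc cp; have Gu := metric_unit g sc cp.
have O0 := dn_Om_gt0 hd dp.
have w0 : 0 < dn_w p by rewrite mulr_gt0 // exprn_gt0.
have wI : dn_w p * invmx (g (dn_chart d k) p) 0 1 = 1.
  have := dn_OmE hd sc dp cp.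
  rewrite /Lprime /Lbprime ipZl ipZr /grad ip_invmx // dfun_s // dfun_sb // ip_delta.
  move=> E; apply: (@mulfI _ (2 * dn_Om d p ^- 2)).
    by rewrite mulf_neq0 // invr_neq0 // gt_eqF // exprn_gt0.
  rewrite mulr1 {2}E /dn_w; have := lt0r_neq0 O0; move: (invmx _ 0 1) => I01.
  by move: (dn_Om d p) => O On0; field.
split => //.
- exact: metric_signature.
- have := dn_eikonal_s hd sc dp cp.
  by rewrite /grad ip_invmx // dfun_s // ip_delta.
- have := dn_eikonal_sb hd sc dp cp.
  by rewrite /grad ip_invmx // dfun_sb // ip_delta.
- move=> i; have := dn_th_L hd i sk cp.
  rewrite /vapp dfun_th // (bigD1 (rshift 2 i)) //= big1 ?addr0 => [|j ji].
    rewrite dn_LvecE // [delta_mx _ _ _ _]mxE !eqxx mulr1 /dnf_L mxZE [row _ _ _ _]mxE.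
    move=> /eqP.
    by rewrite mulf_eq0 (gt_eqF w0) => /eqP.
  by rewrite [X in _ * X]mxE (negbTE ji) andbF mulr0.
Qed.

Lemma metric_differentiable c x m n : smooth_chart A c -> cimg c x ->
  differentiable (fun x => metric_in g c x m n) x.
Proof.
move=> sc cx; have [hc _] := sc.
exact: Ck_differentiable (chart_open_img hc) (metric_smooth g sc m n 1%N) cx.
Qed.

End DoubleNull.

(** * A uniqueness principle *)

(** On a short interval the maximum of [\sum_j |v_j|] is at most half of
    itself. *)
Lemma linear_ode_zero (R : realType) n (v dv : 'I_n -> R -> R) (t0 r K : R) :
  0 < r ->
  (forall t k, `|t - t0| <= r -> is_derive t 1 (v k) (dv k t)) ->
  (forall t k, `|t - t0| <= r -> `|dv k t| <= K * \sum_j `|v j t|) ->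
  (forall k, v k t0 = 0) ->
  exists2 e, 0 < e & forall t k, `|t - t0| <= e -> v k t = 0.
Proof.
move=> r0 Dv bv v0.
pose K1 := `|K| + 1.
have K10 : 0 < K1 by rewrite ltr_wpDl.
pose N : R := n.+1%:R.
have N0 : 0 < N by rewrite ltr0n.
(* This length makes [e * (n + 1) * K1] at most one half. *)
pose e := Num.min r (2 * N * K1)^-1.
have q0 : 0 < 2 * N * K1 by rewrite !mulr_gt0.
have e0 : 0 < e by rewrite lt_min r0 invr_gt0.
have er : e <= r by rewrite ge_min lexx.
have eN : e * (N * K1) <= 2^-1.
  have : e <= (2 * N * K1)^-1 by rewrite ge_min lexx orbT.
  have NK : 0 < N * K1 by rewrite mulr_gt0.
  move=> eI; apply: (@le_trans _ _ ((2 * N * K1)^-1 * (N * K1))).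
    by rewrite ler_pM2r.
  by rewrite -mulrA invfM mulfVK // gt_eqF.
have itvP t : (t \in `[t0 - e, t0 + e]) = (`|t - t0| <= e).
  by rewrite in_itv /= ler_distl.
pose s t := \sum_j `|v j t|.
have s0 t : 0 <= s t by apply: sumr_ge0.
have cs : {within `[t0 - e, t0 + e], continuous s}.
  apply/continuous_in_subspaceT => t; rewrite inE /= itvP => te.
  apply: continuous_bigsum => j _.
  apply: continuous_comp; last exact: norm_continuous.
  apply/differentiable_continuous/derivable1_diffP.
  have H := Dv t j (le_trans te er); exact: (@ex_derive _ _ _ _ _ _ _ H).
have [|m mI mM] := EVT_max _ cs.
  by rewrite lerD2l ge0_cp // ltW.
rewrite itvP in mI.
have vm k : `|v k m| <= e * K1 * s m.
  have [|x xm E] := @mvt_line _ _ (v k) t0 (1 : R) (m - t0).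
    move=> x xm; rewrite [x *: _]mulr1.
    have H := Dv (x + t0) k; apply: (@ex_derive _ _ _ _ _ _ _ (H _)).
    by rewrite addrK; exact: le_trans xm (le_trans mI er).
  move: E; rewrite ![_ *: (1 : R)]mulr1 subrK v0 subr0 => ->.
  have xe : `|(x + t0) - t0| <= e by rewrite addrK; exact: le_trans mI.
  have H := Dv _ k (le_trans xe er).
  rewrite (@derive_val _ _ _ _ _ _ _ H) normrM -mulrA; apply: ler_pM => //.
  apply: le_trans (bv _ k (le_trans xe er)) _.
  apply: (@le_trans _ _ (K1 * s (x + t0))).
    apply: ler_wpM2r; first exact: s0.
    by apply: (le_trans (ler_norm K)); rewrite /K1 lerDl.
  by apply: ler_wpM2l; [exact: ltW | apply: mM; rewrite itvP].
have sm : s m <= 2^-1 * s m.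
  apply: (@le_trans _ _ (\sum_(j < n) e * K1 * s m)); first exact: ler_sum.
  rewrite sumr_const card_ord -[_ *+ n]mulr_natl.
  apply: (@le_trans _ _ (e * (N * K1) * s m)); last exact: ler_wpM2r.
  rewrite !mulrA; apply: ler_wpM2r => //; rewrite [e * N]mulrC; apply: ler_wpM2r.
    exact: ltW.
  by apply: ler_wpM2r; [exact: ltW | rewrite ler_nat].
have sm0 : s m = 0.
  apply/eqP; rewrite eq_le s0 andbT; move: sm; move: (s m) => q; clear; lra.
exists e => // t k te; apply/eqP; rewrite -normr_le0.
rewrite -itvP in te; apply: (@le_trans _ _ (s t)); last by have := mM _ te; rewrite sm0.
rewrite /s (bigD1 k) //=.
by rewrite lerDl sumr_ge0.
Qed.

Definition pt3 {R : realType} (t : R) (y : 'rV[R]_2) : 'rV[R]_(1 + 2) :=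
  row_mx (\row_j t) y.

Lemma pt3E (R : realType) (t t0 : R) y :
  pt3 t y = (t - t0) *: delta_mx 0 (lshift 2 0) + pt3 t0 y.
Proof.
apply/rowP => j; rewrite -(fintype.splitK j); case: (fintype.split j) => i /=.
  by rewrite mxDE mxZE !row_mxEl !mxE (ord1 i) eqxx mulr1 subrK.
by rewrite mxDE mxZE !row_mxEr mxE eq_rlshift andbF mulr0 add0r.
Qed.

(** Differentiated in the angular variables, the equation becomes a linear
    homogeneous one for the angular gradient along the line [y = y0]: the second
    derivatives of [h] that occur are bounded coefficients. *)
Lemma quadratic_flow (R : realType) (U : set 'rV[R]_(1 + 2))
    (h : 'rV[R]_(1 + 2) -> R) (c : 'I_2 -> 'I_2 -> 'rV[R]_(1 + 2) -> R)
    (t0 : R) (y0 : 'rV[R]_2) :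
  open U -> U (pt3 t0 y0) -> smooth_on U h ->
  (forall i j, smooth_on U (c i j)) ->
  (forall z, U z -> partial (lshift 2 0) h z =
     \sum_i \sum_j c i j z * partial (rshift 1 i) h z * partial (rshift 1 j) h z) ->
  (forall i, partial (rshift 1 i) h (pt3 t0 y0) = 0) ->
  exists2 e, 0 < e & forall t i, `|t - t0| <= e ->
    partial (rshift 1 i) h (pt3 t y0) = 0.
Proof.
move=> oU U0 sh sc E h0.
pose p i := partial (rshift 1 i) h.
have sp i k : Ck k U (p i) by apply: Ck_partial; exact: sh.
(* The coefficient of the [j]-th angular derivative, after the two terms that
   contain second derivatives have been symmetrized. *)
pose Mm k j z := \sum_i (partial (rshift 1 k) (c i j) z * p i z
   + c i j z * partial (rshift 1 k) (p i) z
   + c j i z * partial (rshift 1 k) (p i) z).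
have cM k j : Ck 0 U (Mm k j).
  apply: (Ck_sum oU) => i _; apply: (CkD oU); first apply: (CkD oU).
  - by apply: (CkM oU); [apply: Ck_partial; exact: sc | exact: sp].
  - by apply: (CkM oU); [exact: sc | apply: Ck_partial; exact: sp].
  - by apply: (CkM oU); [exact: sc | apply: Ck_partial; exact: sp].
have dE k z : U z -> partial (lshift 2 0) (p k) z = \sum_j Mm k j z * p j z.
  move=> Uz.
  have -> : partial (lshift 2 0) (p k) z
      = partial (rshift 1 k) (partial (lshift 2 0) h) z.
    have s1 i := Ck_partial i (sh 1%N); have s2 i := Ck_partial i (sh 2%N).
    apply: schwarz.
    - have : \forall y \near z, U y by exact: open_nbhs_nbhs.
      apply: filterS => y Uy; split.
      + by have [_ /(_ (rshift 1 k))[+ _]] := sh 1%N; apply.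
      + by have [_ /(_ (lshift 2 0))[+ _]] := sh 1%N; apply.
      + by have [_ /(_ (lshift 2 0))[+ _]] := s2 (rshift 1 k); apply.
      + by have [_ /(_ (rshift 1 k))[+ _]] := s2 (lshift 2 0); apply.
    - by have [_ /(_ (lshift 2 0))[_ H]] := s2 (rshift 1 k); exact: H Uz.
    - by have [_ /(_ (rshift 1 k))[_ H]] := s2 (lshift 2 0); exact: H Uz.
  rewrite {1}/partial (derive_ext_open _ oU Uz E).
  have dp i : is_derive z (delta_mx 0 (rshift 1 k)) (p i) (partial (rshift 1 k) (p i) z).
    by apply/derivableP; have [_ /(_ (rshift 1 k))[+ _]] := sp i 1%N; apply.
  have dc i j : is_derive z (delta_mx 0 (rshift 1 k)) (c i j)
      (partial (rshift 1 k) (c i j) z).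
    by apply/derivableP; have [_ /(_ (rshift 1 k))[+ _]] := sc i j 1%N; apply.
  have H := is_derive_bigsum (fun i => is_derive_bigsum (fun j =>
     is_derive_mul (is_derive_mul (dc i j) (dp i)) (dp j))).
  rewrite (@derive_val _ _ _ _ _ _ _ H) /Mm -/p.
  pose P i j := (partial (rshift 1 k) (c i j) z * p i z
    + c i j z * partial (rshift 1 k) (p i) z) * p j z.
  pose Q i j := c i j z * p i z * partial (rshift 1 k) (p j) z.
  rewrite [LHS](_ : _ = \sum_i \sum_j (P i j + Q i j)) //.
  rewrite (eq_bigr (fun i => \sum_j P i j + \sum_j Q i j)) => [|i _]; last first.
    by rewrite big_split.
  rewrite big_split /= [X in X + _]exchange_big /= -big_split.
  apply: eq_bigr => j _; rewrite mulr_suml -big_split.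
  by apply: eq_bigr => i _; rewrite /P /Q /=; ring.
have bM k j : exists2 B : R, 0 <= B & \forall z \near pt3 t0 y0, `|Mm k j z| <= B.
  have cz := Ck_continuous (cM k j) U0.
  exists (`|Mm k j (pt3 t0 y0)| + 1); first by rewrite addr_ge0.
  move/cvgrPdist_le : cz => /(_ _ ltr01); apply: filterS => z Hz.
  rewrite -(subrK (Mm k j (pt3 t0 y0)) (Mm k j z)).
  by apply: le_trans (ler_normD _ _) _; rewrite addrC lerD2l distrC.
have [B B0 bB] : exists2 B : R, 0 <= B &
    \forall z \near pt3 t0 y0, forall k j, `|Mm k j z| <= B.
  have H k : exists2 B : R, 0 <= B &
      \forall z \near pt3 t0 y0, forall j, `|Mm k j z| <= B.
    have [B1 B10 b1] := bM k 0; have [B2 B20 b2] := bM k 1.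
    exists (B1 + B2); first by rewrite addr_ge0.
    apply: filterS2 b1 b2 => z z1 z2 j.
    have : j = 0 \/ j = 1.
      by case: j => -[|[|]] // hi; [left|right]; apply: val_inj.
    by case=> ->; [apply: le_trans z1 _; rewrite lerDl
                  | apply: le_trans z2 _; rewrite lerDr].
  have [B1 B10 b1] := H 0; have [B2 B20 b2] := H 1.
  exists (B1 + B2); first by rewrite addr_ge0.
  apply: filterS2 b1 b2 => z z1 z2 k j.
  have : k = 0 \/ k = 1.
    by case: k => -[|[|]] // hi; [left|right]; apply: val_inj.
  by case=> ->; [apply: le_trans (z1 j) _; rewrite lerDl
                | apply: le_trans (z2 j) _; rewrite lerDr].
have nU : \forall z \near pt3 t0 y0, U z by exact: open_nbhs_nbhs.
have [r r0 rP] := (near_ballP _ _).1 (filterI nU bB).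
have r2 : 0 < r / 2 by rewrite divr_gt0.
have inr t : `|t - t0| <= r / 2 -> `|pt3 t y0 - pt3 t0 y0| < r.
  move=> tr; rewrite (pt3E t t0) addrK norm_delta; apply: le_lt_trans tr _.
  by rewrite ltr_pdivrMr // ltr_pMr // ltr1n.
have [||//|e e0 eP] := @linear_ode_zero _ 2 (fun k t => p k (pt3 t y0))
    (fun k t => \sum_j Mm k j (pt3 t y0) * p j (pt3 t y0)) t0 (r / 2) B r2.
- move=> t k /inr /rP[Ut _].
  have zE u : pt3 u y0 = u *: delta_mx 0 (lshift 2 0) + pt3 0 y0.
    by rewrite (pt3E u 0) subr0.
  have dp : derivable (p k) (pt3 t y0) (delta_mx 0 (lshift 2 0)).
    by have [_ /(_ (lshift 2 0))[+ _]] := sp k 1%N; apply.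
  rewrite zE in dp; have := is_derive_line dp; rewrite -zE => H.
  apply: (is_derive_eq _ (dE k _ Ut)); apply: is_derive_ext H.
  by apply/funext => u; rewrite -zE.
- move=> t k /inr /rP[_ Mt]; apply: le_trans (ler_norm_sum _ _ _) _.
  rewrite mulr_sumr; apply: ler_sum => j _; rewrite normrM.
  by apply: ler_wpM2r; [exact: normr_ge0 | exact: Mt].
- by exists e => // t i te; exact: eP.
Qed.

(** * Graphs in double null coordinates *)

Lemma pt3_t (R : realType) (t : R) y : pt3 t y 0 (lshift 2 0) = t.
Proof. by rewrite row_mxEl mxE. Qed.
Lemma pt3_y (R : realType) (t : R) y : rsubmx (pt3 t y) = y.
Proof. by rewrite row_mxKr. Qed.
Lemma pt3_i (R : realType) (t : R) y i : pt3 t y 0 (rshift 1 i) = y 0 i.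
Proof. by rewrite row_mxEr. Qed.

Lemma pt3_eta (R : realType) (z : 'rV[R]_(1 + 2)) :
  z = pt3 (z 0 (lshift 2 0)) (rsubmx z).
Proof.
rewrite -[LHS]hsubmxK; congr row_mx.
by apply/rowP => j; rewrite !mxE (ord1 j).
Qed.

Lemma norm_pt3 (R : realType) (t t' : R) y y' :
  `|pt3 t' y' - pt3 t y| <= `|t' - t| + `|y' - y|.
Proof.
apply: norm_rowP => [|j]; first by rewrite addr_ge0.
rewrite mxE [X in _ + X]mxE -(fintype.splitK j); case: (fintype.split j) => i /=.
  by rewrite (ord1 i) !pt3_t lerDl.
rewrite !pt3_i; apply: (@le_trans _ _ `|y' - y|); last by rewrite lerDr.
by have := norm_coord (y' - y) i; rewrite !mxE.
Qed.

Lemma near_pt3 (R : realType) (P : 'rV[R]_(1 + 2) -> Prop) t y :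
  (\forall z \near pt3 t y, P z) ->
  exists2 e, 0 < e & forall t' y', `|t' - t| < e -> `|y' - y| < e -> P (pt3 t' y').
Proof.
move=> /near_ballP[r r0 rP]; exists (r / 2); first by rewrite divr_gt0.
move=> t' y' tt yy; apply: rP; apply: le_lt_trans (norm_pt3 _ _ _ _) _.
by rewrite [ltRHS]splitr ltrD.
Qed.

Lemma slice_partial (R : realType) (H : 'rV[R]_(1 + 2) -> R) t y i :
  partial (rshift 1 i) H (pt3 t y) = partial i (fun y => H (pt3 t y)) y.
Proof.
rewrite /partial /derive; set u := (fun s : R => _); set v := (fun s : R => _).
suff -> : u = v by []; apply/funext => s; rewrite /u /v /=.
congr (_ *: (H _ - _)); apply/rowP => j.
rewrite -(fintype.splitK j); case: (fintype.split j) => l /=.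
  by rewrite mxDE mxZE mxE eq_lrshift andbF mulr0 add0r (ord1 l) !pt3_t.
by rewrite mxDE mxZE !pt3_i mxDE mxZE !mxE eq_rshift.
Qed.

(** Both [Q] and its negation are relatively open in the interval, which is
    connected. *)
Lemma interval_ind (R : realType) (I Q : set R) (a b : R) :
  is_interval I -> I a -> I b -> Q a ->
  (forall t, I t -> \forall u \near t, I u -> (Q u <-> Q t)) -> Q b.
Proof.
move=> /connected_intervalP cI Ia Ib Qa loc.
suff E : I `&` Q = I by have [] : (I `&` Q) b by rewrite E.
apply: cI; first by exists a.
- exists (interior [set u | I u -> Q u]); first exact: open_interior.
  rewrite predeqE => t; split=> [[It Qt]|[It /nbhs_singleton]]; last by split; auto.
  by split => //; apply: filterS (loc _ It) => u + Iu => /(_ Iu)[_]; apply.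
- exists (~` interior [set u | I u -> ~ Q u]).
    by apply: open_closedC; exact: open_interior.
  rewrite predeqE => t; split=> [[It Qt]|[It nt]].
    by split => // /nbhs_singleton; apply.
  split => //; apply: contrapT => nQ; apply: nt.
  by apply: filterS (loc _ It) => u + Iu => /(_ Iu)[Qut _] /Qut.
Qed.

Section Graph.
Variables (R : realType) (M S : topologicalType).
Variables (A : smooth_structure R 4 M) (g : lorentz_metric A).
Variables (T : time_orientation g) (AS : smooth_structure R 2 S).
Variables (d : dn_data R M S) (D : set (R * S)) (h : R -> S -> R).
Hypothesis hd : double_null T AS d.
Hypothesis hh : graph_function AS d D h.

(** Everything attached to the graph is a function of the parameter row
    (sb, theta), theta being expressed in a chart of the base surface, so that
    the calculus on row vectors applies. *)
Definition gr_dom (k : chart R 2 S) : set 'rV[R]_(1 + 2) :=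
  [set z : 'rV[R]_(1 + 2) | cimg k (rsubmx z) /\
     D (z 0 (lshift 2 0), cinv k (rsubmx z))].

Definition gr_fun (k : chart R 2 S) (z : 'rV[R]_(1 + 2)) : R :=
  h (z 0 (lshift 2 0)) (cinv k (rsubmx z)).

Definition gr_pt (k : chart R 2 S) (z : 'rV[R]_(1 + 2)) : 'rV[R]_4 :=
  pt4 (gr_fun k z) (z 0 (lshift 2 0)) (rsubmx z).

Definition gr_met (k : chart R 2 S) (z : 'rV[R]_(1 + 2)) : 'M[R]_4 :=
  metric_in g (dn_chart d k) (gr_pt k z).

(** The components of the differential of s - h. *)
Definition gr_conormal (k : chart R 2 S) (z : 'rV[R]_(1 + 2)) : 'rV[R]_4 :=
  pt4 1 (- partial (lshift 2 0) (gr_fun k) z)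
    (- \row_i partial (rshift 1 i) (gr_fun k) z).

Definition gr_sq (k : chart R 2 S) (z : 'rV[R]_(1 + 2)) : R :=
  ip (invmx (gr_met k z)) (gr_conormal k z) (gr_conormal k z).

Lemma gr_dom_open k : smooth_chart AS k -> open (gr_dom k).
Proof.
move=> [hk _]; rewrite openE => z [Iz Dz].
have nI : \forall z' \near z, cimg k (rsubmx (z' : 'rV[R]_(1 + 2))).
  apply: (differentiable_continuous (differentiable_rsubmx _)).
  by apply: open_nbhs_nbhs; split => //; exact: chart_open_img.
have c1 : {for z, continuous (fun z : 'rV[R]_(1 + 2) => z 0 (lshift 2 0))}.
  exact: coord_continuous.
have c2 : {for z, continuous (fun z : 'rV[R]_(1 + 2) => cinv k (rsubmx z))}.
  apply: continuous_comp; last exact: chart_continuous_inv hk _ Iz.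
  exact: differentiable_continuous (differentiable_rsubmx _).
have nD : \forall z' \near z, D ((z' : 'rV[R]_(1 + 2)) 0 (lshift 2 0),
    cinv k (rsubmx (z' : 'rV[R]_(1 + 2)))).
  have oD : nbhs (z 0 (lshift 2 0), cinv k (rsubmx z)) D.
    by apply: open_nbhs_nbhs; split => //; exact: graph_open hh.
  exact: (cvg_pair c1 c2 oD).
exact: filterS2 nI nD.
Qed.

Lemma gr_domP k t x : smooth_chart AS k -> cdom k x ->
  (gr_dom k (pt3 t (cmap k x)) <-> D (t, x)).
Proof.
move=> [hk _] kx; rewrite /gr_dom /= pt3_t pt3_y (chart_cancel hk) //.
by split=> [[]//|Dt]; split=> //; exact: cmap_cimg.
Qed.

Lemma gr_fun_pt3 k t y : gr_fun k (pt3 t y) = h t (cinv k y).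
Proof. by rewrite /gr_fun pt3_t pt3_y. Qed.

Lemma gr_pt_img k z : smooth_chart AS k -> gr_dom k z ->
  [/\ cimg (dn_chart d k) (gr_pt k z), cdom (dn_chart d k) (cinv (dn_chart d k) (gr_pt k z))
    & cinv (dn_chart d k) (gr_pt k z) =
      dn_point d (gr_fun k z) (z 0 (lshift 2 0)) (cinv k (rsubmx z))].
Proof.
move=> sk [Iz Dz]; have [hk _] := sk; have [ky E] := cimgP hk Iz.
have [p [dp sp tp xp]] := graph_in_dom hh Dz.
have [hc _] := dn_smooth_chart hd sk.
have Ip : cimg (dn_chart d k) (gr_pt k z).
  exists p; first by split => //=; rewrite xp.
  by rewrite /= sp tp xp E.
have [cp _] := cimgP hc Ip; split => //=.
by rewrite /gr_pt !row_mxEl !mxE /= row_mxKr.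
Qed.

Lemma gr_pt_smooth k j : smooth_on (gr_dom k) (gr_fun k) ->
  smooth_on (gr_dom k) (fun z => gr_pt k z 0 j).
Proof.
move=> sh m; move: j; elim/ind4 => [||i].
- by rewrite (_ : (fun _ => _) = gr_fun k) //; apply/funext => z; rewrite pt4E.
- rewrite (_ : (fun _ => _) = fun z : 'rV[R]_(1 + 2) => z 0 (lshift 2 0)); first exact: Ck_coord.
  by apply/funext => z; rewrite pt4E.
- rewrite (_ : (fun _ => _) = fun z : 'rV[R]_(1 + 2) => z 0 (rshift 1 i)); first exact: Ck_coord.
  by apply/funext => z; rewrite pt4E mxE.
Qed.

Lemma gr_form k z : smooth_chart AS k -> gr_dom k z ->
  dn_form (gr_met k z) (dn_w d (cinv (dn_chart d k) (gr_pt k z))).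
Proof.
by move=> sk Dz; have [Ip cp _] := gr_pt_img sk Dz; exact: (dn_formP hd sk cp).
Qed.

Lemma gr_met_smooth k i j : smooth_chart AS k -> smooth_on (gr_dom k) (gr_fun k) ->
  smooth_on (gr_dom k) (fun z => gr_met k z i j).
Proof.
move=> sk sh m; have sc := dn_smooth_chart hd sk; have [hc _] := sc.
apply: (Ck_comp (gr_dom_open sk) (B := cimg (dn_chart d k))
  (f := fun x => metric_in g (dn_chart d k) x i j) (F := gr_pt k)).
- exact: chart_open_img.
- by move=> z /(gr_pt_img sk)[].
- by move=> l; exact: gr_pt_smooth.
- exact: metric_smooth.
Qed.

Lemma gr_inv_smooth k i j : smooth_chart AS k -> smooth_on (gr_dom k) (gr_fun k) ->
  smooth_on (gr_dom k) (fun z => invmx (gr_met k z) i j).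
Proof.
move=> sk sh m; apply: (Ck_invmx (gr_dom_open sk)) => [z Dz|a b].
  exact: dnf_unit (gr_form sk Dz).
exact: gr_met_smooth.
Qed.

(** The terms that are missing are those of g^00, g^11 and g^0i. *)
Lemma gr_sqE k z : smooth_chart AS k -> gr_dom k z ->
  let p i := partial (rshift 1 i) (gr_fun k) z in
  let I := invmx (gr_met k z) in
  gr_sq k z = \sum_i \sum_j I (rshift 2 i) (rshift 2 j) * p i * p j
    - 2 * partial (lshift 2 0) (gr_fun k) z * (I 0 1 - \sum_l I 1 (rshift 2 l) * p l).
Proof.
move=> sk Dz p I; have hG := gr_form sk Dz.
rewrite /gr_sq ipE sum4 !sum4 !pt4E -/I.
rewrite /I (dnf_00 hG) (dnf_11 hG) (dnf_inv_sym hG 1 0) -/I.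
rewrite (eq_bigr (fun _ => 0)) => [|i _]; last by rewrite (dnf_0i hG) mulr0 mul0r.
rewrite big1_eq.
set q := partial (lshift 2 0) _ z.
have ci i : gr_conormal k z 0 (rshift 2 i) = - p i by rewrite pt4E !mxE.
pose B := \sum_l I 1 (rshift 2 l) * p l.
have -> : \sum_(i < 2) - q * I 1 (rshift 2 i) * gr_conormal k z 0 (rshift 2 i) = q * B.
  rewrite mulr_sumr; apply: eq_bigr => i _; by rewrite ci; ring.
have -> : \sum_(i < 2) \sum_m gr_conormal k z 0 (rshift 2 i) * I (rshift 2 i) m
    * gr_conormal k z 0 m = \sum_i \sum_j I (rshift 2 i) (rshift 2 j) * p i * p j + q * B.
  rewrite mulr_sumr -big_split; apply: eq_bigr => i _ /=.
  rewrite sum4 pt4_0 pt4_1 /I (dnf_inv_sym hG _ 0) (dnf_0i hG) (dnf_inv_sym hG _ 1) -/I.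
  rewrite mulr0 mul0r add0r addrC; congr (_ + _); last first.
    by apply: eq_bigr => j _; rewrite !ci; ring.
  by rewrite ci -/q; ring.
by rewrite -/B; ring.
Qed.

End Graph.

(** * Propagation along the fibres *)

Lemma continuous_neq0 (R : realType) (V : topologicalType) (f : V -> R) (x : V) :
  {for x, continuous f} -> f x != 0 -> \forall y \near x, f y != 0.
Proof. by move=> cf fx; have := cf _ (open_nbhs_nbhs (conj (@open_neq _ 0) fx)). Qed.

Section GraphFlow.
Variables (R : realType) (M S : topologicalType).
Variables (A : smooth_structure R 4 M) (g : lorentz_metric A).
Variables (T : time_orientation g) (AS : smooth_structure R 2 S).
Variables (d : dn_data R M S) (D : set (R * S)) (h : R -> S -> R).
Hypothesis hd : double_null T AS d.
Hypothesis hh : graph_function AS d D h.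

Local Notation p k i z := (partial (rshift 1 i) (gr_fun h k) z).

(** Where the angular gradient vanishes the coefficient of the derivative in sb in
    [gr_sqE] is g^01, which is not zero: nearby the null equation can be solved
    for that derivative. *)
Lemma gr_flow k t0 y0 : smooth_chart AS k ->
  smooth_on (gr_dom D k) (gr_fun h k) -> gr_dom D k (pt3 t0 y0) ->
  (forall i, p k i (pt3 t0 y0) = 0) ->
  (\forall z \near pt3 t0 y0, gr_sq g d h k z = 0) ->
  exists2 e, 0 < e & forall t, `|t - t0| < e ->
    [/\ gr_dom D k (pt3 t y0), partial (lshift 2 0) (gr_fun h k) (pt3 t y0) = 0
      & forall i, p k i (pt3 t y0) = 0].
Proof.
move=> sk sh D0 p0 sq0.
have oD := gr_dom_open hh sk.
pose I z := invmx (gr_met g d h k z).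
pose den z := I z 0 1 - \sum_l I z 1 (rshift 2 l) * p k l z.
have CI i j m : Ck m (gr_dom D k) (fun z => I z i j).
  exact: (gr_inv_smooth hd hh i j sk sh).
have Cp i m : Ck m (gr_dom D k) (partial (rshift 1 i) (gr_fun h k)).
  by apply: Ck_partial; exact: sh.
have Cden m : Ck m (gr_dom D k) den.
  apply: (CkB oD) => //; apply: (Ck_sum oD) => l _.
  by apply: (CkM oD) => //; exact: Cp.
have den0 : den (pt3 t0 y0) != 0.
  rewrite /den big1 ?subr0 => [|l _]; last by rewrite p0 mulr0.
  have hG := gr_form hd hh sk D0; apply/eqP => I0.
  by have := dnf_01 hG; rewrite -/(I _) I0 mulr0 => /eqP; rewrite eq_sym oner_eq0.
pose P z := [/\ gr_dom D k z, gr_sq g d h k z = 0 & den z != 0].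
have nP : \forall z \near pt3 t0 y0, P z.
  have nD : \forall z \near pt3 t0 y0, gr_dom D k z by exact: open_nbhs_nbhs.
  have nden : \forall z \near pt3 t0 y0, den z != 0.
    have cd := Ck_continuous (Cden 0%N) D0.
    exact: continuous_neq0 cd den0.
  by apply: filterS2 (filterI nD sq0) nden => z [].
(* The null equation and the nonvanishing of its leading coefficient hold on a
   common open set. *)
pose U := interior [set z | P z].
have oU : open U by exact: open_interior.
have UP : U `<=` [set z | P z] by exact: interior_subset.
have UD : U `<=` gr_dom D k by move=> z /UP[].
have U0 : U (pt3 t0 y0) by [].
pose c i j z := I z (rshift 2 i) (rshift 2 j) / (2 * den z).
have Cc i j : smooth_on U (c i j).
  move=> m; apply: (CkM oU); first exact: Ck_subset UD (CI _ _ _).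
  apply: (CkV oU) => [z /UP[_ _ dz]|]; first by rewrite mulf_neq0.
  apply: (CkM oU); [exact: Ck_cst | exact: Ck_subset UD (Cden _)].
have E z : U z -> partial (lshift 2 0) (gr_fun h k) z =
    \sum_i \sum_j c i j z * p k i z * p k j z.
  move=> /UP[Dz sqz dz]; move: sqz; rewrite (gr_sqE hd hh) //.
  move/eqP; rewrite subr_eq0 => /eqP /esym E.
  apply: (@mulfI _ (2 * den z)); first by rewrite mulf_neq0.
  rewrite mulrAC E mulr_sumr; apply: eq_bigr => i _.
  rewrite mulr_sumr; apply: eq_bigr => j _.
  have cE : 2 * den z * c i j z = I z (rshift 2 i) (rshift 2 j).
    by rewrite /c mulrC mulfVK // mulf_neq0.
  transitivity (2 * den z * c i j z * p k i z * p k j z); first by rewrite cE.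
  by move: (2 * den z) (c i j z) => a b; rewrite !mulrA.
have sU : smooth_on U (gr_fun h k) by move=> m; exact: Ck_subset UD (sh m).
have [e e0 eP] := quadratic_flow oU U0 sU Cc E p0.
have nU : \forall z \near pt3 t0 y0, U z by exact: open_nbhs_nbhs.
have [e' e'0 e'P] := near_pt3 nU.
exists (Num.min e e'); first by rewrite lt_min e0.
move=> t; rewrite lt_min => /andP[te te'].
have Ut : U (pt3 t y0) by apply: e'P => //; rewrite subrr normr0.
have pt i : p k i (pt3 t y0) = 0 by apply: eP; exact: ltW.
split => //; first exact: UD.
by rewrite E // big1 // => i _; rewrite big1 // => j _; rewrite !pt mulr0.
Qed.

Lemma gr_slice_differentiable k t y : smooth_chart AS k ->
  smooth_on (gr_dom D k) (gr_fun h k) -> gr_dom D k (pt3 t y) ->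
  differentiable (h t \o cinv k) y.
Proof.
move=> sk sh Dt; have oD := gr_dom_open hh sk.
pose V := [set y | gr_dom D k (pt3 t y)].
have oV : open V.
  rewrite openE => y' Vy'.
  have nD : \forall z \near pt3 t y', gr_dom D k z by exact: open_nbhs_nbhs.
  have [e e0 eP] := near_pt3 nD; apply: (near_ballP _ V).2; exists e => // z ze.
  by apply: eP => //; rewrite subrr normr0.
have C1 : Ck 1 V (fun y => gr_fun h k (pt3 t y)).
  apply: (Ck_comp oV oD) => // j.
  rewrite -(fintype.splitK j); case: (fintype.split j) => i /=.
    have -> : (fun x => pt3 t x 0 (lshift 2 i)) = fun=> t.
      by apply/funext => z; rewrite (ord1 i) pt3_t.
    exact: (Ck_cst 1 V t).
  have -> : (fun x => pt3 t x 0 (rshift 1 i)) = fun z : 'rV[R]_2 => z 0 i.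
    by apply/funext => z; rewrite pt3_i.
  exact: (Ck_coord 1 V i).
have := Ck_differentiable oV C1 Dt.
by rewrite (_ : (fun y => _) = h t \o cinv k) //; apply/funext => z; rewrite gr_fun_pt3.
Qed.

Lemma dfun_graph k t x : smooth_chart AS k -> cdom k x ->
  dfun k (h t) x = \row_i p k i (pt3 t (cmap k x)).
Proof.
move=> sk kx; apply/rowP => i; rewrite !mxE slice_partial.
by congr (partial i _ _); apply/funext => y; rewrite gr_fun_pt3.
Qed.

(** Along a line of constant [x] the vanishing of [h] and of its angular gradient
    is a closed condition by continuity and an open one by [gr_flow]. It is
    expressed in all charts at once, because the chart in which [h] is known to
    be smooth may vary along the line. *)
Lemma graph_zero_of_null :
  (forall t x k, D (t, x) -> smooth_chart AS k -> cdom k x ->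
     smooth_on (gr_dom D k) (gr_fun h k) ->
     (forall i, p k i (pt3 t (cmap k x)) = 0) ->
     \forall z \near pt3 t (cmap k x), gr_sq g d h k z = 0) ->
  forall t x, D (t, x) -> h t x = 0.
Proof.
move=> null t x Dt.
pose Q t := h t x = 0 /\ forall k, smooth_chart AS k -> cdom k x -> dfun k (h t) x = 0.
suff [] : Q t by [].
have h00 : h 0 = fun=> 0 by apply/funext => y; exact: graph_sigma00 hh _.
have gi : is_interval [set t | D (t, x)] by exact: graph_interval hh _.
have g0 : D (0, x) by exact: graph_zero hh _.
apply: (@interval_ind R _ Q 0 t gi g0 Dt).
  split; first by rewrite h00.
  move=> k sk kx; rewrite h00; apply/rowP => i; rewrite !mxE.
  by rewrite /partial (_ : _ \o _ = fun=> 0) ?derive_cst.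
move=> {Dt}t Dt; have [k [sk kx sh]] := graph_smooth hh Dt.
pose y := cmap k x.
have ky : cinv k y = x by have [hk _] := sk; rewrite /y (chart_cancel hk).
have oD := gr_dom_open hh sk.
have D0 : gr_dom D k (pt3 t y) := (gr_domP D t sk kx).2 Dt.
pose Qk u := h u x = 0 /\ forall i, p k i (pt3 u y) = 0.
have QQk u : D (u, x) -> (Q u <-> Qk u).
  move=> Du; split=> [[hu du]|[hu du]]; split => //.
    by move=> i; have /rowP /(_ i) := du k sk kx; rewrite dfun_graph // !mxE.
  move=> k' sk' k'x; rewrite (dfun_change sk' sk k'x kx).
    by rewrite dfun_graph // (_ : \row_i _ = 0) ?mul0mx //; apply/rowP => i; rewrite !mxE du.
  by apply: gr_slice_differentiable => //; apply: (gr_domP D u sk kx).2.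
have hE u : h u x = gr_fun h k (pt3 u y) by rewrite gr_fun_pt3 ky.
have [Qt|nQt] := pselect (Qk t).
- (* Openness: [h] is constant in [u] near [t], and its gradient stays zero. *)
  have [ht dt] := Qt.
  have [e e0 eP] := gr_flow sk sh D0 dt (null _ _ _ Dt sk kx sh dt).
  apply/near_ballP; exists e => // u ue Du.
  rewrite !QQk //; split=> // _; split; last by have [] := eP _ ue.
  rewrite -ht !hE (pt3E u t).
  have [|s sut E] := @mvt_line _ _ (gr_fun h k) (pt3 t y) (delta_mx 0 (lshift 2 0)) (u - t).
    move=> s sut; have su : `|(s + t) - t| < e by rewrite addrK; exact: le_lt_trans ue.
    have -> : s *: delta_mx 0 (lshift 2 0) + pt3 t y = pt3 (s + t) y.
      by rewrite (pt3E (s + t) t) addrK.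
    have [Ds _ _] := eP _ su.
    by have [_ /(_ (lshift 2 0))[+ _]] := sh 1%N; apply.
  apply/eqP; rewrite -subr_eq0 E; apply/eqP.
  have su : `|(s + t) - t| < e by rewrite addrK; exact: le_lt_trans ue.
  have [_ E0 _] := eP _ su.
  move: E0; rewrite (pt3E (s + t) t) addrK /partial => ->.
  by rewrite mulr0.
- (* Closedness: one of the quantities is nonzero near [t]. *)
  have [z0|z0] : (h t x != 0) \/ (exists i, p k i (pt3 t y) != 0).
    apply: contrapT => H; apply: nQt; split.
      by apply/eqP/negPn/negP => H'; apply: H; left.
    by move=> i; apply/eqP/negPn/negP => H'; apply: H; right; exists i.
  + have c0 := Ck_continuous (sh 0%N) D0.
    have n0 : \forall z \near pt3 t y, gr_fun h k z != 0.
      by rewrite hE in z0; exact: continuous_neq0 c0 z0.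
    have [e e0 eP] := near_pt3 n0.
    apply/near_ballP; exists e => // u ue Du; rewrite !QQk //; split=> // -[hu _].
    have yy : `|y - y| < e by rewrite subrr normr0.
    by have := eP u y ue yy; rewrite -hE hu eqxx.
  + have [i zi] := z0.
    have c0 := Ck_continuous (Ck_partial (rshift 1 i) (sh 1%N)) D0.
    have n0 : \forall z \near pt3 t y, p k i z != 0.
      exact: continuous_neq0 c0 zi.
    have [e e0 eP] := near_pt3 n0.
    apply/near_ballP; exists e => // u ue Du; rewrite !QQk //; split=> // -[_ hu].
    have yy : `|y - y| < e by rewrite subrr normr0.
    by have := eP u y ue yy; rewrite hu eqxx.
Qed.

End GraphFlow.

(** * Null graphs *)

Lemma atlas_smooth_chart (R : realType) n (T : topologicalType)
    (A : smooth_structure R n T) c : atlas A c -> smooth_chart A c.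
Proof.
move=> cA; split=> [|c' cA']; first exact: atlas_chart cA.
by split; [exact: atlas_compat cA cA' | exact: atlas_compat cA' cA].
Qed.

Lemma smooth_chart_at (R : realType) n (T : topologicalType)
    (A : smooth_structure R n T) p : exists2 c, smooth_chart A c & cdom c p.
Proof.
by have [c cA cp] := atlas_cover A p; exists c => //; exact: atlas_smooth_chart.
Qed.

Lemma derive_zero_line (R : realType) (V : normedModType R) (f : V -> R) (x v : V) :
  (\forall s \near (0 : R), f (s *: v + x) = 0) -> 'D_v f x = 0.
Proof.
move=> f0; have fx : f x = 0 by have := nbhs_singleton f0; rewrite scale0r add0r.
pose c s := f (s *: v + x).
have E : 'D_v f x = 'D_1 c 0.
  rewrite /derive; set u := (fun s : R => _); set w := (fun s : R => _).
  suff -> : u = w by []; apply/funext => s; rewrite /u /w /c /=.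
  by rewrite [s *: 1]mulr1 addr0 scale0r add0r.
by rewrite E (@near_eq_derive _ _ _ _ (fun=> 0)) ?derive_cst.
Qed.

(** Lowering the index of [X] gives a nonzero multiple of the conormal [dx^0], so
    that [X] is proportional to the gradient of [x^0]; as [X] is tangent to
    [x^0 = 0], the entry g^00 vanishes. *)
Lemma degenerate_conormal (R : realType) (G : 'M[R]_4) (X : 'rV[R]_4) (l : R) :
  G \in unitmx -> X != 0 -> X 0 0 = 0 ->
  (forall Y : 'rV[R]_4, Y 0 0 = 0 -> ip G X Y = 0) ->
  ip (invmx G) (l *: delta_mx 0 0) (l *: delta_mx 0 0) = 0.
Proof.
move=> Gu Xn0 X0 XY; rewrite ipZl ipZr ip_delta.
pose n := X *m G.
have nE : n = n 0 0 *: delta_mx 0 0.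
  apply/rowP => j; rewrite mxZE [delta_mx _ _ _ _]mxE eqxx /=.
  have [->|j0] := eqVneq j 0; first by rewrite mulr1.
  rewrite mulr0.
  have d0 : (delta_mx 0 j : 'rV[R]_4) 0 0 = 0.
    by rewrite mxE eqxx eq_sym (negbTE j0).
  have dT i : ((delta_mx 0 j : 'rV[R]_4)^T) i 0 = (i == j)%:R by rewrite !mxE eqxx.
  rewrite -(XY _ d0) /ip [RHS]mxE (bigD1 j) //= big1 ?addr0 => [|i ij].
    by rewrite dT eqxx mulr1.
  by rewrite dT (negbTE ij) mulr0.
have XE : X = n *m invmx G by rewrite /n mulmxK.
have n0 : n 0 0 != 0.
  by apply: contra_neq Xn0 => n0; rewrite XE nE n0 scale0r mul0mx.
have : n 0 0 * invmx G 0 0 = 0.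
  by move: X0; rewrite {1}XE {1}nE -scalemxAl -rowE mxZE [row _ _ _ _]mxE.
by move/eqP; rewrite mulf_eq0 (negbTE n0) => /eqP->; rewrite !mulr0.
Qed.

Section NullGraph.
Variables (R : realType) (M S : topologicalType).
Variables (A : smooth_structure R 4 M) (g : lorentz_metric A).
Variables (T : time_orientation g) (AS : smooth_structure R 2 S).
Variables (d : dn_data R M S) (D : set (R * S)) (h : R -> S -> R).
Hypothesis hd : double_null T AS d.
Hypothesis hh : graph_function AS d D h.

(** The projection along s onto the parameters of the graph. *)
Definition proj3 (x : 'rV[R]_4) : 'rV[R]_(1 + 2) :=
  pt3 (x 0 1) (@rsubmx R 1 2 2 x).

Lemma proj3_pt4 a b y : proj3 (pt4 a b y) = pt3 b y.
Proof. by rewrite /proj3 pt4_1 row_mxKr. Qed.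

Lemma proj3_coord j : exists i : 'I_4, forall x, proj3 x 0 j = x 0 i.
Proof.
rewrite -(fintype.splitK j); case: (fintype.split j) => i /=.
  by exists 1 => x; rewrite (ord1 i) pt3_t.
by exists (rshift 2 i) => x; rewrite pt3_i mxE.
Qed.

Lemma proj3_Ck m (B : set 'rV[R]_4) j : Ck m B (fun x => proj3 x 0 j).
Proof.
have [i E] := proj3_coord j.
have -> : (fun x => proj3 x 0 j) = (fun x : 'rV[R]_4 => x 0 i) by apply/funext.
exact: Ck_coord.
Qed.

Lemma proj3_continuous x : {for x, continuous proj3}.
Proof.
by apply: continuous_row => j; exact: Ck_continuous (proj3_Ck 0 setT j) (I : setT x).
Qed.

Definition over_graph (k : chart R 2 S) : set M :=
  cdom (dn_chart d k) `&` (cmap (dn_chart d k) @^-1` (proj3 @^-1` gr_dom D k)).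

Lemma over_graph_open k : smooth_chart AS k -> open (over_graph k).
Proof.
move=> sk; have [hc _] := dn_smooth_chart hd sk.
apply: open_chart_preimage => //; apply: open_comp (gr_dom_open hh sk) => x _.
exact: proj3_continuous.
Qed.

Lemma over_graphP k q : smooth_chart AS k -> cdom (dn_chart d k) q ->
  (over_graph k q <-> D (dn_sb d q, dn_th d q)).
Proof.
move=> sk cq; have kq : cdom k (dn_th d q) by case: cq.
rewrite -(gr_domP D (dn_sb d q) sk kq) /over_graph /= proj3_pt4.
by split=> [[]|].
Qed.

Definition gr_defining (q : M) : R := dn_s d q - h (dn_sb d q) (dn_th d q).

Lemma dfun_gr_defining k z : smooth_chart AS k ->
  smooth_on (gr_dom D k) (gr_fun h k) -> gr_dom D k z ->
  let p := cinv (dn_chart d k) (gr_pt h k z) in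
  differentiable (gr_defining \o cinv (dn_chart d k)) (cmap (dn_chart d k) p) /\
  dfun (dn_chart d k) gr_defining p = gr_conormal h k z.
Proof.
move=> sk sh Dz p; have [Ip cp _] := gr_pt_img hd hh sk Dz.
have [hc _] := dn_smooth_chart hd sk.
have pE : cmap (dn_chart d k) p = gr_pt h k z by have [] := cimgP hc Ip.
have zE : proj3 (gr_pt h k z) = z by rewrite proj3_pt4 -pt3_eta.
pose B := cmap (dn_chart d k) @` (over_graph k `&` cdom (dn_chart d k)).
have oB : open B by apply: open_chart_image => //; exact: over_graph_open.
have Bp : B (gr_pt h k z).
  exists p; rewrite // /over_graph /= -/p; split => //; split => //.
  by rewrite -[X in proj3 X]/(cmap (dn_chart d k) p) pE zE.
pose psi (x : 'rV[R]_4) := x 0 0 - gr_fun h k (proj3 x).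
have E x : B x -> psi x = (gr_defining \o cinv (dn_chart d k)) x.
  move=> [q [_ cq] <-]; have [hk _] := sk.
  rewrite /comp (chart_cancel hc cq) /psi /gr_defining /= proj3_pt4 gr_fun_pt3 pt4_0.
  by rewrite (chart_cancel hk) //; case: cq.
have dgr : differentiable (gr_fun h k) (proj3 (gr_pt h k z)).
  by rewrite zE; exact: Ck_differentiable (gr_dom_open hh sk) (sh 1%N) Dz.
have dpr v j : is_derive (gr_pt h k z) v (fun x => proj3 x 0 j) (proj3 v 0 j).
  have [i Ei] := proj3_coord j; rewrite Ei.
  by apply: is_derive_ext (is_derive_coord i _ _); apply/funext.
have dpsi v : is_derive (gr_pt h k z) v psi
    (v 0 0 - \sum_j proj3 v 0 j * partial j (gr_fun h k) z).
  have [|c1 c2] := @is_derive_chain _ _ _ (gr_fun h k) proj3 (gr_pt h k z) v dgr.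
    by move=> j; exact: (@ex_derive _ _ _ _ _ _ _ (dpr v j)).
  apply: is_deriveB; first exact: is_derive_coord.
  split => //; rewrite c2 zE; apply: eq_bigr => j _.
  by rewrite (@derive_val _ _ _ _ _ _ _ (dpr v j)).
split.
  rewrite pE; have C1 : Ck 1 B psi.
    apply: (CkB oB); first exact: Ck_coord.
    apply: (Ck_comp oB (gr_dom_open hh sk) (F := proj3)).
    - by move=> _ [q [[_ q2] _] <-].
    - by move=> j; exact: proj3_Ck.
    - exact: sh.
  exact: Ck_differentiable oB (Ck_ext oB E C1) Bp.
apply/rowP => m; rewrite mxE pE /partial -(derive_ext_open _ oB Bp E).
rewrite (@derive_val _ _ _ _ _ _ _ (dpsi (delta_mx 0 m))).
have d2 (i j : 'I_4) : (delta_mx 0 i : 'rV[R]_4) 0 j = (j == i)%:R by rewrite mxE eqxx.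
have sE v : \sum_j proj3 v 0 j * partial j (gr_fun h k) z =
    v 0 1 * partial (lshift 2 0) (gr_fun h k) z
    + \sum_i v 0 (rshift 2 i) * partial (rshift 1 i) (gr_fun h k) z.
  rewrite (@big_split_ord _ _ _ 1 2) /= big_ord1 pt3_t; congr (_ + _).
  by apply: eq_bigr => i _; rewrite pt3_i mxE.
rewrite sE; move: m; elim/ind4 => [||i]; rewrite !d2 pt4E.
- rewrite big1 => [|j _]; last by rewrite d2 mul0r.
  by rewrite mul0r addr0 subr0.
- rewrite big1 => [|j _]; last by rewrite d2 mul0r.
  by rewrite mul1r addr0 sub0r.
- rewrite (_ : (0 == rshift 2 i :> 'I_4) = false) //.
  rewrite (_ : (1 == rshift 2 i :> 'I_4) = false) //.
  rewrite (bigD1 i) //= big1 => [|j ji]; last first.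
    have -> : (delta_mx 0 (rshift 2 i) : 'rV[R]_4) 0 (rshift 2 j) = (j == i)%:R.
      by rewrite d2; congr (_%:R); exact: (eq_rshift 2 j i).
    by rewrite (negbTE ji) mul0r.
  by rewrite d2 eqxx mul0r mul1r addr0 !add0r !mxE.
Qed.

Local Notation H := (graph_hypersurface d D h).

(** The function s - h vanishes on the slice [x^0 = 0] of a slice chart, so that
    its differential there is a multiple of [dx^0], which is null. *)
Lemma null_gr_sq k z : null_hypersurface g H -> smooth_chart AS k ->
  smooth_on (gr_dom D k) (gr_fun h k) -> gr_dom D k z -> gr_sq g d h k z = 0.
Proof.
move=> nH sk sh Dz; have [dd de] := dfun_gr_defining sk sh Dz.
have [Ip cp pE] := gr_pt_img hd hh sk Dz.
set p := cinv (dn_chart d k) (gr_pt h k z) in dd de cp pE.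
have sc := dn_smooth_chart hd sk; have [hc _] := sc.
have pX : cmap (dn_chart d k) p = gr_pt h k z by have [] := cimgP hc Ip.
have Hp : H p.
  have [_ ps pb pt] := dn_chart_coord hd sk Ip.
  have kp : cdom k (dn_th d p) by case: cp.
  have tE : dn_th d p = cinv k (rsubmx z).
    have [hk _] := sk; rewrite -(chart_cancel hk kp) pt.
    by rewrite /gr_pt row_mxKr.
  split; first by case: cp.
    by rewrite tE pb pt4_1; case: Dz.
  by rewrite ps pb tE pt4_0 pt4_1.
have [c [[sc' Hc] c'p [X [Xn0 X0 XY]]]] := nH _ Hp.
have [hc' _] := sc'.
rewrite /gr_sq -de /gr_met /metric_in -/p.
rewrite -(conorm_change g sc' sc c'p cp dd).
suff -> : dfun c gr_defining p = dfun c gr_defining p 0 0 *: delta_mx 0 0.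
  by apply: degenerate_conormal Xn0 X0 XY; exact: metric_unit.
apply/rowP => i; rewrite [RHS]mxE [delta_mx _ _ _ _]mxE eqxx /=.
have [->|i0] := eqVneq i 0; first by rewrite mulr1.
rewrite mulr0 mxE; apply: derive_zero_line.
have nI : \forall x \near cmap c p, cimg c x.
  by apply: open_nbhs_nbhs; split; [exact: chart_open_img | exact: cmap_cimg].
have [r r0 rP] := (near_ballP _ _).1 nI.
apply/near_ballP; exists r => // s; rewrite subr0 => sr.
have Is : cimg c (s *: delta_mx 0 i + cmap c p).
  by apply: rP; rewrite addrK norm_delta.
have [cs cE] := cimgP hc' Is.
have c0 : cmap c p 0 0 = 0.
  by have : (H `&` cdom c) p by []; rewrite Hc => -[].
have : (H `&` cdom c) (cinv c (s *: delta_mx 0 i + cmap c p)).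
  rewrite Hc; split => //=; rewrite cE mxDE mxZE c0 [delta_mx _ _ _ _]mxE.
  by rewrite eq_sym (negbTE i0) andbF mulr0 addr0.
by move=> [[_ _ Es] _]; rewrite /= /gr_defining Es subrr.
Qed.

(** * The hypersurface s = 0 *)

(** The restriction discards the points of s = 0 outside the domain of the
    graph, which a slice chart has to avoid. *)
Definition tube_chart (k : chart R 2 S) : chart R 4 M :=
  restr_chart (dn_chart d k) (over_graph k).

Lemma tube_chart_dom k q : cdom (tube_chart k) q -> cdom (dn_chart d k) q.
Proof. by case. Qed.

Lemma tube_chart_smooth k : smooth_chart AS k -> smooth_chart A (tube_chart k).
Proof.
move=> sk; exact: smooth_restr_chart (dn_smooth_chart hd sk) (over_graph_open sk).
Qed.

Lemma tube_metric k p : smooth_chart AS k -> cdom (tube_chart k) p ->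
  g (tube_chart k) p = g (dn_chart d k) p.
Proof.
move=> sk [cp Vp].
exact: metric_restr (dn_smooth_chart hd sk) (over_graph_open sk) cp Vp.
Qed.

Lemma tube_form k p : smooth_chart AS k -> cdom (tube_chart k) p ->
  dn_form (g (tube_chart k) p) (dn_w d p).
Proof.
by move=> sk cp; rewrite tube_metric //; case: cp => cp _; exact: (dn_formP hd sk).
Qed.

Lemma tube_chart_at p : H p -> exists2 k, smooth_chart AS k & cdom (tube_chart k) p.
Proof.
move=> [dp Dp _]; have [k sk kp] := smooth_chart_at AS (dn_th d p).
exists k => //; split; first by split.
by apply/over_graphP.
Qed.

Hypothesis h0 : forall t x, D (t, x) -> h t x = 0.

Lemma tube_slice k : smooth_chart AS k -> slice_chart A H (tube_chart k).
Proof.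
move=> sk; split; first exact: tube_chart_smooth.
rewrite predeqE => q; split=> [[[_ Dq sq] cq]|[cq /= sq]].
  by split => //=; rewrite pt4_0 sq h0.
have Dq : D (dn_sb d q, dn_th d q) by case: cq => cq /(over_graphP sk cq).
split=> //; split => //; first by case: cq => -[].
by rewrite h0 // -sq pt4_0.
Qed.

(** The vector [L] is tangent to s = 0 and g(L, .) = [w] ds. *)
Lemma tube_null : null_hypersurface g H.
Proof.
move=> p Hp; have [k sk cp] := tube_chart_at Hp.
exists (tube_chart k); split => //; first exact: tube_slice.
have hG := tube_form sk cp.
exists (delta_mx 0 1); split.
- by apply/eqP => /rowP /(_ 1); rewrite !mxE !eqxx => /eqP; rewrite oner_eq0.
- by rewrite mxE.
- by move=> Y Y0; rewrite -(dnf_LE hG) (dnf_ip_L hG) Y0 mulr0.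
Qed.

End NullGraph.

(** * Sections given by a function of the angular variables *)

Lemma Ck_mulmx (R : realType) n (B : set 'rV[R]_n) k m1 m2 m3
    (X : 'rV[R]_n -> 'M[R]_(m1, m2)) (Y : 'rV[R]_n -> 'M[R]_(m2, m3)) : open B ->
  (forall i j, Ck k B (fun x => X x i j)) -> (forall i j, Ck k B (fun x => Y x i j)) ->
  forall i j, Ck k B (fun x => (X x *m Y x) i j).
Proof.
move=> oB CX CY i j.
have -> : (fun x => (X x *m Y x) i j) = (fun x => \sum_l X x i l * Y x l j).
  by apply/funext => x; rewrite mxE.
by apply: (Ck_sum oB) => l _; apply: (CkM oB).
Qed.

Lemma Ck_ip (R : realType) n (B : set 'rV[R]_n) k m (X : 'rV[R]_n -> 'M[R]_m)
    (u v : 'rV[R]_n -> 'rV[R]_m) : open B ->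
  (forall i j, Ck k B (fun x => X x i j)) -> (forall j, Ck k B (fun x => u x 0 j)) ->
  (forall j, Ck k B (fun x => v x 0 j)) -> Ck k B (fun x => ip (X x) (u x) (v x)).
Proof.
move=> oB CX Cu Cv.
have -> : (fun x => ip (X x) (u x) (v x)) =
    (fun x => \sum_i \sum_j u x 0 i * X x i j * v x 0 j).
  by apply/funext => x; rewrite ipE.
apply: (Ck_sum oB) => i _; apply: (Ck_sum oB) => j _.
by apply: (CkM oB) => //; apply: (CkM oB).
Qed.

Lemma Ck_open_gt0 (R : realType) n k (B : set 'rV[R]_n) f : open B -> Ck k B f ->
  open [set x | B x /\ 0 < f x].
Proof.
move=> oB Cf; rewrite openE => x [Bx fx].
have n1 : \forall y \near x, B y by exact: open_nbhs_nbhs.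
have n2 : \forall y \near x, 0 < f y.
  have cf := Ck_continuous Cf Bx.
  by have := cf _ (open_nbhs_nbhs (conj (@open_gt _ 0) fx)).
exact: filterS2 n1 n2.
Qed.

Lemma Ck_open_neq0 (R : realType) n k (B : set 'rV[R]_n) f : open B -> Ck k B f ->
  open [set x | B x /\ f x != 0].
Proof.
move=> oB Cf; rewrite openE => x [Bx fx].
have n1 : \forall y \near x, B y by exact: open_nbhs_nbhs.
exact: filterS2 n1 (continuous_neq0 (Ck_continuous Cf Bx) fx).
Qed.

Lemma Ck_posdef_open (R : realType) n (B : set 'rV[R]_n) k (X : 'rV[R]_n -> 'M[R]_2) :
  open B -> (forall i j, Ck k B (fun x => X x i j)) ->
  (forall x, B x -> (X x)^T = X x) -> open [set x | B x /\ posdef (X x)].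
Proof.
move=> oB CX XT.
have -> : [set x | B x /\ posdef (X x)] =
    [set x | (B x /\ 0 < X x 0 0) /\ 0 < X x 0 0 * X x 1 1 - X x 0 1 * X x 0 1].
  rewrite predeqE => x; split=> [[Bx]|[[Bx x0] xd]].
    by move/(posdef2P (XT _ Bx)) => [].
  by split => //; apply/(posdef2P (XT _ Bx)).
have o1 := Ck_open_gt0 oB (CX 0 0).
apply: (Ck_open_gt0 (k := k) o1); apply: (CkB o1); apply: (CkM o1);
  by apply: Ck_subset (CX _ _) => x [].
Qed.

Lemma null_expansion_ext (R : realType) (G : 'rV[R]_4 -> 'M[R]_4)
    (F N F' N' : 'rV[R]_2 -> 'rV[R]_4) (V : set 'rV[R]_2) y : open V -> V y ->
  (forall z, V z -> F z = F' z) -> (forall z, V z -> N z = N' z) ->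
  null_expansion G F N y = null_expansion G F' N' y.
Proof.
move=> oV Vy FF NN.
have fr a : frame F a y = frame F' a y.
  by apply/rowP => m; rewrite !mxE; apply: derive_ext_open oV Vy _ => z /FF ->.
have cd a : cov_deriv G F N a y = cov_deriv G F' N' a y.
  apply/rowP => m; rewrite !mxE FF // NN // fr; congr (_ + _).
  by apply: derive_ext_open oV Vy _ => z /NN ->.
rewrite /null_expansion (_ : first_form G F y = first_form G F' y).
  congr (\tr (_ *m _)); apply/matrixP => a b.
  by rewrite !mxE FF // fr cd.
by apply/matrixP => a b; rewrite !mxE FF // !fr.
Qed.

Section TestSection.
Variables (R : realType) (M S : topologicalType).
Variables (A : smooth_structure R 4 M) (g : lorentz_metric A).
Variables (T : time_orientation g) (AS : smooth_structure R 2 S).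
Variables (d : dn_data R M S) (D : set (R * S)) (h : R -> S -> R).
Hypothesis hd : double_null T AS d.
Hypothesis hh : graph_function AS d D h.
Variable k : chart R 2 S.
Hypothesis sk : smooth_chart AS k.
Hypothesis sh : smooth_on (gr_dom D k) (gr_fun h k).

Let hk : is_chart k. Proof. by case: sk. Qed.
Let oD : open (gr_dom D k) := gr_dom_open hh sk.

Definition gr_w (z : 'rV[R]_(1 + 2)) : R := dn_w d (cinv (dn_chart d k) (gr_pt h k z)).

Let Gz z := gr_met g d h k z.

(** The lapse inherits smoothness from the metric, since [w] is the inverse of
    g^01. *)
Lemma gr_w_Ck m : Ck m (gr_dom D k) gr_w.
Proof.
have nz z : gr_dom D k z -> invmx (Gz z) 0 1 != 0.
  move=> Dz; have hG := gr_form hd hh sk Dz; apply/eqP => I0.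
  by have := dnf_01 hG; rewrite -/(Gz z) I0 mulr0 => /eqP; rewrite eq_sym oner_eq0.
have C1 := CkV oD nz (gr_inv_smooth hd hh 0 1 sk sh m).
apply: Ck_ext C1 => // z Dz; have hG := gr_form hd hh sk Dz.
apply: (mulIf (nz _ Dz)); rewrite mulVf ?nz //.
by rewrite (dnf_01 hG).
Qed.

Lemma gr_b_Ck m i : Ck m (gr_dom D k) (fun z => dnf_b (Gz z) (gr_w z) 0 i).
Proof.
have -> : (fun z => dnf_b (Gz z) (gr_w z) 0 i) =
    (fun z => gr_w z * invmx (Gz z) 1 (rshift 2 i)).
  by apply/funext => z; rewrite /dnf_b /dnf_Lb mxE mxZE [row _ _ _ _]mxE.
by apply: (CkM oD); [exact: gr_w_Ck | exact: (gr_inv_smooth hd hh)].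
Qed.

Variable fb : 'rV[R]_2 -> R.
Hypothesis sfb : smooth_on setT fb.

(** The section sb = [fb], s = h([fb], theta) in a chart, with the quantities that
    enter its null normal; [ts_section_L] identifies the latter with the normal
    given for sections. *)
Definition ts_z y := pt3 (fb y) y.
Definition ts_dom := [set y | gr_dom D k (ts_z y)].
Definition ts_f y := gr_fun h k (ts_z y).
Definition ts_F y := gr_pt h k (ts_z y).
Definition ts_G y := gr_met g d h k (ts_z y).
Definition ts_w y := gr_w (ts_z y).
Definition ts_df y : 'rV[R]_2 := \row_i partial i ts_f y.
Definition ts_dfb y : 'rV[R]_2 := \row_i partial i fb y.
Definition ts_B y := sec_B (ts_df y) (dnf_b (ts_G y) (ts_w y)).
Definition ts_e y := sec_e (ts_w y) (dnf_gs (ts_G y)) (ts_B y) (ts_df y).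
Definition ts_eb y := sec_e (ts_w y) (dnf_gs (ts_G y)) (ts_B y) (ts_dfb y).
Definition ts_disc y := sec_disc (ts_w y) (dnf_gs (ts_G y)) (ts_e y) (ts_eb y).
Definition ts_N y := sec_N (ts_G y) (ts_w y) (ts_B y) (ts_df y) (ts_dfb y).
Definition ts_first y : 'M[R]_2 := \matrix_(a, b)
  ip (ts_G y) (sec_frame (ts_df y) (ts_dfb y) a) (sec_frame (ts_df y) (ts_dfb y) b).

Lemma ts_z_Ck m (B : set 'rV[R]_2) j : Ck m B (fun y => ts_z y 0 j).
Proof.
rewrite -(fintype.splitK j); case: (fintype.split j) => i.
  have -> : (fun x => ts_z x 0 (unsplit (inl i))) = fb.
    by apply/funext => y; rewrite (ord1 i) pt3_t.
  by apply: Ck_subset (sfb m).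
have -> : (fun x => ts_z x 0 (unsplit (inr i))) = (fun y : 'rV[R]_2 => y 0 i).
  by apply/funext => y; rewrite pt3_i.
exact: Ck_coord.
Qed.

Lemma ts_dom_open : open ts_dom.
Proof.
have cz y : {for y, continuous ts_z}.
  by apply: continuous_row => j; exact: Ck_continuous (ts_z_Ck 0 setT j) (I : setT y).
by apply: open_comp oD => y _; exact: cz.
Qed.
Let oT := ts_dom_open.

Lemma ts_comp m (f : 'rV[R]_(1 + 2) -> R) : Ck m (gr_dom D k) f ->
  Ck m ts_dom (fun y => f (ts_z y)).
Proof. by move=> Cf; apply: (Ck_comp oT oD) => // j; exact: ts_z_Ck. Qed.

Lemma ts_f_Ck m : Ck m ts_dom ts_f. Proof. exact: ts_comp (sh m). Qed.
Lemma ts_G_Ck m i j : Ck m ts_dom (fun y => ts_G y i j).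
Proof. exact: ts_comp (gr_met_smooth hd hh i j sk sh m). Qed.
Lemma ts_inv_Ck m i j : Ck m ts_dom (fun y => invmx (ts_G y) i j).
Proof. exact: ts_comp (gr_inv_smooth hd hh i j sk sh m). Qed.
Lemma ts_w_Ck m : Ck m ts_dom ts_w. Proof. exact: ts_comp (gr_w_Ck m). Qed.
Lemma ts_b_Ck m i : Ck m ts_dom (fun y => dnf_b (ts_G y) (ts_w y) 0 i).
Proof. exact: ts_comp (gr_b_Ck m i). Qed.

Lemma ts_df_Ck m i : Ck m ts_dom (fun y => ts_df y 0 i).
Proof.
have -> : (fun y => ts_df y 0 i) = partial i ts_f by apply/funext => y; rewrite mxE.
exact: Ck_partial (ts_f_Ck m.+1).
Qed.

Lemma ts_dfb_Ck m i : Ck m ts_dom (fun y => ts_dfb y 0 i).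
Proof.
have -> : (fun y => ts_dfb y 0 i) = partial i fb by apply/funext => y; rewrite mxE.
by apply: Ck_subset (Ck_partial i (sfb m.+1)).
Qed.

Lemma ts_B_Ck m i j : Ck m ts_dom (fun y => ts_B y i j).
Proof.
have -> : (fun y => ts_B y i j) =
    (fun y => (i == j)%:R - ts_df y 0 i * dnf_b (ts_G y) (ts_w y) 0 j).
  apply/funext => y; rewrite /ts_B /sec_B mxDE [1%:M i j]mxE; congr (_ + _).
  by rewrite [LHS]mxE mxE big_ord1 [_^T _ _]mxE.
apply: (CkB oT); first exact: Ck_cst.
by apply: (CkM oT); [exact: ts_df_Ck | exact: ts_b_Ck].
Qed.

Lemma ts_frame_Ck m a j :
  Ck m ts_dom (fun y => sec_frame (ts_df y) (ts_dfb y) a 0 j).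
Proof.
move: j; elim/ind4 => [||i].
- have -> : (fun y => sec_frame (ts_df y) (ts_dfb y) a 0 0) = (fun y => ts_df y 0 a).
    by apply/funext => y; rewrite /sec_frame pt4E.
  exact: ts_df_Ck.
- have -> : (fun y => sec_frame (ts_df y) (ts_dfb y) a 0 1) = (fun y => ts_dfb y 0 a).
    by apply/funext => y; rewrite /sec_frame pt4E.
  exact: ts_dfb_Ck.
- have -> : (fun y => sec_frame (ts_df y) (ts_dfb y) a 0 (rshift 2 i)) =
      (fun y => (delta_mx 0 a : 'rV[R]_2) 0 i).
    by apply/funext => y; rewrite /sec_frame pt4E.
  exact: Ck_cst.
Qed.

Lemma ts_first_Ck m a b : Ck m ts_dom (fun y => ts_first y a b).
Proof.
have -> : (fun y => ts_first y a b) = (fun y => ip (ts_G y)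
    (sec_frame (ts_df y) (ts_dfb y) a) (sec_frame (ts_df y) (ts_dfb y) b)).
  by apply/funext => y; rewrite mxE.
apply: (Ck_ip oT); [exact: ts_G_Ck | exact: ts_frame_Ck..].
Qed.

Lemma ts_form y : ts_dom y -> dn_form (ts_G y) (ts_w y).
Proof. by move=> Ty; exact: (gr_form hd hh sk Ty). Qed.

Lemma ts_first_sym y : ts_dom y -> (ts_first y)^T = ts_first y.
Proof.
by move=> Ty; apply/matrixP => a b; rewrite !mxE ipC // (dnf_sym (ts_form Ty)).
Qed.

Definition ts_domB := [set y | ts_dom y /\ \det (ts_B y) != 0].

Lemma ts_domB_open : open ts_domB.
Proof. by apply: (Ck_open_neq0 (k := 0%N) oT); apply: (Ck_det oT); exact: ts_B_Ck. Qed.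
Let oB := ts_domB_open.
Let TB : ts_domB `<=` ts_dom. Proof. by move=> y []. Qed.

Lemma ts_gs_Ck m i j : Ck m ts_dom (fun y => dnf_gs (ts_G y) i j).
Proof.
have -> : (fun y => dnf_gs (ts_G y) i j) = (fun y => ts_G y (rshift 2 i) (rshift 2 j)).
  by apply/funext => y; rewrite !mxE.
exact: ts_G_Ck.
Qed.

Lemma ts_sec_e_Ck m (phi : 'rV[R]_2 -> 'rV[R]_2) i :
  (forall i, Ck m ts_domB (fun y => phi y 0 i)) ->
  Ck m ts_domB (fun y => sec_e (ts_w y) (dnf_gs (ts_G y)) (ts_B y) (phi y) 0 i).
Proof.
move=> Cphi.
have -> : (fun y => sec_e (ts_w y) (dnf_gs (ts_G y)) (ts_B y) (phi y) 0 i) =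
  (fun y => - ts_w y * (phi y *m (invmx (ts_B y))^T *m invmx (dnf_gs (ts_G y))) 0 i).
  by apply/funext => y; rewrite /sec_e mxZE.
apply: (CkM oB); first by apply: (CkN oB); exact: Ck_subset TB (ts_w_Ck m).
apply: (Ck_mulmx oB) => [a b|a b].
  apply: (Ck_mulmx oB) => [a' b'|a' b']; first by rewrite (ord1 a'); exact: Cphi.
  have -> : (fun x => (invmx (ts_B x))^T a' b') = (fun x => invmx (ts_B x) b' a').
    by apply/funext => x; rewrite mxE.
  apply: (Ck_invmx oB) => [y [_ By]|? ?]; first by rewrite unitmxE unitfE.
  exact: Ck_subset TB (ts_B_Ck m _ _).
apply: (Ck_invmx oB) => [y [Ty _]|? ?].
  exact: posdef_unit (dnf_gs_posdef (ts_form Ty)).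
exact: Ck_subset TB (ts_gs_Ck m _ _).
Qed.

Lemma ts_e_Ck m i : Ck m ts_domB (fun y => ts_e y 0 i).
Proof. by apply: ts_sec_e_Ck => j; exact: Ck_subset TB (ts_df_Ck m j). Qed.
Lemma ts_eb_Ck m i : Ck m ts_domB (fun y => ts_eb y 0 i).
Proof. by apply: ts_sec_e_Ck => j; exact: Ck_subset TB (ts_dfb_Ck m j). Qed.

Lemma ts_ip_Ck m (u v : 'rV[R]_2 -> 'rV[R]_2) :
  (forall i, Ck m ts_domB (fun y => u y 0 i)) ->
  (forall i, Ck m ts_domB (fun y => v y 0 i)) ->
  Ck m ts_domB (fun y => ip (dnf_gs (ts_G y)) (u y) (v y)).
Proof.
move=> Cu Cv; apply: (Ck_ip oB) => // i j; exact: Ck_subset TB (ts_gs_Ck m _ _).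
Qed.

Lemma ts_a_Ck m : Ck m ts_domB
  (fun y => ts_w y + ip (dnf_gs (ts_G y)) (ts_e y) (ts_eb y)).
Proof.
apply: (CkD oB); first exact: Ck_subset TB (ts_w_Ck m).
by apply: ts_ip_Ck => i; [exact: ts_e_Ck | exact: ts_eb_Ck].
Qed.

Lemma ts_disc_Ck m : Ck m ts_domB ts_disc.
Proof.
pose a y := ts_w y + ip (dnf_gs (ts_G y)) (ts_e y) (ts_eb y).
pose ee y := ip (dnf_gs (ts_G y)) (ts_e y) (ts_e y).
pose bb y := ip (dnf_gs (ts_G y)) (ts_eb y) (ts_eb y).
have Ca : Ck m ts_domB a by exact: ts_a_Ck.
have Ce : Ck m ts_domB ee by apply: ts_ip_Ck => i; exact: ts_e_Ck.
have Cb : Ck m ts_domB bb by apply: ts_ip_Ck => i; exact: ts_eb_Ck.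
have -> : ts_disc = (fun y => a y * a y - ee y * bb y).
  by apply/funext => y; rewrite /ts_disc /sec_disc expr2.
exact (CkB oB (CkM oB Ca Ca) (CkM oB Ce Cb)).
Qed.

(** Here the section is spacelike and both the square root and the denominator in
    its normal are positive, so that the normal is smooth. *)
Definition ts_good := [set y | [/\ ts_domB y, 0 < ts_disc y,
  0 < ts_w y + ip (dnf_gs (ts_G y)) (ts_e y) (ts_eb y) & posdef (ts_first y)]].

Lemma ts_good_open : open ts_good.
Proof.
have o1 := Ck_open_gt0 oB (ts_disc_Ck 0).
have S1 : [set x | ts_domB x /\ 0 < ts_disc x] `<=` ts_domB by move=> ? [].
have o2 := Ck_open_gt0 o1 (Ck_subset S1 (ts_a_Ck 0)).
set V2 := [set x | _] in o2.
have S2 : V2 `<=` ts_dom by move=> ? [[[]]].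
have := Ck_posdef_open (k := 0%N) o2 (X := ts_first)
  (fun i j => Ck_subset S2 (ts_first_Ck 0 i j)) (fun y Hy => ts_first_sym (S2 _ Hy)).
congr open; rewrite predeqE => y; split=> [[[[H1 H2] H3] H4]|[H1 H2 H3 H4]]; by split.
Qed.
Let oGd := ts_good_open.
Let GB : ts_good `<=` ts_domB. Proof. by move=> y []. Qed.
Let GT0 : ts_good `<=` ts_dom. Proof. by move=> y [[]]. Qed.

Lemma ts_eps_Ck m : Ck m ts_good
  (fun y => sec_eps (ts_w y) (dnf_gs (ts_G y)) (ts_e y) (ts_eb y)).
Proof.
apply: (CkM oGd).
  apply: (CkN oGd); apply: Ck_subset GB _; apply: ts_ip_Ck => i; exact: ts_e_Ck.
apply: (CkV oGd) => [y [_ d0 a0 _]|].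
  by rewrite gt_eqF // addr_gt0 // sqrtr_gt0.
apply: (CkD oGd); first exact: Ck_subset GB (ts_a_Ck m).
apply: (Ck_sqrt oGd) => [y []//|]; exact: Ck_subset GB (ts_disc_Ck m).
Qed.

Lemma ts_N_Ck m j : Ck m ts_good (fun y => ts_N y 0 j).
Proof.
pose eps y := sec_eps (ts_w y) (dnf_gs (ts_G y)) (ts_e y) (ts_eb y).
have Ceps : Ck m ts_good eps by exact: ts_eps_Ck.
have E y l : ts_N y 0 l = ts_w y * invmx (ts_G y) 0 l
   + eps y * (ts_w y * invmx (ts_G y) 1 l) + angular (ts_e y + eps y *: ts_eb y) 0 l.
  rewrite /ts_N /sec_N mxDE mxDE mxZE /dnf_L /dnf_Lb !mxZE.
  by rewrite [row 0 _ _ _]mxE [row 1 _ _ _]mxE.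
have -> : (fun y => ts_N y 0 j) = (fun y => ts_w y * invmx (ts_G y) 0 j
   + eps y * (ts_w y * invmx (ts_G y) 1 j) + angular (ts_e y + eps y *: ts_eb y) 0 j).
  by apply/funext => y; rewrite E.
have Cw : Ck m ts_good ts_w by exact: Ck_subset GT0 (ts_w_Ck m).
have CI i l : Ck m ts_good (fun y => invmx (ts_G y) i l).
  exact: Ck_subset GT0 (ts_inv_Ck m i l).
apply: (CkD oGd).
  apply: (CkD oGd); first exact: (CkM oGd).
  by apply: (CkM oGd) => //; exact: (CkM oGd).
move: j {E}; elim/ind4 => [||i].
- have -> : (fun y => angular (ts_e y + eps y *: ts_eb y) 0 0) = (fun=> 0).
    by apply/funext => y; rewrite /angular pt4E.
  exact: Ck_cst.
- have -> : (fun y => angular (ts_e y + eps y *: ts_eb y) 0 1) = (fun=> 0).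
    by apply/funext => y; rewrite /angular pt4E.
  exact: Ck_cst.
- have -> : (fun y => angular (ts_e y + eps y *: ts_eb y) 0 (rshift 2 i)) =
     (fun y => ts_e y 0 i + eps y * ts_eb y 0 i).
    by apply/funext => y; rewrite /angular pt4E mxDE (mxZE (eps y)).
  apply: (CkD oGd); first exact: Ck_subset GB (ts_e_Ck m i).
  by apply: (CkM oGd) => //; exact: Ck_subset GB (ts_eb_Ck m i).
Qed.

Lemma ts_orth y b : ts_domB y ->
  ip (ts_G y) (ts_N y) (sec_frame (ts_df y) (ts_dfb y) b) = 0.
Proof.
move=> [Ty By]; have Bu : ts_B y \in unitmx by rewrite unitmxE unitfE.
exact: (sec_orth (ts_form Ty) (ts_dfb y) Bu b).
Qed.

Lemma ts_frameE y a : ts_dom y -> frame ts_F a y = sec_frame (ts_df y) (ts_dfb y) a.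
Proof.
move=> Ty; rewrite /sec_frame; apply/rowP; elim/ind4 => [||i]; rewrite pt4E mxE.
- rewrite mxE; congr (partial a _ y); apply/funext => w.
  by rewrite /ts_F /gr_pt pt4E.
- rewrite mxE; congr (partial a _ y); apply/funext => w.
  by rewrite /ts_F /gr_pt pt4E pt3_t.
- have -> : (fun w => ts_F w 0 (rshift 2 i)) = (fun w : 'rV[R]_2 => w 0 i).
    by apply/funext => w; rewrite /ts_F /gr_pt pt4E pt3_y.
  by rewrite /partial (@derive_val _ _ _ _ _ _ _ (is_derive_coord i _ _)).
Qed.

End TestSection.

Section SurfaceSection.
Variables (R : realType) (M S : topologicalType).
Variables (A : smooth_structure R 4 M) (g : lorentz_metric A).
Variables (T : time_orientation g) (AS : smooth_structure R 2 S).
Variables (d : dn_data R M S) (D : set (R * S)) (h : R -> S -> R).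
Hypothesis hd : double_null T AS d.
Hypothesis hh : graph_function AS d D h.
Variable k : chart R 2 S.
Hypothesis sk : smooth_chart AS k.
Hypothesis sh : smooth_on (gr_dom D k) (gr_fun h k).
Variable fb : 'rV[R]_2 -> R.
Hypothesis sfb : smooth_on setT fb.

Let hk : is_chart k. Proof. by case: sk. Qed.

Definition ts_fS (x : S) : R := h (fb (cmap k x)) x.
Definition ts_fbS (x : S) : R := fb (cmap k x).
Definition ts_W : set S := cdom k `&` (cmap k @^-1` ts_good g d D h k fb).

Local Notation Tdom := (ts_dom D k fb).
Local Notation good := (ts_good g d D h k fb).

Lemma ts_dom_cimg y : Tdom y -> cimg k y.
Proof. by move=> [+ _]; rewrite pt3_y. Qed.

Lemma ts_good_dom : good `<=` Tdom. Proof. by move=> y [[]]. Qed.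

Lemma ts_fSE y : cimg k y -> ts_fS (cinv k y) = ts_f h k fb y.
Proof.
by move=> /(cimgP hk)[_ E]; rewrite /ts_fS E /ts_f /gr_fun pt3_t pt3_y.
Qed.

Lemma ts_fbSE y : cimg k y -> ts_fbS (cinv k y) = fb y.
Proof. by move=> /(cimgP hk)[_ E]; rewrite /ts_fbS E. Qed.

Lemma ts_section_map y : cimg k y -> section_map k ts_fS ts_fbS y = ts_F h k fb y.
Proof.
by move=> Iy; rewrite /section_map ts_fSE // ts_fbSE // /ts_F /gr_pt pt3_t pt3_y.
Qed.

Lemma ts_dfun_f y : Tdom y -> dfun k ts_fS (cinv k y) = ts_df h k fb y.
Proof.
move=> Ty; have Iy := ts_dom_cimg Ty; have [_ E] := cimgP hk Iy.
apply/rowP => i; rewrite !mxE E.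
by apply: derive_ext_open (chart_open_img hk) Iy _ => w Iw; exact: ts_fSE.
Qed.

Lemma ts_dfun_fb y : Tdom y -> dfun k ts_fbS (cinv k y) = ts_dfb fb y.
Proof.
move=> Ty; have Iy := ts_dom_cimg Ty; have [_ E] := cimgP hk Iy.
apply/rowP => i; rewrite !mxE E.
by apply: derive_ext_open (chart_open_img hk) Iy _ => w Iw; exact: ts_fbSE.
Qed.

Lemma ts_ptP y : Tdom y -> cdom (dn_chart d k) (cinv (dn_chart d k) (ts_F h k fb y)).
Proof. by move=> Ty; have [_ ? _] := gr_pt_img hd hh sk Ty. Qed.

Lemma ts_section_B y : Tdom y ->
  section_B g d k ts_fS (cinv k y) (cinv (dn_chart d k) (ts_F h k fb y)) =
  ts_B g d h k fb y.
Proof.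
move=> Ty; rewrite /section_B /shift_vec (dn_LbvecE hd sk (ts_ptP Ty)).
by rewrite ts_dfun_f.
Qed.

Lemma ts_section_L y : Tdom y ->
  section_L g d k ts_fS ts_fbS y = ts_N g d h k fb y.
Proof.
move=> Ty; have cp := ts_ptP Ty.
rewrite /section_L (ts_section_map (ts_dom_cimg Ty)) (ts_section_B Ty).
rewrite (dn_LvecE hd sk cp) (dn_LbvecE hd sk cp) /section_e.
by rewrite (ts_dfun_f Ty) (ts_dfun_fb Ty) -angularE.
Qed.

Lemma ts_W_open : open ts_W.
Proof. by apply: open_chart_preimage => //; exact: (ts_good_open hd hh sk sh sfb). Qed.

Lemma ts_frame_map y : Tdom y -> forall a,
  frame (section_map k ts_fS ts_fbS) a y = frame (ts_F h k fb) a y.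
Proof.
move=> Ty a; apply/rowP => m; rewrite !mxE.
apply: derive_ext_open (chart_open_img hk) (ts_dom_cimg Ty) _ => w Iw.
by rewrite ts_section_map.
Qed.

Lemma ts_spacelike : spacelike_section g AS d D h ts_W ts_fS ts_fbS.
Proof.
have oT := ts_dom_open hh sk sfb.
have oI (x : S) : ts_W x -> open (cmap k @` (ts_W `&` cdom k)).
  by move=> _; apply: open_chart_image => //; exact: ts_W_open.
have IT y : (cmap k @` (ts_W `&` cdom k)) y -> Tdom y.
  by move=> [x [[_ gx] _] <-]; exact: ts_good_dom.
split.
- exact: ts_W_open.
- move=> x Wx; exists k; split => //; first by case: Wx.
  move=> m; apply: Ck_ext (oI _ Wx) _ (Ck_subset IT (ts_f_Ck hh sk sh sfb m)).
  by move=> y /IT /ts_dom_cimg Iy; rewrite /= ts_fSE.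
- move=> x Wx; exists k; split => //; first by case: Wx.
  move=> m; apply: Ck_ext (oI _ Wx) _ (Ck_subset (@subsetT _ _) (sfb m)).
  by move=> y /IT /ts_dom_cimg Iy; rewrite /= ts_fbSE.
- move=> x [kx gx]; split => //.
  have [_] := ts_good_dom gx.
  by rewrite /ts_fbS pt3_t pt3_y (chart_cancel hk).
- move=> x [kx gx]; exists k; have Ty := ts_good_dom gx; split => //.
    have [_ _ _ +] := gx; congr posdef.
    apply/matrixP => a b; rewrite !mxE (ts_frame_map Ty) (ts_frame_map Ty).
    by rewrite !(ts_frameE _ _ Ty) (ts_section_map (ts_dom_cimg Ty)).
  have [[_ dB] _ _ _] := gx.
  have xE : cinv k (cmap k x) = x by rewrite (chart_cancel hk).
  have := ts_section_B Ty; rewrite xE.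
  have [_ _ ->] := gr_pt_img hd hh sk Ty.
  rewrite /gr_fun pt3_t pt3_y xE => ->.
  by rewrite unitmxE unitfE.
Qed.

Lemma ts_expansion x : ts_W x ->
  section_expansion g d k ts_fS ts_fbS x =
  null_expansion (metric_in g (dn_chart d k)) (ts_F h k fb) (ts_N g d h k fb) (cmap k x).
Proof.
move=> [kx gx]; have oT := ts_dom_open hh sk sfb.
apply: (null_expansion_ext _ oT (ts_good_dom gx)) => y Ty.
  by rewrite ts_section_map //; exact: ts_dom_cimg.
exact: ts_section_L.
Qed.

(** The second derivatives of the section are isolated in the last term; the other
    one depends only on the point, the normal and the tangent frame. *)
Lemma ts_chi y a b : good y ->
  chi_form (metric_in g (dn_chart d k)) (ts_F h k fb) (ts_N g d h k fb) y a b =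
  chi_first (metric_in g (dn_chart d k)) (ts_F h k fb y) (ts_N g d h k fb y)
    (sec_frame (ts_df h k fb y) (ts_dfb fb y) a)
    (sec_frame (ts_df h k fb y) (ts_dfb fb y) b)
  - ip (ts_G g d h k fb y) (ts_N g d h k fb y)
      (pt4 (partial a (partial b (ts_f h k fb)) y) (partial a (partial b fb) y) 0).
Proof.
move=> gy; have Ty := ts_good_dom gy.
have oT := ts_dom_open hh sk sfb; have oG := ts_good_open hd hh sk sh sfb.
have F0 : (fun z => ts_F h k fb z 0 0) = ts_f h k fb.
  by apply/funext => w; rewrite /ts_F /gr_pt pt4E.
have F1 : (fun z => ts_F h k fb z 0 1) = fb.
  by apply/funext => w; rewrite /ts_F /gr_pt pt4E pt3_t.
have F2 i : (fun z => ts_F h k fb z 0 (rshift 2 i)) = (fun w : 'rV[R]_2 => w 0 i).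
  by apply/funext => w; rewrite /ts_F /gr_pt pt4E pt3_y.
have CF j m : Ck m Tdom (fun z => ts_F h k fb z 0 j).
  move: j; elim/ind4 => [||i]; rewrite ?F0 ?F1 ?F2.
  - exact: (ts_f_Ck hh sk sh sfb).
  - by apply: Ck_subset (sfb m).
  - exact: Ck_coord.
have [Ip _ _] := gr_pt_img hd hh sk Ty.
rewrite chi_form_normal.
- rewrite !(ts_frameE _ _ Ty); congr (_ - ip _ _ _).
  apply/rowP; elim/ind4 => [||i]; rewrite pt4E mxE ?F0 ?F1 ?F2 //.
  rewrite mxE (_ : partial b _ = fun=> (delta_mx 0 b : 'rV[R]_2) 0 i).
    exact: derive_cst.
  apply/funext => w; rewrite /partial.
  by rewrite (@derive_val _ _ _ _ _ _ _ (is_derive_coord i _ _)).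
- have : \forall z \near y, good z by exact: open_nbhs_nbhs.
  apply: filterS => z gz; rewrite (ts_frameE _ _ (ts_good_dom gz)).
  by have [zB _ _ _] := gz; exact: (ts_orth hd hh sk _ zB).
- by move=> m n; exact: (metric_differentiable g m n (dn_smooth_chart hd sk) Ip).
- by move=> m; have [_ /(_ a)[+ _]] := CF m 1%N; apply.
- by move=> m; have [_ /(_ a)[+ _]] := Ck_partial b (CF m 2%N); apply.
- by move=> m; have [_ /(_ a)[+ _]] := ts_N_Ck hd hh sk sh sfb 1 m; apply.
Qed.

End SurfaceSection.

(** * Marginality of all sections forces nullness *)

(** A perturbation of the constant [t] whose value and gradient at [y1] do not
    depend on [c], with Hessian [2 c] times the identity. *)
Definition bump {R : realType} (c t : R) (y1 y : 'rV[R]_2) : R :=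
  t + c * \sum_i (y 0 i - y1 0 i) ^+ 2.

Lemma bump_smooth (R : realType) (c t : R) (y1 : 'rV[R]_2) :
  smooth_on setT (bump c t y1).
Proof.
move=> m; have oT := @openT ('rV[R]_2).
apply: (CkD oT); first exact: Ck_cst.
apply: (CkM oT); first exact: Ck_cst.
apply: (Ck_sum oT) => i _.
have C1 : Ck m setT (fun y : 'rV[R]_2 => y 0 i - y1 0 i).
  by apply: (CkB oT); [exact: Ck_coord | exact: Ck_cst].
exact: (CkM oT C1 C1).
Qed.

Lemma bump_center (R : realType) (c t : R) (y1 : 'rV[R]_2) : bump c t y1 y1 = t.
Proof. by rewrite /bump big1 ?mulr0 ?addr0 // => i _; rewrite subrr expr0n. Qed.

Lemma partial_bump (R : realType) (c t : R) (y1 : 'rV[R]_2) a :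
  partial a (bump c t y1) = fun y => 2 * c * (y 0 a - y1 0 a).
Proof.
apply/funext => y.
have dc i : is_derive y (delta_mx 0 a) (fun y : 'rV[R]_2 => y 0 i - y1 0 i)
    ((i == a)%:R - 0).
  have := is_deriveB (is_derive_coord i y (delta_mx 0 a))
    (is_derive_cst (y1 0 i) y (delta_mx 0 a)).
  by rewrite mxE eqxx.
have ds := is_derive_bigsum (fun i => is_derive_mul (dc i) (dc i)).
have H := is_deriveD (is_derive_cst t y (delta_mx 0 a))
  (is_derive_mul (is_derive_cst c y (delta_mx 0 a)) ds).
rewrite /partial; apply: etrans (@derive_val _ _ _ _ _ _ _ H) _.
rewrite mul0r !add0r (bigD1 a) //= big1 => [|i ia].
  by rewrite eqxx /cst /=; ring.
by rewrite (negbTE ia) subrr mul0r mulr0 addr0.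
Qed.

Lemma partial2_bump (R : realType) (c t : R) (y1 : 'rV[R]_2) a b y :
  partial a (partial b (bump c t y1)) y = 2 * c * (a == b)%:R.
Proof.
rewrite partial_bump /partial.
have H := is_derive_mul (is_derive_cst (2 * c) y (delta_mx 0 a))
  (is_deriveB (is_derive_coord b y (delta_mx 0 a))
    (is_derive_cst (y1 0 b) y (delta_mx 0 a))).
apply: etrans (@derive_val _ _ _ _ _ _ _ H) _.
by rewrite mxE eqxx /= mul0r add0r subr0 eq_sym.
Qed.

Section Marginal.
Variables (R : realType) (M S : topologicalType).
Variables (A : smooth_structure R 4 M) (g : lorentz_metric A).
Variables (T : time_orientation g) (AS : smooth_structure R 2 S).
Variables (d : dn_data R M S) (D : set (R * S)) (h : R -> S -> R).
Hypothesis hd : double_null T AS d.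
Hypothesis hh : graph_function AS d D h.
Variable k : chart R 2 S.
Hypothesis sk : smooth_chart AS k.
Hypothesis sh : smooth_on (gr_dom D k) (gr_fun h k).

Let oD : open (gr_dom D k) := gr_dom_open hh sk.
Let hk : is_chart k. Proof. by case: sk. Qed.

Definition gr_dh z : 'rV[R]_2 := \row_i partial (rshift 1 i) (gr_fun h k) z.
Definition gr_B z := sec_B (gr_dh z) (dnf_b (gr_met g d h k z) (gr_w d h k z)).
Definition gr_N z :=
  sec_N (gr_met g d h k z) (gr_w d h k z) (gr_B z) (gr_dh z) 0.
Definition gr_first z : 'M[R]_2 := \matrix_(a, b)
  ip (gr_met g d h k z) (sec_frame (gr_dh z) 0 a) (sec_frame (gr_dh z) 0 b).

(** Here the section sb = const through the point fulfils the requirements on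
    spacelike sections. *)
Definition gr_good := [set z | [/\ gr_dom D k z, \det (gr_B z) != 0
  & posdef (gr_first z)]].

Lemma gr_dh_Ck m i : Ck m (gr_dom D k) (fun z => gr_dh z 0 i).
Proof.
have -> : (fun z => gr_dh z 0 i) = partial (rshift 1 i) (gr_fun h k).
  by apply/funext => z; rewrite mxE.
exact: Ck_partial (sh m.+1).
Qed.

Lemma gr_good_open : open gr_good.
Proof.
have CB i j : Ck 0 (gr_dom D k) (fun z => gr_B z i j).
  have -> : (fun z => gr_B z i j) = (fun z => (i == j)%:R
      - gr_dh z 0 i * dnf_b (gr_met g d h k z) (gr_w d h k z) 0 j).
    apply/funext => y; rewrite /gr_B /sec_B mxDE [1%:M i j]mxE; congr (_ + _).
    by rewrite [LHS]mxE mxE big_ord1 [_^T _ _]mxE.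
  apply: (CkB oD); first exact: Ck_cst.
  by apply: (CkM oD); [exact: gr_dh_Ck | exact: (gr_b_Ck hd hh sk sh)].
have o1 := Ck_open_neq0 oD (Ck_det oD CB).
have CF a j : Ck 0 (gr_dom D k) (fun z => sec_frame (gr_dh z) 0 a 0 j).
  move: j; elim/ind4 => [||i].
  - have -> : (fun z => sec_frame (gr_dh z) 0 a 0 0) = (fun z => gr_dh z 0 a).
      by apply/funext => y; rewrite /sec_frame pt4E.
    exact: gr_dh_Ck.
  - have -> : (fun z => sec_frame (gr_dh z) 0 a 0 1) = (fun=> (0 : 'rV[R]_2) 0 a).
      by apply/funext => y; rewrite /sec_frame pt4E.
    exact: Ck_cst.
  - have -> : (fun z => sec_frame (gr_dh z) 0 a 0 (rshift 2 i)) =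
        (fun=> (delta_mx 0 a : 'rV[R]_2) 0 i).
      by apply/funext => y; rewrite /sec_frame pt4E.
    exact: Ck_cst.
have CG a b : Ck 0 (gr_dom D k) (fun z => gr_first z a b).
  have -> : (fun z => gr_first z a b) = (fun z => ip (gr_met g d h k z)
      (sec_frame (gr_dh z) 0 a) (sec_frame (gr_dh z) 0 b)).
    by apply/funext => z; rewrite mxE.
  apply: (Ck_ip oD) => [i j|j|j]; [|exact: CF..].
  exact: (gr_met_smooth hd hh i j sk sh 0%N).
set V := [set z | _] in o1.
have VD : V `<=` gr_dom D k by move=> z [].
have := Ck_posdef_open o1 (X := gr_first) (fun i j => Ck_subset VD (CG i j)).
rewrite (_ : gr_good = [set x | V x /\ posdef (gr_first x)]).
  apply => z /VD Dz; apply/matrixP => a b.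
  by rewrite !mxE ipC // (dnf_sym (gr_form hd hh sk Dz)).
by rewrite predeqE => z; split=> [[H1 H2 H3]|[[H1 H2] H3]]; split.
Qed.

(** With vanishing angular gradient, the section sb = const is tangent to the
    angular directions, which are spacelike. *)
Lemma gr_good_flat z : gr_dom D k z ->
  (forall i, partial (rshift 1 i) (gr_fun h k) z = 0) -> gr_good z.
Proof.
move=> Dz p0; have dh0 : gr_dh z = 0 by apply/rowP => i; rewrite !mxE p0.
have hG := gr_form hd hh sk Dz.
split => //.
  by rewrite /gr_B dh0 /sec_B trmx0 mul0mx subr0 det1 oner_eq0.
rewrite (_ : gr_first z = dnf_gs (gr_met g d h k z)).
  exact: dnf_gs_posdef hG.
have z0 a : (0 : 'rV[R]_2) 0 a = 0 by rewrite mxE.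
apply/matrixP => a b; rewrite mxE dh0 /sec_frame !z0.
by rewrite -[RHS]ip_delta -ip_angular.
Qed.

Variables (t1 : R) (y1 : 'rV[R]_2).
Let z1 := pt3 t1 y1.
Hypothesis gz1 : gr_good z1.
Let Dz1 : gr_dom D k z1. Proof. by case: gz1. Qed.

Section Bump.
Variable c : R.
Let fb := bump c t1 y1.
Let sfb : smooth_on setT fb := bump_smooth c t1 y1.

Lemma bump_z : ts_z fb y1 = z1. Proof. by rewrite /ts_z /fb bump_center. Qed.

Let Ty1 : ts_dom D k fb y1.
Proof. by rewrite /ts_dom /= bump_z. Qed.

Lemma bump_chain (f : 'rV[R]_(1 + 2) -> R) y a : differentiable f (ts_z fb y) ->
  partial a (fun w => f (ts_z fb w)) y =
    partial a fb y * partial (lshift 2 0) f (ts_z fb y)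
    + partial (rshift 1 a) f (ts_z fb y).
Proof.
move=> df.
have E0 : (fun w => ts_z fb w 0 (lshift 2 0)) = fb by apply/funext => w; rewrite pt3_t.
have Ei i : (fun w => ts_z fb w 0 (rshift 1 i)) = (fun w : 'rV[R]_2 => w 0 i).
  by apply/funext => w; rewrite pt3_i.
have dz j : derivable (fun w => ts_z fb w 0 j) y (delta_mx 0 a).
  by have [_ /(_ a)[+ _]] := ts_z_Ck sfb 1 setT j; apply.
have H := is_derive_chain df dz.
rewrite [LHS]/partial (@derive_val _ _ _ _ _ _ _ H) (@big_split_ord _ _ _ 1 2) /= big_ord1.
rewrite E0; congr (_ + _); rewrite (bigD1 a) //= big1 ?addr0 => [|i ia].
  rewrite Ei (@derive_val _ _ _ _ _ _ _ (is_derive_coord a _ _)).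
  by rewrite mxE !eqxx mul1r.
rewrite Ei (@derive_val _ _ _ _ _ _ _ (is_derive_coord i _ _)).
by rewrite mxE (negbTE ia) andbF mul0r.
Qed.

Let partial_fb a : partial a fb y1 = 0.
Proof. by rewrite /fb partial_bump subrr mulr0. Qed.

Lemma bump_dfb : ts_dfb fb y1 = 0.
Proof. by apply/rowP => i; rewrite [LHS]mxE partial_fb mxE. Qed.

Let dgr m (Cm : Ck m.+1 (gr_dom D k) (gr_fun h k)) y : ts_dom D k fb y ->
  differentiable (gr_fun h k) (ts_z fb y).
Proof. exact: Ck_differentiable oD Cm. Qed.

Lemma bump_df : ts_df h k fb y1 = gr_dh z1.
Proof.
apply/rowP => i; rewrite [LHS]mxE [RHS]mxE.
rewrite (bump_chain _ (dgr (sh 1%N) Ty1)).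
by rewrite partial_fb mul0r add0r bump_z.
Qed.

Lemma bump_N : ts_N g d h k fb y1 = gr_N z1.
Proof.
by rewrite /ts_N /ts_B bump_df bump_dfb /ts_w /ts_G bump_z.
Qed.

Lemma bump_good : ts_good g d D h k fb y1.
Proof.
have BE : ts_B g d h k fb y1 = gr_B z1.
  by rewrite /ts_B bump_df /ts_G /ts_w bump_z.
have eb0 : ts_eb g d h k fb y1 = 0.
  by rewrite /ts_eb bump_dfb /sec_e !mul0mx scaler0.
have ip0 (H : 'M[R]_2) u : ip H u 0 = 0 by rewrite /ip trmx0 mulmx0 mxE.
have w0 : 0 < ts_w d h k fb y1 := dnf_w (ts_form hd hh sk Ty1).
have [_ dB pf] := gz1; split.
- by split; rewrite ?BE.
- by rewrite /ts_disc eb0 /sec_disc !ip0 mulr0 subr0 addr0 exprn_gt0.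
- by rewrite eb0 ip0 addr0.
- move: pf; congr posdef; apply/matrixP => a b.
  by rewrite !mxE bump_df bump_dfb /ts_G bump_z.
Qed.

(** The gradient of [fb] vanishes at [y1], so that its Hessian enters only
    multiplied by the derivative of h in sb. *)
Lemma bump_second a b : partial a (partial b (ts_f h k fb)) y1 =
  2 * c * (a == b)%:R * partial (lshift 2 0) (gr_fun h k) z1
  + partial (rshift 1 a) (partial (rshift 1 b) (gr_fun h k)) z1.
Proof.
have oT := ts_dom_open hh sk sfb.
pose p0 := partial (lshift 2 0) (gr_fun h k).
pose pb := partial (rshift 1 b) (gr_fun h k).
have E y : ts_dom D k fb y -> partial b (ts_f h k fb) y =
    partial b fb y * p0 (ts_z fb y) + pb (ts_z fb y).
  by move=> Ty; rewrite (bump_chain _ (dgr (sh 1%N) Ty)).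
rewrite {1}/partial (derive_ext_open _ oT Ty1 E).
have Cp0 : Ck 1 (ts_dom D k fb) (fun y => p0 (ts_z fb y)).
  exact: (ts_comp hh sk sfb (Ck_partial (lshift 2 0) (sh 2%N))).
have Cpb : Ck 1 (ts_dom D k fb) (fun y => pb (ts_z fb y)).
  exact: (ts_comp hh sk sfb (Ck_partial (rshift 1 b) (sh 2%N))).
have d1 : derivable (partial b fb) y1 (delta_mx 0 a).
  by have [_ /(_ a)[+ _]] := Ck_partial b (sfb 2%N); apply.
have d2 : derivable (fun y => p0 (ts_z fb y)) y1 (delta_mx 0 a).
  by have [_ /(_ a)[+ _]] := Cp0; apply.
have d3 : derivable (fun y => pb (ts_z fb y)) y1 (delta_mx 0 a).
  by have [_ /(_ a)[+ _]] := Cpb; apply.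
have e3 : 'D_(delta_mx 0 a) (fun y => pb (ts_z fb y)) y1 = partial (rshift 1 a) pb z1.
  have := bump_chain a (Ck_differentiable oD (Ck_partial (rshift 1 b) (sh 2%N)) (Ty1)).
  by rewrite partial_fb mul0r add0r bump_z.
have e1 : 'D_(delta_mx 0 a) (partial b fb) y1 = 2 * c * (a == b)%:R.
  exact: partial2_bump.
have H := is_deriveD (is_derive_mul (is_derive_eq (derivableP d1) e1) (derivableP d2))
  (is_derive_eq (derivableP d3) e3).
apply: etrans (@derive_val _ _ _ _ _ _ _ H) _.
by rewrite partial_fb mul0r addr0 bump_z.
Qed.

End Bump.

Hypothesis marg : forall (W : set S) (f fb : S -> R),
  spacelike_section g AS d D h W f fb -> section_marginal g AS d W f fb.

Let cp := dn_chart d k.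

Lemma bump_expansion c : null_expansion (metric_in g cp) (ts_F h k (bump c t1 y1))
  (ts_N g d h k (bump c t1 y1)) y1 = 0.
Proof.
have sfb := bump_smooth c t1 y1.
have Iy : cimg k y1.
  have Ty : ts_dom D k (bump c t1 y1) y1 by rewrite /ts_dom /= bump_z.
  exact: ts_dom_cimg Ty.
have [ky E] := cimgP hk Iy.
have Wx : ts_W g d D h k (bump c t1 y1) (cinv k y1).
  by split => //=; rewrite E; exact: bump_good.
have := ts_expansion hd hh sk sfb Wx; rewrite E => <-.
exact: marg (ts_spacelike hd hh sk sh sfb) _ _ sk Wx ky.
Qed.

(** The bumps for [c = 1] and [c = 0] give two sections with the same first order
    jet, whose Hessians differ by a multiple of the identity. The vanishing of
    both expansions shows that the normal is orthogonal to the remaining tangent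
    direction [V] of the graph as well, and [conormal_null] applies. *)
Lemma marginal_gr_sq : gr_sq g d h k z1 = 0.
Proof.
pose F c := ts_F h k (bump c t1 y1); pose N c := ts_N g d h k (bump c t1 y1).
have Ty c : ts_dom D k (bump c t1 y1) y1 by rewrite /ts_dom /= bump_z.
have FE c : F c y1 = gr_pt h k z1 by rewrite /F /ts_F bump_z.
have NE c : N c y1 = gr_N z1 by exact: bump_N.
have fE c a : frame (F c) a y1 = sec_frame (gr_dh z1) 0 a.
  by rewrite /F (ts_frameE _ _ (Ty c)) bump_df bump_dfb.
have hG := gr_form hd hh sk Dz1.
pose V : 'rV[R]_4 := pt4 (partial (lshift 2 0) (gr_fun h k) z1) 1 0.
have GE c : ts_G g d h k (bump c t1 y1) y1 = gr_met g d h k z1.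
  by rewrite /ts_G bump_z.
have chiE a b : chi_form (metric_in g cp) (F 1) (N 1) y1 a b
    - chi_form (metric_in g cp) (F 0) (N 0) y1 a b
    = (a == b)%:R * (- 2 * ip (gr_met g d h k z1) (gr_N z1) V).
  rewrite /F /N !(ts_chi hd hh sk sh (bump_smooth _ t1 y1) _ _ (bump_good _)).
  rewrite -!/(F _) -!/(N _) !FE !NE !bump_df !bump_dfb !GE.
  rewrite !partial2_bump !bump_second.
  set X := chi_first _ _ _ _ _; set q := partial (rshift 1 a) _ _.
  set h1 := partial _ _ _.
  (* The angular Hessian [q] of h is common to both sections and cancels. *)
  have -> : pt4 (2 * 1 * (a == b)%:R * h1 + q) (2 * 1 * (a == b)%:R) 0 =
     (2 * (a == b)%:R) *: V + pt4 q 0 0.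
    apply/rowP; elim/ind4 => [||i]; rewrite mxDE mxZE !pt4E ?mulr1 ?addr0 //.
    by rewrite !mxE mulr0 addr0.
  have -> : pt4 (2 * 0 * (a == b)%:R * h1 + q) (2 * 0 * (a == b)%:R) 0 = pt4 q 0 0.
    by rewrite mulr0 !mul0r add0r.
  by rewrite ipDr (ipZr _ (2 * _)); ring.
have fs : (first_form (metric_in g cp) (F 0) y1) = gr_first z1.
  by apply/matrixP => a b; rewrite !mxE !fE FE.
have := null_expansion_diff (etrans (FE 1) (esym (FE 0)))
  (etrans (NE 1) (esym (NE 0))) (fun a => etrans (fE 1 a) (esym (fE 0 a))) chiE.
rewrite !bump_expansion subrr fs => /esym /eqP.
have [_ dB pf] := gz1.
have fT : (gr_first z1)^T = gr_first z1.
  by apply/matrixP => a b; rewrite !mxE ipC // (dnf_sym hG).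
rewrite mulf_eq0 (gt_eqF (posdef_trace_invmx fT pf)) /= mulf_eq0 oppr_eq0 pnatr_eq0 /=.
move=> /eqP NV.
have Bu : gr_B z1 \in unitmx by rewrite unitmxE unitfE.
apply: (conormal_null (dnf_sym hG) (dnf_unit hG) _ _ NV).
- apply/eqP => N0; have := sec_N1 hG (gr_dh z1) 0.
  by rewrite -/(gr_B z1) -/(gr_N z1) N0 mxE => /eqP; rewrite eq_sym oner_eq0.
- exact: (sec_null hG (gr_dh z1) (erefl _)).
- move=> a; have := sec_orth hG 0 Bu a.
  by rewrite /sec_frame [(0 : 'rV[R]_2) 0 a]mxE.
Qed.

End Marginal.

(** * The marginal tube *)

Lemma chi_form_metric_ext (R : realType) k (G G' : 'rV[R]_4 -> 'M[R]_4)
    (F N : 'rV[R]_k -> 'rV[R]_4) (V : set 'rV[R]_4) z : open V -> V (F z) ->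
  (forall x, V x -> G x = G' x) -> chi_form G F N z = chi_form G' F N z.
Proof.
move=> oV VF GG.
have GE := GG _ VF.
have pE i a b : partial i (fun x => G x a b) (F z) = partial i (fun x => G' x a b) (F z).
  by apply: derive_ext_open oV VF _ => x /GG ->.
have chE m i j : christoffel G (F z) m i j = christoffel G' (F z) m i j.
  rewrite /christoffel GE; congr (_ * _); apply: eq_bigr => l _; congr (_ * _).
  by congr (_ + _ - _); exact: pE.
have cE a : cov_deriv G F N a z = cov_deriv G' F N a z.
  apply/rowP => m; rewrite [LHS]mxE [RHS]mxE; congr (_ + _).
  by apply: eq_bigr => i _; apply: eq_bigr => j _; rewrite chE.
by apply/matrixP => a b; rewrite [LHS]mxE [RHS]mxE GE cE.
Qed.

Lemma first_form_metric_ext (R : realType) k (G G' : 'rV[R]_4 -> 'M[R]_4)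
    (F : 'rV[R]_k -> 'rV[R]_4) z :
  G (F z) = G' (F z) -> first_form G F z = first_form G' F z.
Proof. by move=> GG; apply/matrixP => a b; rewrite !mxE GG. Qed.

(** A form degenerate along the first coordinate only sees the last two columns
    of the frame of a plane. *)
Lemma degenerate_restrict (R : realType) (X : 'M[R]_3) (E : 'M[R]_(2, 3)) :
  (forall j, X 0 j = 0) -> (forall i, X i 0 = 0) ->
  E *m X *m E^T =
    @rsubmx R 2 1 2 E *m @drsubmx R 1 2 1 2 X *m (@rsubmx R 2 1 2 E)^T.
Proof.
move=> X0j Xi0.
have XE : X = @block_mx R 1 2 1 2 0 0 0 (@drsubmx R 1 2 1 2 X).
  have e1 : @ulsubmx R 1 2 1 2 X = 0.
    apply/matrixP => i j; rewrite !mxE -[RHS](X0j (lshift 2 j)); congr (X _ _).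
    by rewrite (ord1 i); apply: val_inj.
  have e2 : @ursubmx R 1 2 1 2 X = 0.
    apply/matrixP => i j; rewrite !mxE -[RHS](X0j (rshift 1 j)); congr (X _ _).
    by rewrite (ord1 i); apply: val_inj.
  have e3 : @dlsubmx R 1 2 1 2 X = 0.
    apply/matrixP => i j; rewrite !mxE -[RHS](Xi0 (rshift 1 i)); congr (X _ _).
    by rewrite (ord1 j); apply: val_inj.
  by rewrite -[LHS](@submxK R 1 2 1 2) e1 e2 e3.
move: XE; move: (@drsubmx R 1 2 1 2 X) => X' XE.
transitivity (@row_mx R 2 1 2 (@lsubmx R 2 1 2 E) (@rsubmx R 2 1 2 E)
   *m @block_mx R 1 2 1 2 0 0 0 X'
   *m (@row_mx R 2 1 2 (@lsubmx R 2 1 2 E) (@rsubmx R 2 1 2 E))^T).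
  by rewrite hsubmxK -XE.
by rewrite tr_row_mx mul_row_block mul_row_col !mulmx0 !add0r mul0mx add0r.
Qed.

Lemma drsubmx_entry (R : realType) (X : 'M[R]_3) a b :
  @drsubmx R 1 2 1 2 X a b = X (@rshift 1 2 a) (@rshift 1 2 b).
Proof. by rewrite !mxE. Qed.

(** Modulo the null direction every spacelike plane of the tube is a change of
    basis of the angular one, which leaves the expansion unchanged. *)
Lemma trace_plane (R : realType) (E X Y : 'M[R]_2) : posdef (E *m X *m E^T) ->
  \tr (invmx (E *m X *m E^T) *m (E *m Y *m E^T)) = \tr (invmx X *m Y).
Proof.
move=> /posdef_unit; rewrite !unitmx_mul => /andP[/andP[Eu Xu] ETu].
have -> : invmx (E *m X *m E^T) = invmx E^T *m invmx X *m invmx E.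
  have Ku : E *m X *m E^T \in unitmx by rewrite !unitmx_mul Eu Xu.
  apply: (can_inj (mulKmx Ku)); rewrite mulmxV //.
  by rewrite !mulmxA mulmxK // mulmxK // mulmxV.
rewrite !mulmxA mulmxKV // mxtrace_mulC !mulmxA mulmxV // mul1mx.
by [].
Qed.

Section Tube.
Variables (R : realType) (M S : topologicalType).
Variables (A : smooth_structure R 4 M) (g : lorentz_metric A).
Variables (T : time_orientation g) (AS : smooth_structure R 2 S).
Variables (d : dn_data R M S) (D : set (R * S)) (h : R -> S -> R).
Hypothesis hd : double_null T AS d.
Hypothesis hh : graph_function AS d D h.
Hypothesis h0 : forall t x, D (t, x) -> h t x = 0.
Hypothesis marg : forall (W : set S) (f fb : S -> R),
  spacelike_section g AS d D h W f fb -> section_marginal g AS d W f fb.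

Local Notation H := (graph_hypersurface d D h).
Local Notation tc k := (tube_chart d D k).

Lemma dn_s_differentiable c p : smooth_chart A c -> cdom c p -> dn_dom d p ->
  differentiable (dn_s d \o cinv c) (cmap c p).
Proof.
move=> sc cp dp; have [k sk kp] := smooth_chart_at AS (dn_th d p).
have sdn := dn_smooth_chart hd sk; have [hc _] := sc; have [hdn _] := sdn.
have st := smooth_transition_charts sc sdn (0 : 'I_4) 1%N.
pose B := cmap c @` (cdom (dn_chart d k) `&` cdom c).
have oB : open B by apply: open_chart_image => //; exact: chart_open_dom.
rewrite setIC -/B in st.
apply: (Ck_differentiable oB); last by exists p.
apply: Ck_ext st => // _ [q [[dq kq] cq] <-].
by rewrite /comp (chart_cancel hc) // /= pt4_0.
Qed.

Lemma Lvec_field : vector_field A H (Lvec g d).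
Proof.
move=> c c' p sc sc' [dp _ _] cp c'p.
rewrite /Lvec /Lprime (grad_change g sc sc' cp c'p).
  by rewrite -!scalemxAl.
exact: dn_s_differentiable.
Qed.

Lemma tube_L k q : smooth_chart AS k -> cdom (tc k) q ->
  Lvec g d (tc k) q = delta_mx 0 1.
Proof.
move=> sk cq; have cq' := tube_chart_dom cq.
rewrite /Lvec /Lprime /grad (tube_metric hd hh sk cq).
have := dn_LvecE hd sk cq'; rewrite /Lvec /Lprime /grad => ->.
exact: dnf_LE (dn_formP hd sk cq').
Qed.

(** [L] is null, hence not orthogonal to the time direction, and if it were past
    directed then [- L] would be a future direction along which [sb]
    decreases. *)
Lemma tube_future k q : smooth_chart AS k -> H q -> cdom (tc k) q ->
  future_null T (tc k) q (Lvec g d (tc k) q).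
Proof.
move=> sk Hq cq; have cq' := tube_chart_dom cq.
have sc := tube_chart_smooth hd hh sk; have hG := tube_form hd hh sk cq.
have LE : Lvec g d (tc k) q = dnf_L (g (tc k) q) (dn_w d q).
  by rewrite tube_L // (dnf_LE hG).
have L0 : (delta_mx 0 1 : 'rV[R]_4) != 0.
  by apply/eqP => /rowP /(_ 1); rewrite !mxE !eqxx => /eqP; rewrite oner_eq0.
have LL : ip (g (tc k) q) (delta_mx 0 1) (delta_mx 0 1) = 0.
  by rewrite -{1}(dnf_LE hG) (dnf_ip_L hG) mxE mulr0.
have TT := tvec_timelike T sc cq.
rewrite tube_L //; split => //.
have [P Pu PG] := dnf_lorentz hG.
have [//|TL|TL0] := ltrgtP (ip (g (tc k) q) (T (tc k) q) (delta_mx 0 1)) 0; last first.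
  by have := orth_timelike Pu PG TT TL0 L0; rewrite LL ltxx.
have [dq Dq sq] := Hq.
have fN : future_null T (tc k) q ((-1) *: delta_mx 0 1).
  split.
  - by rewrite scaler_eq0 oppr_eq0 oner_eq0.
  - by rewrite ipZl ipZr LL !mulr0.
  - by rewrite ipZr mulN1r oppr_lt0.
have vE (f : M -> R) m : dfun (dn_chart d k) f q = delta_mx 0 m ->
    vapp (tc k) ((-1) *: delta_mx 0 1) f q = - (m == 1)%:R.
  move=> fE; rewrite /vapp (bigD1 1) //= big1 => [|i i1].
    rewrite mxZE [delta_mx _ _ _ _]mxE !eqxx addr0 mulr1 mulN1r; congr (- _).
    rewrite (_ : dfun (tc k) f q = delta_mx 0 m) //.
    by rewrite mxE eqxx eq_sym.
  by rewrite mxZE [delta_mx _ _ _ _]mxE (negbTE i1) andbF mulr0 mul0r.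
have := dn_sb_increasing hd sc dq cq _ fN _.
rewrite (vE _ _ (dfun_s hd sk cq')) (vE _ _ (dfun_sb hd sk cq')) sq h0 //.
by move=> /(_ erefl); rewrite /= oppr0 => /(_ erefl); rewrite oppr_gt0 ltr10.
Qed.

Lemma tube_gr_smooth k : smooth_chart AS k -> smooth_on (gr_dom D k) (gr_fun h k).
Proof.
move=> sk m; apply: (Ck_ext (gr_dom_open hh sk) _ (Ck_cst m _ 0)) => z [_ Dz].
by rewrite /gr_fun h0.
Qed.

Lemma tube_partial0 k z i : smooth_chart AS k -> gr_dom D k z ->
  partial i (gr_fun h k) z = 0.
Proof.
move=> sk Dz; rewrite /partial.
rewrite (derive_ext_open _ (gr_dom_open hh sk) Dz (g := fun=> 0)) ?derive_cst //.
by move=> w [_ Dw]; rewrite /gr_fun h0.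
Qed.

Section TubeChart.
Variable k : chart R 2 S.
Hypothesis sk : smooth_chart AS k.
Let c := tc k.
Let sc : smooth_chart A c := tube_chart_smooth hd hh sk.
Let hc : is_chart c. Proof. by case: sc. Qed.
Let G := metric_in g c.

Lemma tube_img x : cimg c x -> [/\ cdom c (cinv c x),
  dn_form (G x) (dn_w d (cinv c x)) & gr_dom D k (proj3 x)].
Proof.
move=> Ix; have [cx E] := cimgP hc Ix; split => //; first exact: (tube_form hd hh sk).
by case: cx => _ [_]; rewrite /= -[X in proj3 X]/(cmap c (cinv c x)) E.
Qed.

Lemma tube_G1 x j : cimg c x -> j != 0 -> G x j 1 = 0.
Proof.
move=> Ix j0; have [_ hG _] := tube_img Ix.
by rewrite -[G x]trmxK (dnf_sym hG) mxE (dnf_G1 hG) (negbTE j0) mulr0.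
Qed.

(** As g(L, .) = [w] ds, the tangential components of this covector vanish
    identically, and only the derivative of the metric along [L] survives. *)
Lemma tube_chi_coord n (F N : 'rV[R]_n -> 'rV[R]_4) z (s : 'I_n -> 'I_4) a b :
  cimg c (F z) -> (forall a, frame F a z = delta_mx 0 (s a)) ->
  (\forall w \near z, N w = delta_mx 0 1) -> (forall a, s a != 0) ->
  chi_form G F N z a b = 2^-1 * partial 1 (fun x => G x (s b) (s a)) (F z).
Proof.
move=> Ix fr Nc s0; have [_ hG _] := tube_img Ix.
rewrite (chi_form_coord (s := s) (c := 1) a b (dnf_sym hG) (dnf_unit hG) fr Nc).
have p0 i j : j != 0 -> partial i (fun x => G x j 1) (F z) = 0.
  move=> j0; rewrite /partial.
  rewrite (derive_ext_open _ (chart_open_img hc) Ix (g := fun=> 0)) ?derive_cst //.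
  by move=> x Ixx; exact: tube_G1.
by rewrite !p0 // add0r subr0.
Qed.

Lemma tube_Lconst n (F : 'rV[R]_n -> 'rV[R]_4) z :
  {for z, continuous F} -> cimg c (F z) ->
  \forall w \near z, Lvec g d c (cinv c (F w)) = delta_mx 0 1.
Proof.
move=> cF Ix.
have nI : \forall w \near z, cimg c (F w).
  by apply: (cF (cimg c)); apply: open_nbhs_nbhs; split => //; exact: chart_open_img.
by apply: filterS nI => w /tube_img[cw _ _]; exact: tube_L.
Qed.

(** In the chart [c] the field [L] has constant components. *)
Lemma tube_L_smooth n (F : 'rV[R]_n -> 'rV[R]_4) : continuous F ->
  smooth_map_on [set z | cimg c (F z)] (fun z => Lvec g d c (cinv c (F z))).
Proof.
move=> cF j m.
have oZ : open [set z | cimg c (F z)].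
  by apply: open_comp (chart_open_img hc) => z _; exact: cF.
apply: Ck_ext (Ck_cst m _ ((delta_mx 0 1 : 'rV[R]_4) 0 j)) => // z.
by move=> /tube_img[cz _ _]; rewrite tube_L.
Qed.

Let slice t (y : 'rV[R]_2) := pt4 0 t y : 'rV[R]_4.
Let sN t y := Lvec g d c (cinv c (slice t y)).

Lemma slice_frame t a y : frame (slice t) a y = delta_mx 0 (rshift 2 a).
Proof.
rewrite delta_pt4; apply/rowP; elim/ind4 => [||i]; rewrite pt4E mxE.
- rewrite (_ : (fun _ => _) = fun=> 0); first exact: derive_cst.
  by apply/funext => w; rewrite /slice pt4E.
- rewrite (_ : (fun _ => _) = fun=> t); first exact: derive_cst.
  by apply/funext => w; rewrite /slice pt4E.
- rewrite (_ : (fun _ => _) = fun w : 'rV[R]_2 => w 0 i).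
    by rewrite /partial (@derive_val _ _ _ _ _ _ _ (is_derive_coord i _ _)).
  by apply/funext => w; rewrite /slice pt4E.
Qed.

Lemma slice_continuous t : continuous (slice t).
Proof.
move=> y; apply: continuous_row; elim/ind4 => [||i].
- rewrite (_ : (fun _ => _) = fun=> 0); first exact: cst_continuous.
  by apply/funext => w; rewrite /slice pt4E.
- rewrite (_ : (fun _ => _) = fun=> t); first exact: cst_continuous.
  by apply/funext => w; rewrite /slice pt4E.
- rewrite (_ : (fun _ => _) = fun w : 'rV[R]_2 => w 0 i); first exact: coord_continuous.
  by apply/funext => w; rewrite /slice pt4E.
Qed.

Lemma slice_first t y : first_form G (slice t) y = dnf_gs (G (slice t y)).
Proof. by apply/matrixP => a b; rewrite mxE !slice_frame ip_delta !mxE. Qed.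

(** The slices of the tube are the sections [f = 0], [fb = t], that is bumps of
    height zero, and their normal is [L]. *)
Lemma slice_expansion t y : cimg c (slice t y) -> null_expansion G (slice t) (sN t) y = 0.
Proof.
move=> Ix; have [cx hG] := tube_img Ix; rewrite proj3_pt4 => Dz.
have sh := tube_gr_smooth sk.
have gz : gr_good g d D h k (pt3 t y).
  by apply: (gr_good_flat hd hh sk Dz) => i; exact: tube_partial0.
have := bump_expansion hd hh sk sh gz marg 0.
set fb := bump 0 t y.
have sfb : smooth_on setT fb := bump_smooth 0 t y.
have fbE w : fb w = t by rewrite /fb /bump mul0r addr0.
have oT := ts_dom_open hh sk sfb.
have Ty : ts_dom D k fb y by rewrite /ts_dom /= /ts_z fbE.
have FE w : ts_dom D k fb w -> ts_F h k fb w = slice t w.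
  move=> [_ Dw]; rewrite /ts_F /gr_pt /gr_fun h0 //.
  by rewrite pt3_t pt3_y fbE.
have NE w : ts_dom D k fb w -> ts_N g d h k fb w = delta_mx 0 1.
  move=> Tw; have hGw := ts_form hd hh sk Tw.
  have df0 : ts_df h k fb w = 0.
    apply/rowP => i; rewrite !mxE /partial.
    rewrite (derive_ext_open _ oT Tw (g := fun=> 0)) ?derive_cst //.
    by move=> v [_ Dv]; rewrite /ts_f /gr_fun h0.
  have dfb0 : ts_dfb fb w = 0.
    by apply/rowP => i; rewrite !mxE /fb partial_bump mulr0 mul0r.
  have e0 w' gs B : sec_e w' gs B (0 : 'rV[R]_2) = 0 by rewrite /sec_e !mul0mx scaler0.
  rewrite /ts_N /sec_N df0 dfb0 !e0 /sec_eps.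
  have -> : ip (dnf_gs (ts_G g d h k fb w)) 0 0 = 0 by rewrite /ip !mul0mx mxE.
  rewrite oppr0 mul0r !scale0r !addr0 (dnf_LE hGw).
  have -> : angular (0 : 'rV[R]_2) = 0.
    by apply/rowP; elim/ind4 => [||i]; rewrite /angular pt4E !mxE.
  by rewrite addr0.
have oV : open [set w | ts_dom D k fb w /\ cimg c (slice t w)].
  apply: openI => //; apply: open_comp (chart_open_img hc) => w _.
  exact: slice_continuous.
rewrite (null_expansion_ext (metric_in g (dn_chart d k)) oV (F' := slice t) (N' := sN t)).
- rewrite /null_expansion => <-.
  have GE x : cimg c x -> G x = metric_in g (dn_chart d k) x.
    by move=> /(cimgP hc)[cx' _]; exact: (tube_metric hd hh sk cx').
  rewrite (chi_form_metric_ext _ (chart_open_img hc) Ix GE).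
  by rewrite (first_form_metric_ext (GE _ Ix)).
- by [].
- by move=> w [Tw _]; exact: FE.
- move=> w [Tw /tube_img[cw _ _]]; rewrite NE //.
  by rewrite /sN tube_L.
Qed.

Lemma tube_marginal_slice t : marginal_slice g (Lvec g d) c t.
Proof.
split; first exact: (@tube_L_smooth 2 (slice t) (@slice_continuous t)).
move=> y Iy; have [cy hG _] := tube_img Iy; split.
- by rewrite slice_first; exact: dnf_gs_posdef hG.
- move=> a; rewrite slice_frame tube_L // -{1}(dnf_LE hG) (dnf_ip_L hG).
  by rewrite mxE andbC mulr0.
- exact: slice_expansion.
Qed.

(** The first and second fundamental forms of the tube degenerate along [L], and
    their angular blocks are those of the slices sb = const. *)
Lemma tube_tangential : tangential_expansion_zero g (Lvec g d) c.
Proof.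
pose F (z : 'rV[R]_3) : 'rV[R]_4 := @row_mx R 1 1 3 0 z.
have Fl w i : F w 0 (@lshift 1 3 i) = 0 by rewrite /F (@row_mxEl R 1 1 3) mxE.
have Fr w i : F w 0 (@rshift 1 3 i) = w 0 i by rewrite /F (@row_mxEr R 1 1 3).
have cF : continuous F.
  move=> z; apply: continuous_row => j.
  rewrite -(@fintype.splitK 1 3 j); case: (@fintype.split 1 3 j) => i /=.
    rewrite (_ : (fun _ => _) = fun=> 0); first exact: cst_continuous.
    by apply/funext => w; rewrite Fl.
  rewrite (_ : (fun _ => _) = fun w : 'rV[R]_3 => w 0 i); first exact: coord_continuous.
  by apply/funext => w; rewrite Fr.
split; first exact: tube_L_smooth cF.
move=> z Iz E pE; rewrite -/(F z) in Iz.
have [cz hG _] := tube_img Iz.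
pose s (a : 'I_3) : 'I_4 := @rshift 1 3 a.
have s0 a : s a != 0 by [].
have fr a : frame F a z = delta_mx 0 (s a).
  apply/rowP => j; rewrite mxE.
  rewrite -(@fintype.splitK 1 3 j); case: (@fintype.split 1 3 j) => i /=.
    rewrite (_ : (fun w => _) = fun=> 0); last first.
      by apply/funext => w; rewrite Fl.
    have e : (@lshift 1 3 i == s a) = false by exact: (@eq_lrshift 1 3 i a).
    by rewrite /partial derive_cst mxE e andbF.
  rewrite (_ : (fun w => _) = fun w : 'rV[R]_3 => w 0 i); last first.
    by apply/funext => w; rewrite Fr.
  rewrite /partial (@derive_val _ _ _ _ _ _ _ (is_derive_coord i _ _)) !mxE.
  by have -> : (@rshift 1 3 i == s a) = (i == a) by exact: (@eq_rshift 1 3 i a).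
pose X := first_form G F z.
pose Y := chi_form G F (fun z => Lvec g d c (cinv c (F z))) z.
have XE a b : X a b = G (F z) (s a) (s b) by rewrite mxE !fr ip_delta.
have YE a b : Y a b = 2^-1 * partial 1 (fun x => G x (s b) (s a)) (F z).
  exact: (tube_chi_coord (s := s) a b Iz fr (tube_Lconst (cF z) Iz) s0).
have s1 : s 0 = 1 by exact: val_inj.
have GT x : cimg c x -> (G x)^T = G x by move=> /tube_img[_ hGx _]; exact: dnf_sym hGx.
have G1 x j : cimg c x -> j != 0 -> G x 1 j = 0.
  by move=> Ixx j0; rewrite -(GT _ Ixx) mxE tube_G1.
have X0 j : X 0 j = 0 by rewrite XE s1 G1.
have Xi i : X i 0 = 0 by rewrite XE s1 tube_G1.
have p0 i j : (forall x, cimg c x -> G x i j = 0) ->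
    partial 1 (fun x => G x i j) (F z) = 0.
  move=> Gij; rewrite /partial.
  by rewrite (derive_ext_open _ (chart_open_img hc) Iz Gij) derive_cst.
have Y0 j : Y 0 j = 0.
  by rewrite YE s1 p0 ?mulr0 // => x Ixx; exact: tube_G1.
have Yi i : Y i 0 = 0.
  by rewrite YE s1 p0 ?mulr0 // => x Ixx; exact: G1.
pose t := F z 0 1; pose y := @rsubmx R 1 2 2 (F z).
have Fz : F z = slice t y.
  apply/rowP; elim/ind4 => [||i]; rewrite pt4E //; last by rewrite /y [RHS]mxE.
  by rewrite -(Fl z 0); congr (F z 0 _); apply: val_inj.
have Iy : cimg c (slice t y) by rewrite -Fz.
have X' : @drsubmx R 1 2 1 2 X = first_form G (slice t) y.
  rewrite slice_first; apply/matrixP => a b; rewrite drsubmx_entry XE -Fz !mxE.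
  by congr (G _ _ _); apply: val_inj.
have Y' : @drsubmx R 1 2 1 2 Y = chi_form G (slice t) (sN t) y.
  apply/matrixP => a b; rewrite drsubmx_entry YE.
  rewrite (tube_chi_coord (s := fun a => rshift 2 a) a b Iy
    (fun a => slice_frame t a y) (tube_Lconst (@slice_continuous t y) Iy)) //.
  rewrite -Fz; congr (_ * partial _ _ _); apply/funext => x.
  by congr (G _ _ _); apply: val_inj.
have pX : posdef (E *m X *m E^T) by exact: pE.
suff : \tr (invmx (E *m X *m E^T) *m (E *m Y *m E^T)) = 0 by [].
rewrite (degenerate_restrict E X0 Xi) X' in pX *.
by rewrite (degenerate_restrict E Y0 Yi) Y' trace_plane //; exact: slice_expansion.
Qed.

End TubeChart.
End Tube.

(** * Vanishing of h and conclusion *)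

Lemma graph_null_zero (R : realType) (M S : topologicalType)
    (A : smooth_structure R 4 M) (AS : smooth_structure R 2 S)
    (g : lorentz_metric A) (T : time_orientation g)
    (d : dn_data R M S) (D : set (R * S)) (h : R -> S -> R)
    (hd : double_null T AS d) (hh : graph_function AS d D h) :
  null_hypersurface g (graph_hypersurface d D h) ->
  forall t x, D (t, x) -> h t x = 0.
Proof.
move=> nH; apply: (graph_zero_of_null hd hh) => t x k Dt sk kx sh _.
have Dz := (gr_domP D t sk kx).2 Dt.
have nD : \forall z \near pt3 t (cmap k x), gr_dom D k z.
  by apply: open_nbhs_nbhs; split => //; exact: (gr_dom_open hh sk).
by apply: filterS nD => z; exact: (null_gr_sq hd hh nH sk sh).
Qed.

(** Being spacelike is an open condition, so that near a point with vanishing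
    angular gradient marginality yields the null equation. *)
Lemma marginal_sections_zero (R : realType) (M S : topologicalType)
    (A : smooth_structure R 4 M) (AS : smooth_structure R 2 S)
    (g : lorentz_metric A) (T : time_orientation g)
    (d : dn_data R M S) (D : set (R * S)) (h : R -> S -> R)
    (hd : double_null T AS d) (hh : graph_function AS d D h) :
  (forall (W : set S) (f fb : S -> R),
      spacelike_section g AS d D h W f fb -> section_marginal g AS d W f fb) ->
  forall t x, D (t, x) -> h t x = 0.
Proof.
move=> marg; apply: (graph_zero_of_null hd hh) => t x k Dt sk kx sh p0.
have Dz := (gr_domP D t sk kx).2 Dt.
have nG : \forall z \near pt3 t (cmap k x), gr_good g d D h k z.
  apply: open_nbhs_nbhs; split; first exact: (gr_good_open hd hh sk sh).
  exact: (gr_good_flat hd hh sk Dz p0).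
apply: filterS nG => z; rewrite (pt3_eta z) => gz.
exact: (marginal_gr_sq hd hh sk sh gz marg).
Qed.

Lemma tube_foliation (R : realType) (M S : topologicalType)
    (A : smooth_structure R 4 M) (AS : smooth_structure R 2 S)
    (g : lorentz_metric A) (T : time_orientation g)
    (d : dn_data R M S) (D : set (R * S)) (h : R -> S -> R)
    (hd : double_null T AS d) (hh : graph_function AS d D h)
    (h0 : forall t x, D (t, x) -> h t x = 0) k :
  let H := graph_hypersurface d D h in
  smooth_chart AS k ->
  foliated_chart A H
    [set l | l !=set0 /\ exists t, l = H `&` [set p | dn_sb d p = t]]
    (tube_chart d D k).
Proof.
move=> H sk; have [sc Hc] := tube_slice hd hh h0 sk.
split=> [|l [_ [t ->]]]; first by split.
exists [set t]; first exact: countable1.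
rewrite setIAC Hc predeqE => q; rewrite /= pt4_1.
by split=> [[[cq q0] qt]|[cq [q0 qt]]]; split.
Qed.

Lemma tube_marginal (R : realType) (M S : topologicalType)
    (A : smooth_structure R 4 M) (AS : smooth_structure R 2 S)
    (g : lorentz_metric A) (T : time_orientation g)
    (d : dn_data R M S) (D : set (R * S)) (h : R -> S -> R)
    (hd : double_null T AS d) (hh : graph_function AS d D h)
    (h0 : forall t x, D (t, x) -> h t x = 0) :
  (forall (W : set S) (f fb : S -> R),
      spacelike_section g AS d D h W f fb -> section_marginal g AS d W f fb) ->
  marginal_tube T (graph_hypersurface d D h).
Proof.
move=> marg; set H := graph_hypersurface d D h.
split=> [p Hp|].
  have [k sk cp] := tube_chart_at AS Hp.
  by exists (tube_chart d D k) => //; exact: (tube_slice hd hh h0).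
exists [set l | l !=set0 /\ exists t, l = H `&` [set p | dn_sb d p = t]], (Lvec g d).
split; last first.
- move=> p Hp; have [k sk cp] := tube_chart_at AS Hp.
  exists (tube_chart d D k); split => //.
  + exact: (tube_foliation hd hh h0).
  + apply: continuous_in_subspaceT => q; rewrite inE => -[_ cq].
    have [hc _] := tube_chart_smooth hd hh sk.
    have E q' : cdom (tube_chart d D k) q' ->
        (delta_mx 0 1 : 'rV[R]_4) = Lvec g d (tube_chart d D k) q'.
      by move=> cq'; rewrite (tube_L hd hh sk cq').
    apply: (@continuous_ext_open R M 'rV[R]_4 _ (fun=> delta_mx 0 1) _ q
      (chart_open_dom hc) cq E).
    exact: cst_continuous.
  + by move=> q Hq cq; exact: (tube_future hd hh h0 sk Hq cq).
  + by move=> t; exact: (tube_marginal_slice hd hh h0 marg sk).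
- exact: Lvec_field hd.
- split.
  + by move=> l [].
  + rewrite predeqE => p; split=> [[l [_ [t ->]] []//]|Hp].
    exists (H `&` [set q | dn_sb d q = dn_sb d p]) => //.
    by split; [exists p | exists (dn_sb d p)].
  + move=> l l' [_ [t ->]] [_ [t' ->]] [p [[_ pt] [_ pt']]].
    by move: pt pt' => /= <- <-.
  + move=> p Hp; have [k sk cp] := tube_chart_at AS Hp.
    by exists (tube_chart d D k) => //; exact: (tube_foliation hd hh h0).
Qed.

Theorem theorem5p1 (R : realType) (M S : topologicalType)
    (A : smooth_structure R 4 M) (AS : smooth_structure R 2 S)
    (g : lorentz_metric A) (T : time_orientation g)
    (d : dn_data R M S) (D : set (R * S)) (h : R -> S -> R)
    (hd : double_null T AS d) (hh : graph_function AS d D h) :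
  let H := graph_hypersurface d D h in
  (null_hypersurface g H <-> (forall t x, D (t, x) -> h t x = 0)) /\
  ((forall (W : set S) (f fb : S -> R),
      spacelike_section g AS d D h W f fb -> section_marginal g AS d W f fb) ->
   [/\ null_hypersurface g H,
       forall t x, D (t, x) -> h t x = 0 &
       tangential_null_marginal_tube T H]).
Proof.
move=> H; split.
  by split=> [nH|h0]; [exact: (graph_null_zero hd hh nH) | exact: (tube_null hd hh h0)].
move=> marg; have h0 := marginal_sections_zero hd hh marg.
have nH := tube_null hd hh h0.
split=> //; split => //; first exact: (tube_marginal hd hh h0 marg).
exists (Lvec g d); first exact: Lvec_field hd.
move=> p Hp; have [k sk cp] := tube_chart_at AS Hp.
exists (tube_chart d D k); split => //.
- exact: (tube_slice hd hh h0).
- move=> q Hq cq; split; first exact: (tube_future hd hh h0 sk Hq cq).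
  by rewrite (tube_L hd hh sk cq) mxE.
- exact: (tube_tangential hd hh h0 marg sk).
Qed.
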